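(* Let $E$ be a stable and split additive functor from an admissible subcategory of the category of real or complex $C^*$-algebras to the category of abelian groups. Then $E$ is homotopy invariant.
   Context: $k=\mathbb{R}$ or $\mathbb{C}$ is the ground field; $\otimes$ is the minimal $C^*$-tensor product; $\mathcal{K}$ is the $C^*$-algebra (over $k$) of compact operators on the standard infinite-dimensional separable Hilbert space; $k^I=k[0,1]$ is the $C^*$-algebra of continuous $k$-valued functions on $I=[0,1]$. A subcategory $\mathcal{S}$ of the category of $C^*$-algebras over $k$ and $*$-homomorphisms is admissible if: (1) $k$ belongs to $\mathcal{S}$; (2) if $A$ is in $\mathcal{S}$ then so is $A\otimes k^I$; (3) if $A$ is in $\mathcal{S}$ then so is $A\otimes\mathcal{K}$; (4) if $0\to A\to B\to C\to0$ is a split exact sequence with $A$ and $C$ in $\mathcal{S}$, then so is $B$. $E$ is stable if for every $A$ the homomorphism $E(A)\to E(A\otimes\mathcal{K})$ induced by $a\mapsto a\otimes p$, $p$ a rank one projection, is an isomorphism. $E$ is split additive if for every split exact sequence $0\to A\to B\to C\to0$ in $\mathcal{S}$ the sequence $0\to E(A)\to E(B)\to E(C)\to0$ is split exact (so $E(B)\cong E(A)\oplus E(C)$). $E$ is homotopy invariant if the evaluations at $0$ and $1$, $A\otimes k[0,1]\to A$, induce the same homomorphism $E(A\otimes k[0,1])\to E(A)$ for all $A$ (equivalently homotopic $*$-homomorphisms induce equal maps). *)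

(* Defs.v *)
From HB Require Import structures.
From mathcomp Require Import all_boot all_order all_algebra.
From mathcomp Require Import all_classical all_reals all_analysis.
From mathcomp Require Import complex.

Set Implicit Arguments.
Unset Strict Implicit.
Unset Printing Implicit Defensive.

Import Order.TTheory GRing.Theory Num.Theory.
Import numFieldNormedType.Exports.

Local Open Scope classical_set_scope.
Local Open Scope ring_scope.

Variant ground (R : realType) := RealScalars | ComplexScalars.
Arguments RealScalars {R}.
Arguments ComplexScalars {R}.

Definition scalars (R : realType) (k : ground R) : numFieldType :=
  match k with
  | RealScalars => R : numFieldType
  | ComplexScalars => (complex R) : numFieldType
  end.
Coercion scalars : ground >-> Num.NumField.type.

Definition sconj (R : realType) (k : ground R) : k -> k :=
  match k return scalars k -> scalars k with
  | RealScalars => fun x => x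
  | ComplexScalars => fun z => conjc z
  end.
Arguments sconj {R k} _.

(* Real and complex C*-algebras are treated uniformly: norms are valued in the
   nonnegative elements of the ground field k, as in [normedModType]. *)

(* Inner products are linear in the first variable. *)
Record hilbert (R : realType) (k : ground R) := Hilbert {
  hcarrier :> completeNormedModType k;
  ip : hcarrier -> hcarrier -> k;
  ip_linear : forall (c : k) x y z, ip (c *: x + y) z = c * ip x z + ip y z;
  ip_conj : forall x y, ip y x = sconj (ip x y);
  ip_norm : forall x, ip x x = `|x| ^+ 2 }.

Record banach_star_alg (R : realType) (k : ground R) := BanachStarAlg {
  acarrier :> completeNormedModType k;
  amul : acarrier -> acarrier -> acarrier;
  astar : acarrier -> acarrier;
  amulA : forall a b c, amul a (amul b c) = amul (amul a b) c;
  amul_linearl : forall (c : k) a b d,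
    amul (c *: a + b) d = c *: amul a d + amul b d;
  amul_linearr : forall (c : k) a b d,
    amul d (c *: a + b) = c *: amul d a + amul d b;
  astar_linear : forall (c : k) a b,
    astar (c *: a + b) = sconj c *: astar a + astar b;
  astarM : forall a b, astar (amul a b) = amul (astar b) (astar a);
  astarK : forall a, astar (astar a) = a;
  amul_norm : forall a b, `|amul a b| <= `|a| * `|b| }.

Record representation (R : realType) (k : ground R) (A : banach_star_alg k)
    (H : hilbert k) := Representation {
  rep_op :> A -> {linear H -> H};
  rep_bounded : forall a, continuous (rep_op a);
  rep_linear : forall (c : k) a b x,
    rep_op (c *: a + b) x = c *: rep_op a x + rep_op b x;
  rep_mul : forall a b x, rep_op (amul a b) x = rep_op a (rep_op b x);
  rep_star : forall a x y, ip (rep_op a x) y = ip x (rep_op (astar a) y) }.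

Definition is_opnorm (R : realType) (k : ground R) (H : hilbert k)
    (T : H -> H) (n : k) : Prop :=
  [/\ 0 <= n, forall x, `|T x| <= n * `|x| &
      forall c : k, 0 <= c -> (forall x, `|T x| <= c * `|x|) -> n <= c].

Definition isometric_rep (R : realType) (k : ground R) (A : banach_star_alg k)
    (H : hilbert k) (pi : representation A H) : Prop :=
  forall a, is_opnorm (pi a) `|a|.

(* A C*-algebra over k is, up to isometric *-isomorphism, a norm-closed
   *-subalgebra of the bounded operators on a Hilbert space over k; closedness
   is the completeness of the carrier.  Over the reals the C*-identity alone
   would not suffice (it holds for the complex numbers with trivial
   involution). *)
Record cstar (R : realType) (k : ground R) := Cstar {
  cs_alg :> banach_star_alg k;
  cs_identity : forall a : cs_alg, `|amul (astar a) a| = `|a| ^+ 2;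
  cs_concrete : exists (H : hilbert k) (pi : representation cs_alg H),
    isometric_rep pi }.

Record star_hom (R : realType) (k : ground R) (A B : cstar k) := StarHom {
  sh_fun :> {linear A -> B};
  sh_mul : forall a b, sh_fun (amul a b) = amul (sh_fun a) (sh_fun b);
  sh_star : forall a, sh_fun (astar a) = astar (sh_fun a) }.

Definition sh_id (R : realType) (k : ground R) (A : cstar k) : star_hom A A :=
  @StarHom R k A A (idfun : {linear A -> A})
    (fun _ _ => erefl) (fun _ => erefl).

Program Definition sh_comp (R : realType) (k : ground R) (A B C : cstar k)
    (g : star_hom B C) (f : star_hom A B) : star_hom A C :=
  @StarHom R k A C (g \o f : {linear A -> C}) _ _.
Next Obligation. by move=> R k A B C g f a b /=; rewrite !sh_mul. Qed.
Next Obligation. by move=> R k A B C g f a /=; rewrite !sh_star. Qed.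

Definition split_exact_cstar (R : realType) (k : ground R) (A B C : cstar k)
    (i : star_hom A B) (q : star_hom B C) : Prop :=
  [/\ injective i, range i = [set b | q b = 0] &
      exists s : star_hom C B, forall c, q (s c) = c].

(* Formal sums [:: (x_1, y_1); ...; (x_n, y_n)] stand for the elements
   x_1 (x) y_1 + ... + x_n (x) y_n of an algebraic tensor product.
   [tsqnorm] is the squared norm of the tensor product of Hilbert spaces. *)
Definition tsqnorm (R : realType) (k : ground R) (H1 H2 : hilbert k)
    (s : seq (H1 * H2)) : k :=
  \sum_(u <- s) \sum_(v <- s) ip u.1 v.1 * ip u.2 v.2.

Definition tact (R : realType) (k : ground R) (A B : cstar k)
    (H1 H2 : hilbert k) (pi : representation A H1) (sg : representation B H2)
    (z : seq (A * B)) (s : seq (H1 * H2)) : seq (H1 * H2) :=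
  [seq (pi w.1 u.1, sg w.2 u.2) | w <- z, u <- s].

(* The operator norm of (pi (x) sg)(z) is at most c; it is enough to test on
   the algebraic tensor product of H1 and H2, which is dense in the Hilbert
   space tensor product. *)
Definition tensor_rep_le (R : realType) (k : ground R) (A B : cstar k)
    (H1 H2 : hilbert k) (pi : representation A H1) (sg : representation B H2)
    (z : seq (A * B)) (c : k) : Prop :=
  forall s : seq (H1 * H2), tsqnorm (tact pi sg z s) <= c ^+ 2 * tsqnorm s.

(* The minimal (spatial) norm: the supremum of the norms of (pi (x) sg)(z) over
   all representations pi of A and sg of B. *)
Definition is_min_norm (R : realType) (k : ground R) (A B : cstar k)
    (z : seq (A * B)) (n : k) : Prop :=
  [/\ 0 <= n,
      forall (H1 H2 : hilbert k) (pi : representation A H1)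
        (sg : representation B H2), tensor_rep_le pi sg z n &
      forall c : k, 0 <= c ->
        (forall (H1 H2 : hilbert k) (pi : representation A H1)
          (sg : representation B H2), tensor_rep_le pi sg z c) -> n <= c].

(* T, with the elementary tensors a (x) b := iota a b, is the minimal tensor
   product of A and B, i.e. the completion of the algebraic tensor product for
   the minimal norm. *)
Record is_min_tensor (R : realType) (k : ground R) (A B T : cstar k)
    (iota : A -> B -> T) : Prop := IsMinTensor {
  mt_linearl : forall (c : k) a a' b,
    iota (c *: a + a') b = c *: iota a b + iota a' b;
  mt_linearr : forall (c : k) a b b',
    iota a (c *: b + b') = c *: iota a b + iota a b';
  mt_mul : forall a a' b b',
    iota (amul a a') (amul b b') = amul (iota a b) (iota a' b');
  mt_star : forall a b, iota (astar a) (astar b) = astar (iota a b);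
  mt_dense :
    dense (range (fun z : seq (A * B) => \sum_(w <- z) iota w.1 w.2));
  mt_norm : forall z : seq (A * B),
    is_min_norm z `|\sum_(w <- z) iota w.1 w.2| }.

(* A is isomorphic to the ground field k. *)
Definition is_ground_algebra (R : realType) (k : ground R) (A : cstar k)
    : Prop :=
  exists u : k -> A,
    [/\ bijective u, forall c d e : k, u (c * d + e) = c *: u d + u e,
        forall c d, u (c * d) = amul (u c) (u d) &
        forall c, u (sconj c) = astar (u c)].

(* CI, with ev f t the value of f at t, is the algebra of continuous k-valued
   functions on [0, 1] with the sup norm; ev f t is irrelevant for t outside
   of [0, 1]. *)
Record is_interval_algebra (R : realType) (k : ground R) (CI : cstar k)
    (ev : CI -> R -> k) : Prop := IsIntervalAlgebra {
  ia_linear : forall (c : k) f g t, t \in `[0, 1] ->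
    ev (c *: f + g) t = c * ev f t + ev g t;
  ia_mul : forall f g t, t \in `[0, 1] -> ev (amul f g) t = ev f t * ev g t;
  ia_star : forall f t, t \in `[0, 1] -> ev (astar f) t = sconj (ev f t);
  ia_continuous : forall f, {within `[0, 1], continuous (ev f)};
  ia_surj : forall g : R -> k, {within `[0, 1], continuous g} ->
    exists f, forall t, t \in `[0, 1] -> ev f t = g t;
  ia_norm_ge : forall f t, t \in `[0, 1] -> `|ev f t| <= `|f|;
  ia_norm_le : forall f (c : k), 0 <= c ->
    (forall t, t \in `[0, 1] -> `|ev f t| <= c) -> `|f| <= c }.

Definition infinite_dimensional (R : realType) (k : ground R) (H : hilbert k)
    : Prop :=
  forall (n : nat) (v : 'I_n -> H),
    exists x : H, forall c : 'I_n -> k, x <> \sum_(i < n) c i *: v i.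

Definition separable (R : realType) (k : ground R) (H : hilbert k) : Prop :=
  exists D : set H, countable D /\ dense D.

Definition compact_operator (R : realType) (k : ground R) (H : hilbert k)
    (T : {linear H -> H}) : Prop :=
  compact (closure (T @` [set x : H | `|x| <= 1])).

(* rho identifies KK with the algebra of compact operators on H. *)
Definition is_compact_algebra (R : realType) (k : ground R) (H : hilbert k)
    (KK : cstar k) (rho : representation KK H) : Prop :=
  isometric_rep rho /\
  forall T : {linear H -> H},
    compact_operator T <-> exists a, forall x, rho a x = T x.

Definition rank_one_projection (R : realType) (k : ground R) (H : hilbert k)
    (KK : cstar k) (rho : representation KK H) (p : KK) : Prop :=
  [/\ amul p p = p, astar p = p &
      exists v : H, v != 0 /\
        range (rho p) = range (fun c : k => c *: v)].

(* The objects of the full subcategory of C*-algebras determined by S, which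
   need not be closed under isomorphism. *)
Record sobj (R : realType) (k : ground R) (S : cstar k -> Prop) := SObj {
  obj :> cstar k;
  objP : S obj }.

(* Tensor products and k itself are only determined up to isomorphism:
   belonging to S means that some isomorphic copy does. *)
Record admissible (R : realType) (k : ground R) (KK CI : cstar k)
    (S : cstar k -> Prop) : Prop := Admissible {
  adm_ground : exists A : sobj S, is_ground_algebra A;
  adm_interval : forall A : sobj S, exists (T : sobj S) (iota : A -> CI -> T),
    is_min_tensor iota;
  adm_compact : forall A : sobj S, exists (T : sobj S) (iota : A -> KK -> T),
    is_min_tensor iota;
  adm_extension : forall (A C : sobj S) (B : cstar k)
    (i : star_hom A B) (q : star_hom B C), split_exact_cstar i q -> S B }.

Record ab_functor (R : realType) (k : ground R) (S : cstar k -> Prop) :=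
    AbFunctor {
  fob :> sobj S -> zmodType;
  fmap : forall A B : sobj S, star_hom A B -> {additive fob A -> fob B};
  fmap_id : forall (A : sobj S) x, fmap (sh_id A) x = x;
  fmap_comp : forall (A B C : sobj S) (g : star_hom B C) (f : star_hom A B) x,
    fmap (sh_comp g f) x = fmap g (fmap f x) }.
Arguments fmap {R k S} E {A B} f : rename.

Definition stable (R : realType) (k : ground R) (KK : cstar k) (p : KK)
    (S : cstar k -> Prop) (E : ab_functor S) : Prop :=
  forall (A T : sobj S) (iota : A -> KK -> T), is_min_tensor iota ->
  forall j : star_hom A T, (forall a, j a = iota a p) ->
  bijective (fmap E j).

Definition split_exact_ab (U V W : zmodType) (i : {additive U -> V})
    (q : {additive V -> W}) : Prop :=
  [/\ injective i, range i = [set v | q v = 0] &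
      exists s : {additive W -> V}, forall w, q (s w) = w].

Definition split_additive (R : realType) (k : ground R) (S : cstar k -> Prop)
    (E : ab_functor S) : Prop :=
  forall (A B C : sobj S) (i : star_hom A B) (q : star_hom B C),
    split_exact_cstar i q -> split_exact_ab (fmap E i) (fmap E q).

Definition homotopy_invariant (R : realType) (k : ground R) (CI : cstar k)
    (ev : CI -> R -> k) (S : cstar k -> Prop) (E : ab_functor S) : Prop :=
  forall (A T : sobj S) (iota : A -> CI -> T), is_min_tensor iota ->
  forall e0 e1 : star_hom T A,
    (forall a f, e0 (iota a f) = ev f 0 *: a) ->
    (forall a f, e1 (iota a f) = ev f 1 *: a) ->
    fmap E e0 =1 fmap E e1.

(* Main.v *)
Require Import Defs.
From HB Require Import structures.
From mathcomp Require Import all_boot all_order all_algebra.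
From mathcomp Require Import all_classical all_reals all_analysis.
From mathcomp Require Import complex.
From mathcomp Require Import ring lra zify.

Set Implicit Arguments.
Unset Strict Implicit.
Unset Printing Implicit Defensive.

Import Order.TTheory GRing.Theory Num.Theory.
Import numFieldNormedType.Exports.

Local Open Scope classical_set_scope.
Local Open Scope ring_scope.

(* Evaluation at the dyadic points i/2^n and (i+1)/2^n, for all n and i < 2^n,
   gives two diagonal *-homomorphisms from A (x) C[0,1] to the multipliers of
   A (x) K whose difference takes values in A (x) K, because the two points
   come together.  By stability and split additivity such a pair (x, y) of
   diagonals induces a map Q(x, y) on E, defined through the split extension
   of A (x) C[0,1] by A (x) K generated by x; Q is additive both for
   concatenation, Q(x, y) + Q(y, z) = Q(x, z), and for orthogonal sums, and
   does not change under a reindexing of the diagonal entries.  Halving all the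
   intervals does not change Q: with m the midpoints, Q(x, m) + Q(m, y) =
   Q(x, y).  But halving turns the family of all dyadic intervals into itself
   without the interval [0,1] of level 0, which therefore contributes nothing,
   and its contribution is E(ev_0) - E(ev_1). *)

(** * Scalars *)

(** A diagonal of evaluations does not tend to 0, so it defines only a multiplier of [A (x) K], and
    [E] need not be defined on the multiplier algebra. A split extension of objects of [S], on the
    other hand, lies in [S]: this is why each comparison takes place among pairs (t, multiplier of t
    plus an element of [A (x) K]), where both diagonals become sections of one quotient map.
    Multipliers appear as operators on the space of an isometric representation, strong limits of
    finite diagonals.

    The minimal norm is a supremum over all representations, over R as well as over C, so estimates
    must hold in every representation and cannot rest on complex spectral theory. They come from one
    fact: for [|a| < 1] the defect [1 - a^* a] is the square of a self-adjoint [1 - q].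

    [Q] is never formed as a function: an equation that fixes its value in one extension is carried
    over to another. Reindexings have to fix the index 0, where stability puts the corner of [p];
    hence index 0 carries no evaluation. *)

Definition of_real (R : realType) (k : ground R) : R -> k :=
  match k return R -> scalars k with
  | RealScalars => fun x => x
  | ComplexScalars => fun x => (x%:C)%C
  end.
Arguments of_real {R k} _.

Definition real_part (R : realType) (k : ground R) : k -> R :=
  match k return scalars k -> R with
  | RealScalars => fun x => x
  | ComplexScalars => fun z => complex.Re z
  end.
Arguments real_part {R k} _.

Section Scalars.
Context {R : realType} {k : ground R}.
Implicit Types (x y z : k) (a b : R).

Lemma of_realD a b : of_real (a + b) = of_real a + of_real b :> k.
Proof. by rewrite /of_real; case: k => //=; exact: rmorphD. Qed.

Lemma of_realM a b : of_real (a * b) = of_real a * of_real b :> k.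
Proof. by rewrite /of_real; case: k => //=; exact: rmorphM. Qed.

Lemma of_real0 : of_real 0 = 0 :> k.
Proof. by rewrite /of_real; case: k. Qed.

Lemma of_real1 : of_real 1 = 1 :> k.
Proof. by rewrite /of_real; case: k. Qed.

Lemma of_realN a : of_real (- a) = - of_real a :> k.
Proof. by apply/eqP; rewrite -addr_eq0 -of_realD addNr of_real0. Qed.

Lemma of_real_le a b : (of_real a <= of_real b :> k) = (a <= b).
Proof. by rewrite /of_real; case: k => //=; exact: lecR. Qed.

Lemma of_real_inj : injective (@of_real R k).
Proof.
by move=> a b ab; apply/eqP; rewrite eq_le -!of_real_le ab lexx.
Qed.

Lemma of_real_lt a b : (of_real a < of_real b :> k) = (a < b).
Proof. by rewrite !lt_neqAle of_real_le (inj_eq of_real_inj). Qed.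

Lemma real_partK z : z \is Num.real -> of_real (real_part z) = z.
Proof.
rewrite /of_real /real_part; case: k z => //= z.
by case: z => a b; rewrite complex_real => /eqP ->.
Qed.

Lemma sconjD x y : sconj (x + y) = sconj x + sconj y.
Proof. by rewrite /sconj; case: k x y => //= x y; exact: rmorphD. Qed.

Lemma sconjM x y : sconj (x * y) = sconj x * sconj y.
Proof. by rewrite /sconj; case: k x y => //= x y; exact: rmorphM. Qed.

Lemma sconjK : involutive (@sconj R k).
Proof. by rewrite /sconj; case: k => //= z; exact: conjcK. Qed.

Lemma sconj_of_real a : sconj (of_real a : k) = of_real a.
Proof.
by rewrite /sconj /of_real; case: k => //=; rewrite oppr0.
Qed.

Lemma sconj_real x : x \is Num.real -> sconj x = x.
Proof. by move/real_partK => <-; rewrite sconj_of_real. Qed.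

Lemma sconj0 : sconj (0 : k) = 0.
Proof. by rewrite -of_real0 sconj_of_real. Qed.

Lemma sconj1 : sconj (1 : k) = 1.
Proof. by rewrite -of_real1 sconj_of_real. Qed.

Lemma sconjN x : sconj (- x) = - sconj x.
Proof. by apply/eqP; rewrite -addr_eq0 -sconjD addNr sconj0. Qed.

Lemma mul_sconj x : x * sconj x = `|x| ^+ 2.
Proof.
rewrite /sconj; case: k x => //= x; last by rewrite sqr_normc.
by rewrite real_normK ?num_real// expr2.
Qed.

Lemma norm_sconj x : `|sconj x| = `|x|.
Proof.
apply/eqP; rewrite -(@eqrXn2 _ 2)//; apply/eqP.
by rewrite -!mul_sconj sconjK mulrC.
Qed.

Lemma scalar_arch x : 0 < x -> exists n, n.+1%:R^-1 < x.
Proof.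
move=> x0; have xr : x \is Num.real by rewrite realE (ltW x0).
rewrite -(real_partK xr) in x0 *; set a := real_part x in x0 *.
rewrite -of_real0 of_real_lt in x0.
pose n := Num.truncn a^-1; exists n.
have -> : (n.+1%:R : k) = of_real n.+1%:R.
  by elim: n.+1 => [|m IH]; rewrite ?of_real0// !mulrS of_realD -IH of_real1.
rewrite -[_^-1]mulr1 ltr_pdivrMl; last first.
  by rewrite -of_real0 of_real_lt ltr0n.
rewrite -of_realM -of_real1 of_real_lt -ltr_pdivrMr// div1r.
by rewrite truncnS_gt.
Qed.

Lemma scalar_sqrt x : 0 <= x -> exists2 y, 0 <= y & y ^+ 2 = x.
Proof.
move=> x0; have xr : x \is Num.real by rewrite realE x0.
rewrite -(real_partK xr) in x0 *; set a := real_part x in x0 *.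
rewrite -of_real0 of_real_le in x0.
exists (of_real (Num.sqrt a)); first by rewrite -of_real0 of_real_le sqrtr_ge0.
by rewrite expr2 -of_realM -expr2 sqr_sqrtr.
Qed.

(** [k] may be complex, so the infimum is taken among the real numbers [a] with [P (of_real a)]. The
    third hypothesis, closure of [P] under approximation from above, is what makes it attained. *)
Lemma scalar_least (P : k -> Prop) (c0 : k) :
  0 <= c0 -> P c0 -> (forall c, 0 <= c -> (forall e, 0 < e -> P (c + e)) -> P c) ->
  (forall c d, 0 <= c -> c <= d -> P c -> P d) ->
  exists c, [/\ 0 <= c, P c & forall d, 0 <= d -> P d -> c <= d].
Proof.
move=> c00 Pc0 Pcl Pup.
pose E : set R := [set a | 0 <= a /\ P (of_real a)].
have rp (c : k) : 0 <= c -> of_real (real_part c) = c.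
  by move=> cge; rewrite real_partK// realE cge.
have rp0 (c : k) : 0 <= c -> 0 <= real_part c.
  by move=> cge; rewrite -of_real_le rp ?of_real0.
have E0 : E !=set0 by exists (real_part c0); rewrite /E /= rp// rp0.
have Elb : lbound E 0 by move=> a [].
have Ei : has_inf E by split => //; exists 0.
have i0 : 0 <= inf E by apply: lb_le_inf.
exists (of_real (inf E)); split.
- by rewrite -of_real0 of_real_le.
- apply: Pcl => [|e e0]; first by rewrite -of_real0 of_real_le.
  have er := rp _ (ltW e0).
  have : 0 < real_part e by rewrite -of_real_lt er of_real0.
  move=> re0; have [a [a0 Pa] ae] := inf_adherent re0 Ei.
  apply: Pup Pa; first by rewrite -of_real0 of_real_le.
  by rewrite -er -of_realD of_real_le ltW.
- move=> d d0 Pd; rewrite -(rp _ d0) of_real_le.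
  by apply: ge_inf; [exists 0|rewrite /E /= rp// rp0].
Qed.

(** Monotone convergence in [R], kept in Cauchy form: the increments [s n - s m] will bound
    distances between the terms of other sequences. *)
Lemma bounded_monotone_cauchy (s : nat -> k) (c : k) :
  (forall n, 0 <= s n) -> (forall n, s n <= s n.+1) -> (forall n, s n <= c) ->
  forall e, 0 < e -> exists N, forall m n, (N <= m)%N -> (m <= n)%N -> s n - s m <= e.
Proof.
move=> s0 sS sc e e0.
have rp (x : k) : 0 <= x -> of_real (real_part x) = x.
  by move=> x0; rewrite real_partK// realE x0.
have mono m n : (m <= n)%N -> s m <= s n.
  by move/subnK => <-; elim: (n - m)%N => // i /le_trans; apply; rewrite addSn.
pose t n := real_part (s n).
have tE n : of_real (t n) = s n by rewrite rp.
have [l tl] : exists l : R, t @ \oo --> l.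
  apply/cvg_ex; apply: nondecreasing_is_cvgn.
    by move=> m n mn; rewrite -of_real_le !tE mono.
  exists (real_part c) => _ [n _ <-]; rewrite -of_real_le tE rp//.
  by rewrite (le_trans (s0 0%N)).
have er := rp _ (ltW e0).
have e20 : 0 < real_part e / 2 by rewrite divr_gt0// -of_real_lt er of_real0.
move/cvgrPdist_le: tl => /(_ _ e20) [N _ HN].
exists N => m n Nm mn.
rewrite -!tE -er -of_realN -of_realD of_real_le.
have := HN m Nm; have := HN n (leq_trans Nm mn) => /=.
rewrite !ler_norml; lra.
Qed.

End Scalars.

(** * Sequences in normed modules *)

Section NormedSequences.
Context {R : realType} {k : ground R}.
Implicit Types (V W : normedModType k).

Lemma cvg_seqP V (u : nat -> V) (l : V) :
  u @ \oo --> l <->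
  forall e, 0 < e -> exists N, forall n, (N <= n)%N -> `|l - u n| <= e.
Proof.
split=> [/cvgrPdist_le ul e e0|ul].
  by have [N _ HN] := ul e e0; exists N => n Nn; exact: HN.
by apply/cvgrPdist_le => e e0; have [N HN] := ul e e0; exists N.
Qed.

Lemma cvg_seq_unique V (u : nat -> V) (l m : V) :
  u @ \oo --> l -> u @ \oo --> m -> l = m.
Proof. by move=> ul um; exact: (cvg_unique (@norm_hausdorff _ V) ul um). Qed.

Lemma cauchy_seq_cvg (V : completeNormedModType k) (u : nat -> V) :
  (forall e, 0 < e -> exists N, forall m n, (N <= m)%N -> (m <= n)%N ->
    `|u n - u m| <= e) ->
  exists l : V, u @ \oo --> l.
Proof.
move=> uC; apply/cvg_ex; apply/cauchy_cvgP/cauchyP => e e0.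
have e20 : 0 < e / 2 by rewrite divr_gt0.
have [N HN] := uC _ e20; exists (u N); exists N => // n /= Nn.
rewrite -ball_normE /= distrC (le_lt_trans (HN _ _ _ Nn))//.
by rewrite ltr_pdivrMr// ltr_pMr// ltr1n.
Qed.

(** A Cauchy filter contains a ball of radius [1 / (n + 1)] for each [n]; the centres form a Cauchy
    sequence, whose limit is that of the filter. The carriers [hsum] and [oa_carrier] are shown
    complete in this way. *)
Lemma seq_complete V :
  (forall u : nat -> V,
    (forall e, 0 < e -> exists N, forall m n, (N <= m)%N -> (m <= n)%N ->
      `|u n - u m| <= e) -> exists l : V, u @ \oo --> l) ->
  forall F : set_system V, ProperFilter F -> cauchy F -> cvg F.
Proof.
move=> Vc F FF /cauchyP Fc.
have /choice [u Fu] : forall n, exists x : V, F (ball x (n.+1%:R^-1 : k)).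
  by move=> n; apply: Fc; rewrite invr_gt0 ltr0n.
have near_u n m e : (n.+1%:R^-1 < e / 2 :> k) -> (n <= m)%N -> `|u m - u n| <= e.
  move=> ne nm; have [x [xn xm]] := filter_ex (filterI (Fu n) (Fu m)).
  move: xn xm; rewrite -!ball_normE /= => xn xm.
  rewrite (le_trans (ler_distD x _ _))// [e]splitr lerD//.
    apply/ltW/(lt_trans xm)/(le_lt_trans _ ne).
    by rewrite lef_pV2 ?posrE ?ltr0n// ler_nat ltnS.
  by rewrite distrC; exact/ltW/(lt_trans xn).
have [|l ul] := Vc u.
  move=> e e0; have e40 : 0 < e / 2 / 2 by rewrite !divr_gt0.
  have [N HN] := scalar_arch e40; exists N => m n Nm mn.
  rewrite (le_trans (ler_distD (u N) _ _))// [e]splitr lerD//.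
    by apply: near_u => //; exact: leq_trans mn.
  by rewrite distrC; exact: near_u.
apply/cvg_ex; exists l; apply/cvgrPdist_lt => e e0.
have e20 : 0 < e / 2 by rewrite divr_gt0.
have [N HN] := scalar_arch e20.
have [N' HN'] := (cvg_seqP u l).1 ul _ e20.
apply: filterS (Fu (maxn N N')) => x; rewrite -ball_normE /= => xu.
rewrite (le_lt_trans (ler_distD (u (maxn N N')) _ _))// [e]splitr ler_ltD//.
  exact/HN'/leq_maxr.
apply: (lt_trans xu); apply: le_lt_trans HN.
by rewrite lef_pV2 ?posrE ?ltr0n// ler_nat ltnS leq_maxl.
Qed.

Lemma scalar_squeeze0 V (x : V) :
  (forall e : k, 0 < e -> `|x| <= e) -> x = 0.
Proof.
move=> xe; apply/eqP; rewrite -normr_le0.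
by apply/ler_addgt0Pr => e e0; rewrite add0r xe.
Qed.

Lemma cvg_norm_le V (u : nat -> V) (l : V) (c : k) :
  u @ \oo --> l -> (exists N, forall n, (N <= n)%N -> `|u n| <= c) -> `|l| <= c.
Proof.
move=> /cvg_seqP ul [M uc]; apply/ler_addgt0Pr => e e0.
have [N HN] := ul e e0.
rewrite -(subrK (u (maxn M N)) l) (le_trans (ler_normD _ _))// addrC lerD//.
  exact/uc/leq_maxl.
exact/HN/leq_maxr.
Qed.

Lemma cvg_bounded_linear V W (f : V -> W) (C : k) (u : nat -> V) (l : V) :
  (forall x y, f (x - y) = f x - f y) -> 0 <= C ->
  (forall x, `|f x| <= C * `|x|) ->
  u @ \oo --> l -> (fun n => f (u n)) @ \oo --> f l.
Proof.
move=> fB C0 fC /cvg_seqP ul; apply/cvg_seqP => e e0.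
(* [C] may be 0, so the division is by [C + 1]. *)
have C1 : 0 < C + 1 by rewrite ltr_wpDl.
have eC : 0 < e / (C + 1) by rewrite divr_gt0.
have [N HN] := ul _ eC; exists N => n Nn; rewrite -fB (le_trans (fC _))//.
apply: (@le_trans _ _ ((C + 1) * `|l - u n|)).
  by rewrite ler_wpM2r// lerDl.
by rewrite mulrC -ler_pdivlMr// HN.
Qed.

End NormedSequences.

(** * Hilbert spaces *)

(** The scalar identity behind [ip_sub_proj]: [a], [b], [b'], [n] stand for [ip x x], [ip x y],
    [ip y x], [ip y y]. *)
Lemma proj_identity (F : fieldType) (a b b' n : F) : n != 0 ->
  a - b' / n * b - (b / n * b' - b / n * (b' / n * n)) = a - b * b' / n.
Proof. by move=> n0; field. Qed.

Section InnerProduct.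
Context {R : realType} {k : ground R} {H : hilbert k}.
Implicit Types (x y z : H) (c : k).

Lemma ipDl x y z : ip (x + y) z = ip x z + ip y z.
Proof. by have := ip_linear 1 x y z; rewrite scale1r mul1r. Qed.

Lemma ip0l z : ip (0 : H) z = 0.
Proof. by apply: (addrI (ip 0 z)); rewrite -ipDl !addr0. Qed.

Lemma ipZl c x z : ip (c *: x) z = c * ip x z.
Proof. by have := ip_linear c x 0 z; rewrite ip0l !addr0. Qed.

Lemma ipNl x z : ip (- x) z = - ip x z.
Proof. by rewrite -scaleN1r ipZl mulN1r. Qed.

Lemma ipBl x y z : ip (x - y) z = ip x z - ip y z.
Proof. by rewrite ipDl ipNl. Qed.

Lemma ipDr x y z : ip z (x + y) = ip z x + ip z y.
Proof. by rewrite ip_conj ipDl sconjD -!ip_conj. Qed.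

Lemma ip0r z : ip z (0 : H) = 0.
Proof. by rewrite ip_conj ip0l sconj0. Qed.

Lemma ipZr c x z : ip z (c *: x) = sconj c * ip z x.
Proof. by rewrite ip_conj ipZl sconjM -ip_conj. Qed.

Lemma ipNr x z : ip z (- x) = - ip z x.
Proof. by rewrite ip_conj ipNl sconjN -ip_conj. Qed.

Lemma ipBr x y z : ip z (x - y) = ip z x - ip z y.
Proof. by rewrite ipDr ipNr. Qed.

Lemma ip_suml (I : Type) (r : seq I) (P : pred I) (F : I -> H) z :
  ip (\sum_(i <- r | P i) F i) z = \sum_(i <- r | P i) ip (F i) z.
Proof.
by elim/big_rec2: _ => [|i u v _ <-]; rewrite ?ip0l ?ipDl.
Qed.

Lemma ip_sumr (I : Type) (r : seq I) (P : pred I) (F : I -> H) z :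
  ip z (\sum_(i <- r | P i) F i) = \sum_(i <- r | P i) ip z (F i).
Proof.
by elim/big_rec2: _ => [|i u v _ <-]; rewrite ?ip0r ?ipDr.
Qed.

Lemma ip_ge0 x : 0 <= ip x x.
Proof. by rewrite ip_norm exprn_ge0. Qed.

Lemma ip_eq0 x : ip x x = 0 -> x = 0.
Proof. by move/eqP; rewrite ip_norm sqrf_eq0 normr_eq0 => /eqP. Qed.

Lemma ip_ext x y : (forall z, ip x z = ip y z) -> x = y.
Proof.
move=> xy; apply/eqP; rewrite -subr_eq0; apply/eqP/ip_eq0.
by rewrite ipBl xy subrr.
Qed.

Lemma norm_le_of_ip x y : ip x x <= ip y y -> `|x| <= `|y|.
Proof. by rewrite !ip_norm ler_pXn2r// nnegrE. Qed.

Lemma ip_sub_proj x y : y != 0 ->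
  ip (x - (ip x y / ip y y) *: y) (x - (ip x y / ip y y) *: y) =
    ip x x - `|ip x y| ^+ 2 / ip y y.
Proof.
move=> y0; have nyy : ip y y != 0.
  by apply/negP => /eqP /ip_eq0 y00; rewrite y00 eqxx in y0.
have yr : sconj (ip y y) = ip y y by rewrite -ip_conj.
rewrite ipBl !ipBr !ipZl !ipZr (ip_conj x y) -mul_sconj.
rewrite sconjM.
have -> : sconj (ip y y)^-1 = (ip y y)^-1.
  by apply: (mulfI nyy); rewrite divff// -{1}yr -sconjM divff// sconj1.
exact: proj_identity.
Qed.

Lemma cauchy_schwarz x y : `|ip x y| <= `|x| * `|y|.
Proof.
have [->|y0] := eqVneq y 0; first by rewrite ip0r !normr0 mulr0.
have := ip_ge0 (x - (ip x y / ip y y) *: y).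
rewrite ip_sub_proj// subr_ge0 ler_pdivrMr ?ip_norm ?exprn_gt0 ?normr_gt0//.
by rewrite -exprMn ler_pXn2r// nnegrE mulr_ge0.
Qed.

Lemma ip_pythagoras x y : ip x y = 0 -> ip (x + y) (x + y) = ip x x + ip y y.
Proof.
by move=> xy; rewrite ipDl !ipDr (ip_conj x y) xy sconj0 addr0 add0r.
Qed.

Lemma cvg_ip (u : nat -> H) x y e : 0 < e -> u @ \oo --> x ->
  exists N, forall n, (N <= n)%N -> `|ip x y - ip (u n) y| <= e.
Proof.
move=> e0 /cvg_seqP ux.
have y1 : 0 < `|y| + 1 by rewrite ltr_wpDl.
have [N HN] := ux _ (divr_gt0 e0 y1); exists N => n Nn.
rewrite -ipBl (le_trans (cauchy_schwarz _ _))//.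
apply: (@le_trans _ _ (`|x - u n| * (`|y| + 1))).
  by rewrite ler_wpM2l// lerDl.
by rewrite -ler_pdivlMr// HN.
Qed.

(** Adjointness passes to strong limits in this form: for [transport] and [diag_op] it is first
    known for the truncations. *)
Lemma cvg_ip_eq (u v : nat -> H) x y l m :
  u @ \oo --> l -> v @ \oo --> m -> (forall n, ip (u n) y = ip x (v n)) ->
  ip l y = ip x m.
Proof.
move=> ul vm uv; apply/eqP; rewrite -subr_eq0.
have := @scalar_squeeze0 R k (k^o : normedModType k) (ip l y - ip x m).
move=> -> // e e0; have e20 : 0 < e / 2 by rewrite divr_gt0.
have [N HN] := cvg_ip y e20 ul; have [M HM] := cvg_ip x e20 vm.
have := HN _ (leq_maxl N M); have := HM _ (leq_maxr N M).
set n := maxn N M; rewrite -norm_sconj sconjD sconjN -!ip_conj => h1 h2.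
rewrite -(subrK (ip (u n) y) (ip l y)) -addrA (le_trans (ler_normD _ _))//.
by rewrite [e]splitr lerD// uv distrC.
Qed.

(** By Pythagoras the squared norms of the partial sums increase, and their increments are the
    squared norms of the differences of partial sums; being bounded by [C ^+ 2], they are Cauchy. *)
Lemma orthogonal_series (u : nat -> H) (C : k) :
  (forall m n, m != n -> ip (u m) (u n) = 0) ->
  (forall N, `|\sum_(n < N) u n| <= C) ->
  exists l : H, (fun N => \sum_(n < N) u n) @ \oo --> l.
Proof.
move=> uo uC; apply: cauchy_seq_cvg => e e0.
pose s N := \sum_(n < N) u n.
have so N M : (N <= M)%N -> ip (s N) (u M) = 0.
  move=> NM; rewrite ip_suml big1// => i _; apply: uo.
  by rewrite neq_ltn (leq_trans (ltn_ord i) NM).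
have sS N : s N.+1 = s N + u N by rewrite /s big_ord_recr.
have sB N M : (N <= M)%N ->
    ip (s N) (s M - s N) = 0 /\ ip (s M - s N) (s M - s N) = ip (s M) (s M) - ip (s N) (s N).
  move=> NM; have h : ip (s N) (s M - s N) = 0.
    move: NM => /subnK <-; elim: (M - N)%N => [|i IH]; first by rewrite subrr ip0r.
    by rewrite addSn sS addrAC ipDr IH so ?addr0// leq_addl.
  split=> //; have := ip_pythagoras h; rewrite addrC subrK => ->.
  by rewrite addrAC subrr add0r.
have e2 : 0 < e ^+ 2 by rewrite exprn_gt0.
have [|||N HN] := @bounded_monotone_cauchy R k (fun N => ip (s N) (s N)) (C ^+ 2) _ _ _ _ e2.
- by move=> n; exact: ip_ge0.
- by move=> n; rewrite -subr_ge0 -(sB _ _ (leqnSn n)).2 ip_ge0.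
- by move=> n; rewrite ip_norm ler_pXn2r ?nnegrE// (le_trans _ (uC n)).
exists N => m n Nm mn; have := HN m n Nm mn.
rewrite -(sB _ _ mn).2 ip_norm ler_pXn2r ?nnegrE//; exact: ltW.
Qed.

Definition orthonormal (e : nat -> H) := forall m n, ip (e m) (e n) = (m == n)%:R.

Lemma bessel_eq (f g : nat -> H) x N : orthonormal g ->
  ip (\sum_(n < N) ip x (f n) *: g n) (\sum_(n < N) ip x (f n) *: g n) =
  \sum_(n < N) `|ip x (f n)| ^+ 2.
Proof.
move=> go; rewrite ip_suml; apply: eq_bigr => i _.
rewrite ip_sumr (bigD1 i)//= big1 ?addr0 => [|j ji].
  by rewrite ipZl ipZr go eqxx mulr1 mul_sconj.
by rewrite ipZl ipZr go eq_sym (inj_eq val_inj) (negbTE ji) !mulr0.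
Qed.

(** By [bessel_eq] the norm does not depend on the target sequence; for the target [f] the sum is
    the orthogonal projection of [x] to the span of the first [N] vectors. *)
Lemma bessel (f g : nat -> H) x N : orthonormal f -> orthonormal g ->
  `|\sum_(n < N) ip x (f n) *: g n| <= `|x|.
Proof.
move=> fo go; apply: norm_le_of_ip; rewrite bessel_eq// -(bessel_eq f x N fo).
set s := \sum_(n < N) ip x (f n) *: f n.
rewrite -subr_ge0.
suff <- : ip (x - s) (x - s) = ip x x - ip s s by exact: ip_ge0.
have h : ip s (x - s) = 0.
  rewrite ip_suml big1// => i _; rewrite ipZl ipBr ip_sumr (bigD1 i)//=.
  rewrite big1 ?addr0 => [|j ji]; last first.
    by rewrite ipZr fo eq_sym (inj_eq val_inj) (negbTE ji) mulr0.
  by rewrite ipZr fo eqxx mulr1 -ip_conj subrr mulr0.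
have := ip_pythagoras h; rewrite addrC subrK => ->.
by rewrite addrAC subrr add0r.
Qed.

End InnerProduct.

(** * Partial isometries and isometries given by orthonormal sequences *)

Section PartialIsometries.
Context {R : realType} {k : ground R} {H : hilbert k}.
Implicit Types (x y z : H) (c : k) (e f g : nat -> H).

Lemma transport_cvg_ex f g : orthonormal f -> orthonormal g -> forall x,
  exists l : H, (fun N => \sum_(n < N) ip x (f n) *: g n) @ \oo --> l.
Proof.
move=> fo go x; apply: (@orthogonal_series _ _ _ (fun n => ip x (f n) *: g n) `|x|) => [m n mn|N].
  by rewrite ipZl ipZr go (negbTE mn) !mulr0.
exact: bessel.
Qed.

(* The partial isometry [f n |-> g n], zero on the orthogonal complement of
   [f]; junk unless both sequences are orthonormal. *)
Definition transport f g x : H :=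
  xget 0 [set l | (fun N => \sum_(n < N) ip x (f n) *: g n) @ \oo --> l].

Lemma transport_cvg f g : orthonormal f -> orthonormal g -> forall x,
  (fun N => \sum_(n < N) ip x (f n) *: g n) @ \oo --> transport f g x.
Proof.
move=> fo go x; rewrite /transport; case: xgetP => [l -> //|].
by have [l xl] := transport_cvg_ex fo go x; move/(_ l).
Qed.
Arguments transport_cvg {f g} fo go x : rename.

Lemma transport_linear f g : orthonormal f -> orthonormal g ->
  forall c x y, transport f g (c *: x + y) = c *: transport f g x + transport f g y.
Proof.
move=> fo go c x y; apply: (cvg_seq_unique (transport_cvg fo go (c *: x + y))).
under eq_fun do under eq_bigr do rewrite ip_linear scalerDl -scalerA.
under eq_fun do rewrite big_split /= -scaler_sumr.
by apply: cvgD; [apply: cvgZr|]; exact: transport_cvg.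
Qed.

Lemma transport_norm f g : orthonormal f -> orthonormal g ->
  forall x, `|transport f g x| <= `|x|.
Proof.
move=> fo go x; apply: cvg_norm_le (transport_cvg fo go x) _.
by exists 0%N => N _; exact: bessel.
Qed.

Lemma transport_adj f g : orthonormal f -> orthonormal g ->
  forall x y, ip (transport f g x) y = ip x (transport g f y).
Proof.
move=> fo go x y.
apply: (cvg_ip_eq (transport_cvg fo go x) (transport_cvg go fo y)) => N.
rewrite ip_suml ip_sumr; apply: eq_bigr => i _.
by rewrite ipZl ipZr -ip_conj mulrC.
Qed.

Lemma transport0 f g : orthonormal f -> orthonormal g ->
  forall x, (forall n, ip x (f n) = 0) -> transport f g x = 0.
Proof.
move=> fo go x xf; apply: (cvg_seq_unique (transport_cvg fo go x)).
under eq_fun do under eq_bigr do rewrite xf scale0r.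
under eq_fun do rewrite big1//.
exact: cvg_cst.
Qed.

Lemma transport_basis f g : orthonormal f -> orthonormal g ->
  forall n, transport f g (f n) = g n.
Proof.
move=> fo go n; apply: (cvg_seq_unique (transport_cvg fo go (f n))).
apply/cvg_seqP => e e0; exists n.+1 => N nN.
rewrite (bigD1 (Ordinal nN))//= fo eqxx scale1r big1 => [|i ni].
  by rewrite addr0 subrr normr0 ltW.
rewrite fo; case: eqP => [nE|_]; last by rewrite scale0r.
by case/eqP: ni; apply/val_inj; rewrite /= nE.
Qed.

Lemma transportB f g : orthonormal f -> orthonormal g ->
  forall x y, transport f g (x - y) = transport f g x - transport f g y.
Proof.
by move=> fo go x y; rewrite addrC -scaleN1r transport_linear// scaleN1r addrC.
Qed.

Lemma transportD f g : orthonormal f -> orthonormal g ->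
  forall x y, transport f g (x + y) = transport f g x + transport f g y.
Proof. by move=> fo go x y; rewrite -{1}[x]scale1r transport_linear// scale1r. Qed.

Lemma transport_comp e f g : orthonormal e -> orthonormal f -> orthonormal g ->
  forall x, transport f g (transport e f x) = transport e g x.
Proof.
move=> eo fo go x.
have h y : `|transport f g y| <= 1 * `|y| by rewrite mul1r transport_norm.
have := cvg_bounded_linear (transportB fo go) ler01 h (transport_cvg eo fo x).
move/cvg_seq_unique; apply.
suff -> : (fun N => transport f g (\sum_(n < N) ip x (e n) *: f n)) =
    fun N => \sum_(n < N) ip x (e n) *: g n by exact: transport_cvg.
apply/funext => N; elim: N => [|N IH].
  by rewrite !big_ord0 transport0// => n; rewrite ip0l.
by rewrite !big_ord_recr /= addrC transport_linear// IH transport_basis// addrC.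
Qed.

Section Isometry.
Variables (e : nat -> H) (i : nat -> nat).
Hypotheses (eo : orthonormal e) (inj_i : injective i).

Let f n := e (i n).

Let fo : orthonormal f.
Proof. by move=> m n; rewrite /f eo (inj_eq inj_i). Qed.

(* The isometry acting by [e n |-> e (i n)] on the span of [e] and as the
   identity on its orthogonal complement, and its adjoint. *)
Definition iso x : H := x - transport e e x + transport e f x.
Definition coiso x : H := x - transport e e x + transport f e x.

Lemma iso_linear c x y : iso (c *: x + y) = c *: iso x + iso y.
Proof.
rewrite /iso !transport_linear// !(scalerDr, scalerN) opprD !addrA.
by rewrite (ACl (1*3*5*2*4*6)).
Qed.

Lemma coiso_linear c x y : coiso (c *: x + y) = c *: coiso x + coiso y.
Proof.
rewrite /coiso !transport_linear// !(scalerDr, scalerN) opprD !addrA.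
by rewrite (ACl (1*3*5*2*4*6)).
Qed.

Lemma iso_adj x y : ip (iso x) y = ip x (coiso y).
Proof.
by rewrite /iso /coiso ipDl ipBl ipDr ipBr !transport_adj.
Qed.

(** [transport e e] is the projection to the closed span of [e], which contains every [f n]. *)
Lemma transport_fixed x : transport e e (transport e f x) = transport e f x.
Proof.
have h y : `|transport e e y| <= 1 * `|y| by rewrite mul1r transport_norm.
have := cvg_bounded_linear (transportB eo eo) ler01 h (transport_cvg eo fo x).
move/cvg_seq_unique; apply.
suff -> : (fun N => transport e e (\sum_(n < N) ip x (e n) *: f n)) =
    fun N => \sum_(n < N) ip x (e n) *: f n by exact: transport_cvg.
apply/funext => N; elim: N => [|N IH].
  by rewrite !big_ord0 transport0// => n; rewrite ip0l.
by rewrite !big_ord_recr /= addrC transport_linear// IH /f transport_basis// addrC.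
Qed.

Lemma transport_cofixed x : transport f e (transport e e x) = transport f e x.
Proof.
by apply: ip_ext => z; rewrite !transport_adj// transport_fixed.
Qed.

Lemma isoK x : coiso (iso x) = x.
Proof.
have -> : coiso (iso x) = iso x - transport e e (iso x) + transport f e (iso x) by [].
have -> : transport e e (iso x) = transport e f x.
  rewrite /iso (transportD eo eo) (transportB eo eo) transport_fixed.
  by rewrite (transport_comp eo eo eo) subrr add0r.
have -> : transport f e (iso x) = transport e e x.
  rewrite /iso (transportD fo eo) (transportB fo eo) transport_cofixed.
  by rewrite (transport_comp eo fo eo) subrr add0r.
by rewrite /iso addrK subrK.
Qed.

Lemma iso_basis n : iso (e n) = e (i n).
Proof. by rewrite /iso !transport_basis// subrr add0r. Qed.

Lemma coiso0 m : (forall n, i n <> m) -> coiso (e m) = 0.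
Proof.
move=> im; rewrite /coiso transport_basis// subrr add0r transport0// => n.
by rewrite /f eo; case: eqP => // mn; case: (im n).
Qed.

Lemma iso_norm x : `|iso x| = `|x|.
Proof.
apply/eqP; rewrite -(@eqrXn2 _ 2)// -!ip_norm; apply/eqP.
by rewrite iso_adj isoK.
Qed.

Lemma coiso_norm x : `|coiso x| <= `|x|.
Proof.
have [->|cx0] := eqVneq (coiso x) 0; first by rewrite normr0.
rewrite -(ler_pM2l (x := `|coiso x|)) ?normr_gt0// -expr2 -ip_norm -iso_adj.
have : `|ip (iso (coiso x)) x| <= `|coiso x| * `|x|.
  by rewrite -(iso_norm (coiso x)) cauchy_schwarz.
by rewrite iso_adj ger0_norm ?ip_ge0.
Qed.

End Isometry.

Lemma orthonormal_extend n (v : 'I_n -> H) : infinite_dimensional H ->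
  (forall i j, ip (v i) (v j) = (i == j)%:R) ->
  exists x, ip x x = 1 /\ forall i, ip (v i) x = 0.
Proof.
move=> /(_ n v) [x xv] vo.
pose y := x - \sum_(i < n) ip x (v i) *: v i.
have y0 : y != 0.
  by rewrite subr_eq0; apply/negP => /eqP; exact: xv.
have vy i : ip (v i) y = 0.
  rewrite ipBr ip_sumr (bigD1 i)//= big1 ?addr0 => [|j ji].
    by rewrite ipZr vo eqxx mulr1 -ip_conj subrr.
  by rewrite ipZr vo eq_sym (negbTE ji) mulr0.
have ny : `|y| != 0 by rewrite normr_eq0.
exists (`|y|^-1 *: y); split; last by move=> i; rewrite ipZr vy mulr0.
by rewrite ip_norm normrZ normfV normr_id mulVf// expr1n.
Qed.

(** Gram-Schmidt with a prescribed first vector: the diagonal unit at index 0 has to be the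
    projection [p] of the stability hypothesis. *)
Lemma orthonormal_sequence (e0 : H) : infinite_dimensional H -> ip e0 e0 = 1 ->
  exists2 e, orthonormal e & e 0%N = e0.
Proof.
move=> Hinf e00.
pose ons (s : seq H) := forall i j, (i < size s)%N -> (j < size s)%N ->
  ip (nth 0 s i) (nth 0 s j) = (i == j)%:R.
(* The extension property is conditional on [ons s], so that [nxt] is a total function and can be
   iterated. *)
have /choice [nxt nxtP] : forall s, exists x, ons s -> ons (rcons s x).
  move=> s; have [so|?] := pselect (ons s); last by exists 0.
  have [|x [x1 xs]] := @orthonormal_extend (size s) (fun i => nth 0 s i) Hinf.
    by move=> i j; rewrite so.
  exists x => _ i j; rewrite size_rcons !ltnS !nth_rcons.
  rewrite (leq_eqVlt i) (leq_eqVlt j) => /orP[/eqP->|si] /orP[/eqP->|sj].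
  - by rewrite ltnn eqxx x1.
  - by rewrite ltnn eqxx sj ip_conj (xs (Ordinal sj)) sconj0 gtn_eqF.
  - by rewrite ltnn eqxx si (xs (Ordinal si)) ltn_eqF.
  - by rewrite si sj so.
pose L n := iter n (fun s => rcons s (nxt s)) [:: e0].
have Lo n : ons (L n).
  elim: n => [|n IH]; last exact: nxtP.
  by move=> [|i] [|j]//= _ _; rewrite e00.
have Ls n : size (L n) = n.+1 by elim: n => //= n IH; rewrite size_rcons IH.
have Ln n m : (n <= m)%N -> nth 0 (L m) n = nth 0 (L n) n.
  move/subnK <-; elim: (m - n)%N => // i IH.
  by rewrite addSn /= nth_rcons Ls ltnS leq_addl.
exists (fun n => nth 0 (L n) n) => // m n.
rewrite -(Ln _ _ (leq_maxl m n)) -(Ln n _ (leq_maxr m n)).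
by apply: Lo; rewrite Ls ltnS ?leq_maxl ?leq_maxr.
Qed.

End PartialIsometries.
Arguments transport_cvg {R k H f g} fo go x : rename.

(** * Star-algebras and their representations *)

Section BanachStarAlgebra.
Context {R : realType} {k : ground R} {A : banach_star_alg k}.
Implicit Types (a b d : A) (c : k).

Lemma amulDl a b d : amul (a + b) d = amul a d + amul b d.
Proof. by have := amul_linearl 1 a b d; rewrite !scale1r. Qed.

Lemma amulDr a b d : amul d (a + b) = amul d a + amul d b.
Proof. by have := amul_linearr 1 a b d; rewrite !scale1r. Qed.

Lemma amul0l d : amul (0 : A) d = 0.
Proof. by apply: (addrI (amul 0 d)); rewrite -amulDl !addr0. Qed.

Lemma amul0r d : amul d (0 : A) = 0.
Proof. by apply: (addrI (amul d 0)); rewrite -amulDr !addr0. Qed.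

Lemma amulZl c a d : amul (c *: a) d = c *: amul a d.
Proof. by have := amul_linearl c a 0 d; rewrite amul0l !addr0. Qed.

Lemma amulZr c a d : amul d (c *: a) = c *: amul d a.
Proof. by have := amul_linearr c a 0 d; rewrite amul0r !addr0. Qed.

Lemma amulNl a d : amul (- a) d = - amul a d.
Proof. by rewrite -scaleN1r amulZl scaleN1r. Qed.

Lemma amulNr a d : amul d (- a) = - amul d a.
Proof. by rewrite -scaleN1r amulZr scaleN1r. Qed.

Lemma amulBl a b d : amul (a - b) d = amul a d - amul b d.
Proof. by rewrite amulDl amulNl. Qed.

Lemma amulBr a b d : amul d (a - b) = amul d a - amul d b.
Proof. by rewrite amulDr amulNr. Qed.

Lemma amul_suml (I : Type) (r : seq I) (P : pred I) (F : I -> A) d :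
  amul (\sum_(i <- r | P i) F i) d = \sum_(i <- r | P i) amul (F i) d.
Proof. by elim/big_rec2: _ => [|i u v _ <-]; rewrite ?amul0l ?amulDl. Qed.

Lemma amul_sumr (I : Type) (r : seq I) (P : pred I) (F : I -> A) d :
  amul d (\sum_(i <- r | P i) F i) = \sum_(i <- r | P i) amul d (F i).
Proof. by elim/big_rec2: _ => [|i u v _ <-]; rewrite ?amul0r ?amulDr. Qed.

Lemma astarD a b : astar (a + b) = astar a + astar b.
Proof. by have := astar_linear 1 a b; rewrite sconj1 !scale1r. Qed.

Lemma astar0 : astar (0 : A) = 0.
Proof. by apply: (addrI (astar 0)); rewrite -astarD !addr0. Qed.

Lemma astarZ c a : astar (c *: a) = sconj c *: astar a.
Proof. by have := astar_linear c a 0; rewrite astar0 !addr0. Qed.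

Lemma astarN a : astar (- a) = - astar a.
Proof. by rewrite -scaleN1r astarZ sconjN sconj1 scaleN1r. Qed.

Lemma astarB a b : astar (a - b) = astar a - astar b.
Proof. by rewrite astarD astarN. Qed.

Lemma astar_sum (I : Type) (r : seq I) (P : pred I) (F : I -> A) :
  astar (\sum_(i <- r | P i) F i) = \sum_(i <- r | P i) astar (F i).
Proof. by elim/big_rec2: _ => [|i u v _ <-]; rewrite ?astar0 ?astarD. Qed.

Lemma cvg_amulr (u : nat -> A) a d : u @ \oo --> a ->
  (fun n => amul d (u n)) @ \oo --> amul d a.
Proof.
move=> ua; apply: (@cvg_bounded_linear R k A A (amul d) `|d| u a _ _ _ ua) => // [x y|x].
  exact: amulBr.
exact: amul_norm.
Qed.

Lemma cvg_amul (u v : nat -> A) a b : u @ \oo --> a -> v @ \oo --> b ->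
  (fun n => amul (u n) (v n)) @ \oo --> amul a b.
Proof.
move=> /cvg_seqP ua vb; have /cvg_seqP uab := cvg_amulr (d := a) vb.
apply/cvg_seqP => e e0; have e20 : 0 < e / 2 by rewrite divr_gt0.
have [N1 H1] := uab _ e20; have /cvg_seqP vb' := vb; have [N2 H2] := vb' _ ltr01.
have b1 : 0 < `|b| + 1 by rewrite ltr_wpDl.
have [N3 H3] := ua _ (divr_gt0 e20 b1).
exists (maxn N1 (maxn N2 N3)) => n; rewrite !geq_max => /and3P[n1 n2 n3].
rewrite -(subrK (amul a (v n)) (amul a b)) -addrA (le_trans (ler_normD _ _))//.
rewrite [e]splitr lerD ?H1// -amulBl (le_trans (amul_norm _ _))//.
apply: (@le_trans _ _ (`|a - u n| * (`|b| + 1))); last first.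
  by rewrite -ler_pdivlMr// H3.
rewrite ler_wpM2l// -(subrK b (v n)) (le_trans (ler_normD _ _))// addrC lerD2l.
by rewrite distrC H2.
Qed.

End BanachStarAlgebra.

Section Representations.
Context {R : realType} {k : ground R} {A : banach_star_alg k} {H : hilbert k}.
Variable pi : representation A H.
Implicit Types (a b : A) (x y : H) (c : k).

Lemma repD a b x : pi (a + b) x = pi a x + pi b x.
Proof. by have := rep_linear pi 1 a b x; rewrite !scale1r. Qed.

Lemma rep0 x : pi 0 x = 0.
Proof. by apply: (addrI (pi 0 x)); rewrite -repD !addr0. Qed.

Lemma repZ c a x : pi (c *: a) x = c *: pi a x.
Proof. by have := rep_linear pi c a 0 x; rewrite rep0 !addr0. Qed.

Lemma repN a x : pi (- a) x = - pi a x.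
Proof. by rewrite -scaleN1r repZ scaleN1r. Qed.

Lemma repB a b x : pi (a - b) x = pi a x - pi b x.
Proof. by rewrite repD repN. Qed.

Lemma rep_sum (I : Type) (r : seq I) (P : pred I) (F : I -> A) x :
  pi (\sum_(i <- r | P i) F i) x = \sum_(i <- r | P i) pi (F i) x.
Proof. by elim/big_rec2: _ => [|i u v _ <-]; rewrite ?rep0 ?repD. Qed.

Hypothesis iso_pi : isometric_rep pi.

Lemma isorep_norm a x : `|pi a x| <= `|a| * `|x|.
Proof. by have [_ + _] := iso_pi a; exact. Qed.

Lemma isorep_le a c : 0 <= c -> (forall x, `|pi a x| <= c * `|x|) -> `|a| <= c.
Proof. by move=> c0 ac; have [_ _ +] := iso_pi a; exact. Qed.

Lemma isorep_inj a b : (forall x, pi a x = pi b x) -> a = b.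
Proof.
move=> ab; apply/eqP; rewrite -subr_eq0 -normr_le0.
by apply: isorep_le => // x; rewrite repB ab subrr normr0 mul0r.
Qed.

End Representations.

Section CstarNorm.
Context {R : realType} {k : ground R} {A : cstar k}.
Implicit Types (a b h q : A).

Lemma norm_astar a : `|astar a| = `|a|.
Proof.
suff le b : `|b| <= `|astar b| by apply/eqP; rewrite eq_le le -{2}[a]astarK le.
have [->|b0] := eqVneq b 0; first by rewrite normr0.
rewrite -(ler_pM2l (x := `|b|)) ?normr_gt0// -expr2 -cs_identity mulrC.
exact: amul_norm.
Qed.

Lemma cvg_astar (u : nat -> A) a : u @ \oo --> a ->
  (fun n => astar (u n)) @ \oo --> astar a.
Proof.
move=> /cvg_seqP ua; apply/cvg_seqP => e /ua [N HN]; exists N => n /HN.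
by rewrite -astarB norm_astar.
Qed.

(* Ford's square root lemma: [1 - h = (1 - q) ^ 2], with [q] the fixed point of
   the contraction [q |-> (h + q ^ 2) / 2]. *)
Lemma ford_square_root h : astar h = h -> `|h| < 1 ->
  exists2 q : A, astar q = q & h = q + q - amul q q.
Proof.
move=> hh; set r := `|h| => r1.
have r0 : 0 <= r by exact: normr_ge0.
pose F q : A := 2^-1 *: (h + amul q q).
pose u n := iter n F 0.
have un n : `|u n| <= r.
  elim: n => [|n IH]; first by rewrite /= normr0.
  rewrite /= /F normrZ ger0_norm ?invr_ge0// mulrC ler_pdivrMr//.
  rewrite (le_trans (ler_normD _ _))// mulr_natr mulr2n lerD2l.
  rewrite (le_trans (amul_norm _ _))//.
  by rewrite -[leRHS]mulr1 ler_pM// (le_trans IH)// ltW.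
have ustar n : astar (u n) = u n.
  elim: n => [|n IH]; first by rewrite /= astar0.
  rewrite /= /F astarZ astarD hh astarM IH sconj_real//.
have Fdiff p q : amul q q - amul p p = amul q (q - p) + amul (q - p) p.
  by rewrite amulBr amulBl addrA subrK.
have step n : `|u n.+1 - u n| <= r ^+ n * r.
  elim: n => [|n IH].
    rewrite expr0 mul1r subr0 /= /F amul0l addr0 normrZ ger0_norm ?invr_ge0//.
    by rewrite -[leRHS]mul1r ler_wpM2r// invf_le1// ler1n.
  rewrite [u n.+2]/= /F -[u n.+1 in X in _ - X]/(F (u n)) /F.
  rewrite -scalerBr opprD addrACA subrr add0r Fdiff.
  rewrite normrZ ger0_norm ?invr_ge0// mulrC ler_pdivrMr//.
  rewrite (le_trans (ler_normD _ _))// mulr_natr mulr2n.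
  have le1 : `|u n.+1| * `|u n.+1 - u n| <= r ^+ n.+1 * r.
    by rewrite exprS -mulrA ler_pM.
  have le2 : `|u n.+1 - u n| * `|u n| <= r ^+ n.+1 * r.
    by rewrite mulrC exprS -mulrA ler_pM.
  apply: lerD; first exact: le_trans (amul_norm _ _) le1.
  exact: le_trans (amul_norm _ _) le2.
have d0 : 0 < 1 - r by rewrite subr_gt0.
(* The factor [1 - r] makes the geometric bounds of [step] telescope. *)
have tele m n : (m <= n)%N -> (1 - r) * `|u n - u m| <= r ^+ m - r ^+ n.
  move/subnK <-; elim: (n - m)%N => [|i IH].
    by rewrite add0n !subrr normr0 mulr0.
  rewrite addSn -(subrK (u (i + m)%N) (u (i + m).+1)) -addrA.
  apply: (@le_trans _ _ ((1 - r) * (`|u (i + m).+1 - u (i + m)%N| + `|u (i + m)%N - u m|))).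
    by rewrite ler_wpM2l ?(ltW d0)// ler_normD.
  rewrite mulrDr; apply: (@le_trans _ _ ((1 - r) * r ^+ (i + m) + (r ^+ m - r ^+ (i + m)))).
    apply: lerD => //; rewrite ler_wpM2l ?(ltW d0)// (le_trans (step _))//.
    by rewrite -[leRHS]mulr1 ler_wpM2l ?exprn_ge0// ltW.
  by rewrite mulrBl mul1r exprS addrC addrA subrK.
have [q uq] : exists q : A, u @ \oo --> q.
  apply: cauchy_seq_cvg => e e0.
  (* [1 - r ^+ n] increases and is at most 1; its Cauchy property at [(1 - r) * e] bounds the
     right-hand side of [tele]. *)
  have [|||N HN] := @bounded_monotone_cauchy R k (fun n => 1 - r ^+ n) 1 _ _ _ _ (mulr_gt0 d0 e0).
  - by move=> n; rewrite subr_ge0 exprn_ile1// ltW.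
  - by move=> n; rewrite lerD2l lerN2 exprS -[leRHS]mul1r ler_wpM2r ?exprn_ge0// ltW.
  - by move=> n; rewrite gerBl exprn_ge0.
  exists N => m n Nm mn; rewrite -(ler_pM2l d0) (le_trans (tele _ _ mn))//.
  by have := HN m n Nm mn; rewrite opprB addrC addrA subrK.
have Fq : F q = q.
  have : (fun n => u n.+1) @ \oo --> q by rewrite (cvg_shiftS u).
  apply: cvg_seq_unique; apply: cvgZr; apply: cvgD; first exact: cvg_cst.
  exact: cvg_amul.
exists q.
  have := cvg_astar uq; under eq_fun do rewrite ustar.
  by move/cvg_seq_unique/(_ uq).
rewrite -{1 2}Fq /F -scalerDl.
have -> : 2^-1 + 2^-1 = 1 :> k by rewrite [RHS]splitr div1r.
by rewrite scale1r addrK.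
Qed.

(** With [h = a^* a], [ford_square_root] gives [1 - a^* a = (1 - q)^2] with [q] self-adjoint. Two
    vectors occur because estimates on sums of tensors need the whole kernel in [(x, y)], not only
    its diagonal. *)
Lemma ip_contraction (H : hilbert k) (pi : representation A H) a : `|a| < 1 ->
  exists q, forall x y,
    ip x y - ip (pi a x) (pi a y) = ip (x - pi q x) (y - pi q y).
Proof.
move=> a1; have [||q qq aq] := @ford_square_root (amul (astar a) a).
- by rewrite astarM astarK.
- by rewrite cs_identity exprn_ilt1.
exists q => x y; rewrite rep_star -rep_mul aq repB repD rep_mul.
rewrite ipBl !ipBr !rep_star qq ipDr !opprB !opprD !addrA.
by rewrite (ACl (1*3*2*4)).
Qed.

Lemma rep_contraction (H : hilbert k) (pi : representation A H) a x :
  `|a| < 1 -> `|pi a x| <= `|x|.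
Proof.
move=> a1; have [q aq] := ip_contraction pi a1.
by apply: norm_le_of_ip; rewrite -subr_ge0 aq ip_ge0.
Qed.

(** The factor 2 brings the norm strictly below 1, as the square root requires. It is the source of
    the constants 2 and 4 in the bounds below, which serve to prove continuity and convergence. *)
Lemma half_unit_norm a : a != 0 -> `|(2 * `|a|)^-1 *: a| < 1.
Proof.
rewrite -normr_gt0 => a0; rewrite normrZ ger0_norm ?invr_ge0 ?mulr_ge0//.
by rewrite invfM -mulrA mulVf ?gt_eqF// mulr1 invf_lt1// ltr1n.
Qed.

Lemma rep_bound (H : hilbert k) (pi : representation A H) a x :
  `|pi a x| <= 2 * `|a| * `|x|.
Proof.
have [->|a0] := eqVneq a 0; first by rewrite rep0 !normr0 mulr0 mul0r.
have := rep_contraction pi x (half_unit_norm a0).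
have a20 : 0 < 2 * `|a| by rewrite mulr_gt0// normr_gt0.
by rewrite repZ normrZ ger0_norm ?invr_ge0 ?(ltW a20)// ler_pdivrMl.
Qed.

Definition rep_pullback (B : cstar k) (H : hilbert k) (pi : representation B H)
    (f : star_hom A B) : representation A H.
Proof.
refine (@Representation R k A H (fun a => pi (f a)) _ _ _ _).
- by move=> a; exact: rep_bounded.
- by move=> c a b x; rewrite linearP rep_linear.
- by move=> a b x; rewrite sh_mul rep_mul.
- by move=> a x y; rewrite sh_star rep_star.
Defined.

(** Automatic continuity: an isometric representation of [B] pulls back along [f] to a
    representation of [A], where [rep_bound] applies. *)
Lemma star_hom_bound (B : cstar k) (f : star_hom A B) a : `|f a| <= 2 * `|a|.
Proof.
have [H [pi pi_iso]] := cs_concrete B.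
apply: (isorep_le pi_iso) => [|x]; first by rewrite mulr_ge0.
exact: (rep_bound (rep_pullback pi f)).
Qed.

Lemma cvg_star_hom (B : cstar k) (f : star_hom A B) (u : nat -> A) a :
  u @ \oo --> a -> (fun n => f (u n)) @ \oo --> f a.
Proof.
move=> ua; apply: (@cvg_bounded_linear R k A B f 2 u a _ _ _ ua) => // [x y|x].
  exact: linearB.
exact: star_hom_bound.
Qed.

End CstarNorm.

(** [fmap] acts on records, so homomorphisms that agree pointwise must be equal as records; this
    calls for identifying their proof components. *)
Lemma linear_ext (K : pzRingType) (V W : lmodType K) (f g : {linear V -> W}) :
  f =1 g -> f = g.
Proof.
case: f g => [f [fa fl]] [g [ga gl]] /= /funext fg; subst g.
have -> : fa = ga.
  by case: fa fl => fa fl; case: ga gl => ga gl; rewrite (Prop_irrelevance fa ga).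
have -> : fl = gl.
  by case: fl => fl; case: gl => gl; rewrite (Prop_irrelevance fl gl).
by [].
Qed.

Lemma star_hom_ext (R : realType) (k : ground R) (A B : cstar k)
  (f g : star_hom A B) : f =1 g -> f = g.
Proof.
case: f g => [f fm fs] [g gm gs] /= /linear_ext fg; subst g.
by rewrite (Prop_irrelevance fm gm) (Prop_irrelevance fs gs).
Qed.

(** * Minimal tensor products *)

Section TensorNorm.
Context {R : realType} {k : ground R} {H1 H2 : hilbert k}.
Implicit Types (s : seq (H1 * H2)).

(* Orthogonalize the first components against one of them; this peels a
   nonnegative term off and lowers the number of tensors by one. *)
Lemma tsqnorm_ge0 s : 0 <= tsqnorm s.
Proof.
elim: {s}(size s) {-2}s (leqnn (size s)) => [|n IH] [|[u v] s]//=; rewrite ?/tsqnorm ?big_nil//.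
rewrite ltnS => sn.
have cons0 (w : H2) (t : seq (H1 * H2)) : tsqnorm ((0, w) :: t) = tsqnorm t.
  rewrite /tsqnorm big_cons /= big1 ?add0r => [|i _]; last by rewrite ip0l mul0r.
  by apply: eq_bigr => i _; rewrite big_cons /= ip0r mul0r add0r.
rewrite -/(tsqnorm _); have [->|u0] := eqVneq u 0; first by rewrite cons0 IH.
set s0 := _ :: s.
pose c (w : H1 * H2) := ip w.1 u / ip u u.
pose f (w : H1 * H2) := (w.1 - c w *: u, w.2).
pose V := \sum_(w <- s0) c w *: w.2.
have nuu : ip u u != 0 by apply/negP => /eqP /ip_eq0 uu; rewrite uu eqxx in u0.
have fu w : ip (f w).1 u = 0 by rewrite /f /= ipBl ipZl /c divfK// subrr.
have ker w z : ip w.1 z.1 * ip w.2 z.2 =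
    ip u u * (c w * sconj (c z) * ip w.2 z.2) + ip (f w).1 (f z).1 * ip (f w).2 (f z).2.
  have wE : w.1 = (f w).1 + c w *: u by rewrite /f /= subrK.
  have zE : z.1 = (f z).1 + c z *: u by rewrite /f /= subrK.
  rewrite -[(f w).2]/w.2 -[(f z).2]/z.2.
  move: (fu w) (fu z) wE zE; move: (f w).1 (f z).1 => x y xu yu -> ->.
  rewrite ipDl !ipDr !ipZr !ipZl xu mulr0 addr0 (ip_conj y u) yu sconj0 mulr0 add0r.
  rewrite mulrDl addrC; congr (_ + _); rewrite !mulrA; congr (_ * _).
  by rewrite divfK// [ip u u * _]mulrC mulfK// mulrC.
have -> : tsqnorm s0 = ip u u * ip V V + tsqnorm [seq f w | w <- s0].
  rewrite {}/V; move: s0 => t; rewrite /tsqnorm ip_suml big_distrr /= big_map -big_split /=.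
  apply: eq_bigr => w _; rewrite ip_sumr big_distrr /= big_map -big_split /=.
  by apply: eq_bigr => z _; rewrite ker [ip (c w *: _) _]ipZl ipZr !mulrA.
have fu0 : f (u, v) = (0, v) by rewrite /f /c /= divff// scale1r subrr.
by rewrite addr_ge0 ?mulr_ge0 ?ip_ge0// /s0 map_cons fu0 cons0 IH// size_map.
Qed.

(** The hypothesis makes the difference of the two sides itself a [tsqnorm], that of [Y] applied to
    the second components. *)
Lemma tsqnorm_map_ler (X Y : H2 -> H2) s :
  (forall v w, ip v w - ip (X v) (X w) = ip (Y v) (Y w)) ->
  tsqnorm [seq (u.1, X u.2) | u <- s] <= tsqnorm s.
Proof.
move=> XY; rewrite -subr_ge0.
suff <- : tsqnorm [seq (u.1, Y u.2) | u <- s] =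
  tsqnorm s - tsqnorm [seq (u.1, X u.2) | u <- s] by exact: tsqnorm_ge0.
rewrite /tsqnorm !big_map -sumrB; apply: eq_bigr => u _.
rewrite !big_map -sumrB; apply: eq_bigr => v _ /=.
by rewrite -mulrBr XY.
Qed.

Lemma tsqnorm_map_lel (X Y : H1 -> H1) s :
  (forall v w, ip v w - ip (X v) (X w) = ip (Y v) (Y w)) ->
  tsqnorm [seq (X u.1, u.2) | u <- s] <= tsqnorm s.
Proof.
move=> XY; rewrite -subr_ge0.
suff <- : tsqnorm [seq (Y u.1, u.2) | u <- s] =
  tsqnorm s - tsqnorm [seq (X u.1, u.2) | u <- s] by exact: tsqnorm_ge0.
rewrite /tsqnorm !big_map -sumrB; apply: eq_bigr => u _.
rewrite !big_map -sumrB; apply: eq_bigr => v _ /=.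
by rewrite -mulrBl XY.
Qed.

End TensorNorm.

Section MinimalTensor.
Context {R : realType} {k : ground R} {A B T : cstar k} {iota : A -> B -> T}.
Hypothesis mt : is_min_tensor iota.
Implicit Types (a : A) (b : B) (z : seq (A * B)) (t : T).

Lemma tensorDl a a' b : iota (a + a') b = iota a b + iota a' b.
Proof. by have := mt_linearl mt 1 a a' b; rewrite !scale1r. Qed.

Lemma tensorDr a b b' : iota a (b + b') = iota a b + iota a b'.
Proof. by have := mt_linearr mt 1 a b b'; rewrite !scale1r. Qed.

Lemma tensor0l b : iota 0 b = 0.
Proof. by apply: (addrI (iota 0 b)); rewrite -tensorDl !addr0. Qed.

Lemma tensor0r a : iota a 0 = 0.
Proof. by apply: (addrI (iota a 0)); rewrite -tensorDr !addr0. Qed.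

Lemma tensorZl (c : k) a b : iota (c *: a) b = c *: iota a b.
Proof. by have := mt_linearl mt c a 0 b; rewrite tensor0l !addr0. Qed.

Lemma tensorZr (c : k) a b : iota a (c *: b) = c *: iota a b.
Proof. by have := mt_linearr mt c a b 0; rewrite tensor0r !addr0. Qed.

Lemma tensorNl a b : iota (- a) b = - iota a b.
Proof. by rewrite -scaleN1r tensorZl scaleN1r. Qed.

Lemma tensorBl a a' b : iota (a - a') b = iota a b - iota a' b.
Proof. by rewrite tensorDl tensorNl. Qed.

Definition tensor_sum z : T := \sum_(w <- z) iota w.1 w.2.

Lemma tensor_norm_le z c : 0 <= c ->
  (forall (H1 H2 : hilbert k) (pi : representation A H1)
     (sg : representation B H2), tensor_rep_le pi sg z c) ->
  `|tensor_sum z| <= c.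
Proof. by move=> c0 zc; have [_ _ +] := mt_norm mt z; exact. Qed.

Lemma tensor_dense t : exists zs : nat -> seq (A * B), (fun n => tensor_sum (zs n)) @ \oo --> t.
Proof.
have /choice [zs zsP] : forall n, exists z, `|t - tensor_sum z| < (n.+1%:R^-1 : k).
  move=> n; have n0 : 0 < (n.+1%:R^-1 : k) by rewrite invr_gt0 ltr0n.
  have bt : ball t (n.+1%:R^-1 : k) t by apply: ballxx.
  have [y [ty [z _ zy]]] := mt_dense mt (ex_intro _ t bt) (ball_open t n.+1%:R^-1).
  by exists z; rewrite /tensor_sum zy; have : ball t n.+1%:R^-1 y by []; rewrite -ball_normE.
exists zs; apply/cvg_seqP => e /scalar_arch [N HN]; exists N => n Nn.
apply/ltW/(lt_trans (zsP n)); apply: le_lt_trans HN.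
by rewrite lef_pV2 ?posrE ?ltr0n// ler_nat ltnS.
Qed.

Lemma tensor_norm_unit a b : `|a| < 1 -> `|b| < 1 -> `|iota a b| <= 1.
Proof.
move=> a1 b1; have := @tensor_norm_le [:: (a, b)] 1 ler01.
rewrite /tensor_sum big_seq1; apply=> H1 H2 pi sg s; rewrite expr1n mul1r.
have [q aq] := ip_contraction pi a1; have [r br] := ip_contraction sg b1.
apply: le_trans (tsqnorm_map_lel s aq).
apply: le_trans (tsqnorm_map_ler _ br).
by rewrite -map_comp /tact /= cats0.
Qed.

Lemma tensor_norm a b : `|iota a b| <= 4 * `|a| * `|b|.
Proof.
have [->|a0] := eqVneq a 0; first by rewrite tensor0l !normr0 mulr0 mul0r.
have [->|b0] := eqVneq b 0; first by rewrite tensor0r !normr0 mulr0.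
have := tensor_norm_unit (half_unit_norm a0) (half_unit_norm b0).
have a20 : 0 < 2 * `|a| by rewrite mulr_gt0// normr_gt0.
have b20 : 0 < 2 * `|b| by rewrite mulr_gt0// normr_gt0.
rewrite tensorZl tensorZr !normrZ !ger0_norm ?invr_ge0 ?(ltW a20) ?(ltW b20)//.
rewrite ler_pdivrMl// mulr1 ler_pdivrMl// => /le_trans; apply.
by rewrite mulrACA -natrM [`|b| * _]mulrC mulrA.
Qed.

Definition orthogonal_projections (p : nat -> B) :=
  (forall n, astar (p n) = p n) /\
  (forall m n, amul (p m) (p n) = if m == n then p n else 0).

Lemma diagonal_norm_unit (p : nat -> B) (a : nat -> A) (r : seq nat) :
  orthogonal_projections p -> uniq r -> (forall n, `|a n| < 1) ->
  `|\sum_(n <- r) iota (a n) (p n)| <= 1.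
Proof.
move=> [ps pp] ur a1; have := @tensor_norm_le [seq (a n, p n) | n <- r] 1 ler01.
rewrite /tensor_sum big_map /=; apply=> H1 H2 pi sg s; rewrite expr1n mul1r.
pose P := \sum_(n <- r) p n.
have Ps : astar P = P by rewrite /P astar_sum; apply: eq_bigr.
have PP : amul P P = P.
  rewrite /P amul_suml; apply: eq_big_seq => i ir; rewrite amul_sumr.
  rewrite (bigD1_seq i)//= pp eqxx big1 ?addr0// => j ji.
  by rewrite pp eq_sym (negbTE ji).
(* For a projection the defect [1 - P] is its own square. *)
have Pdiff v w : ip v w - ip (sg P v) (sg P w) = ip (v - sg P v) (w - sg P w).
  rewrite ipBl !ipBr !rep_star Ps -rep_mul PP.
  by rewrite subrr subr0.
apply: le_trans (tsqnorm_map_ler s Pdiff).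
have -> : tsqnorm (tact pi sg [seq (a n, p n) | n <- r] s) =
    \sum_(n <- r) tsqnorm [seq (pi (a n) u.1, sg (p n) u.2) | u <- s].
  rewrite /tsqnorm /tact big_allpairs_dep big_map /=.
  apply: eq_big_seq => n nr; rewrite big_map; apply: eq_bigr => u _.
  rewrite big_allpairs_dep big_map /= (bigD1_seq n)//= [X in _ + X]big1 ?addr0 => [|m mn].
    by rewrite big_map.
  rewrite big1// => v _; rewrite [X in _ * X]rep_star -rep_mul ps pp.
  by rewrite eq_sym (negbTE mn) rep0 ip0r mulr0.
have -> : tsqnorm [seq (u.1, sg P u.2) | u <- s] =
    \sum_(n <- r) tsqnorm [seq (u.1, sg (p n) u.2) | u <- s].
  rewrite /tsqnorm big_map.
  under [RHS]eq_bigr do rewrite big_map.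
  rewrite [RHS]exchange_big /=; apply: eq_bigr => u _; rewrite big_map.
  under [RHS]eq_bigr do rewrite big_map.
  rewrite [RHS]exchange_big /=; apply: eq_bigr => v _.
  rewrite rep_star -rep_mul Ps PP rep_sum ip_sumr big_distrr /=.
  by apply: eq_bigr => n _; rewrite rep_star -rep_mul ps pp eqxx.
apply: ler_sum => n _; have [q aq] := ip_contraction pi (a1 n).
by apply: le_trans (tsqnorm_map_lel _ aq); rewrite -map_comp.
Qed.

Lemma diagonal_norm (p : nat -> B) (a : nat -> A) (r : seq nat) c :
  orthogonal_projections p -> uniq r -> 0 < c ->
  (forall n, n \in r -> `|a n| <= c) ->
  `|\sum_(n <- r) iota (a n) (p n)| <= 2 * c.
Proof.
move=> pp ur c0 ac; have c20 : 0 < 2 * c by rewrite mulr_gt0.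
(* [diagonal_norm_unit] asks for a bound at every index, hence the value 0 outside of [r]. *)
pose b n := if n \in r then (2 * c)^-1 *: a n else 0.
have b1 n : `|b n| < 1.
  rewrite /b; case: ifP => [nr|_]; last by rewrite normr0.
  rewrite normrZ ger0_norm ?invr_ge0 ?(ltW c20)// ltr_pdivrMl// mulr1.
  by rewrite (le_lt_trans (ac _ nr))// mulr2n mulrDl mul1r ltrDl.
have := diagonal_norm_unit pp ur b1.
have -> : \sum_(n <- r) iota (b n) (p n) = (2 * c)^-1 *: \sum_(n <- r) iota (a n) (p n).
  by rewrite scaler_sumr; apply: eq_big_seq => n nr; rewrite /b nr tensorZl.
by rewrite normrZ ger0_norm ?invr_ge0 ?(ltW c20)// ler_pdivrMl// mulr1.
Qed.

Lemma tensor_corner (p : B) : amul p p = p -> astar p = p ->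
  exists j : star_hom A T, forall a, j a = iota a p.
Proof.
move=> p2 ps.
pose f a := iota a p.
have fl : linear f by move=> c a b; exact: (mt_linearl mt).
pose f' : {linear A -> T} := HB.pack f (GRing.isLinear.Build k A T _ f fl).
have fm (a b : A) : f' (amul a b) = amul (f' a) (f' b).
  by rewrite /f' /= /f -(mt_mul mt) p2.
have fs a : f' (astar a) = astar (f' a).
  by rewrite /f' /= /f -(mt_star mt) ps.
by exists (StarHom fm fs).
Qed.

Section Extension.
Context {T' : cstar k} {f : A -> B -> T'}.
Hypotheses (f_linearl : forall (c : k) a a' b, f (c *: a + a') b = c *: f a b + f a' b)
  (f_mul : forall a a' b b', f (amul a a') (amul b b') = amul (f a b) (f a' b'))
  (f_star : forall a b, f (astar a) (astar b) = astar (f a b))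
  (f_bound : forall z, `|\sum_(w <- z) f w.1 w.2| <= `|tensor_sum z|).

Let fsum z := \sum_(w <- z) f w.1 w.2.

(** The closure of the map on finite sums: [f_bound] makes it single-valued and, as [T'] is
    complete, everywhere defined. Each algebraic identity for the extension is then an instance of
    [graph_uniq]. *)
Let graph (t : T) (t' : T') := exists zs : nat -> seq (A * B),
  (fun n => tensor_sum (zs n)) @ \oo --> t /\ (fun n => fsum (zs n)) @ \oo --> t'.

Let comb (c : k) z z' := [seq (c *: w.1, w.2) | w <- z] ++ z'.

Let combT c z z' : tensor_sum (comb c z z') = c *: tensor_sum z + tensor_sum z'.
Proof.
rewrite /tensor_sum /comb big_cat big_map /= scaler_sumr; congr (_ + _).
by apply: eq_bigr => w _; rewrite tensorZl.
Qed.

Let combF c z z' : fsum (comb c z z') = c *: fsum z + fsum z'.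
Proof.
have f0 b : f 0 b = 0.
  by apply: (addrI (f 0 b)); have := f_linearl 1 0 0 b; rewrite !scale1r !addr0 => <-.
rewrite /fsum /comb big_cat big_map /= scaler_sumr; congr (_ + _).
by apply: eq_bigr => w _; rewrite -[c *: w.1]addr0 f_linearl f0 addr0.
Qed.

Let fsumB z z' : `|fsum z - fsum z'| <= `|tensor_sum z - tensor_sum z'|.
Proof.
by have := f_bound (comb (- 1) z' z); rewrite -/(fsum _) combT combF !scaleN1r ![- _ + _]addrC.
Qed.

Let graph_ex (t : T) : exists t' : T', graph t t'.
Proof.
have [zs zt] := tensor_dense t.
have [t' zt'] : exists t' : T', (fun n => fsum (zs n)) @ \oo --> t'.
  apply: cauchy_seq_cvg => e e0; have e20 : 0 < e / 2 by rewrite divr_gt0.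
  have /cvg_seqP /(_ _ e20) [N HN] := zt; exists N => m n Nm mn.
  rewrite (le_trans (fsumB _ _))// (le_trans (ler_distD t _ _))//.
  by rewrite [e]splitr lerD ?HN// distrC HN// (leq_trans Nm).
by exists t', zs.
Qed.

Let graph_uniq (t : T) (t1 t2 : T') : graph t t1 -> graph t t2 -> t1 = t2.
Proof.
move=> [zs [zt zt1]] [zs' [zt' zt2]].
apply/eqP; rewrite -subr_eq0; apply/eqP/(@scalar_squeeze0 R k) => e e0.
apply: (@cvg_norm_le _ _ T' (fun n => fsum (zs n) - fsum (zs' n))).
  exact: cvgB.
have : (fun n => tensor_sum (zs n) - tensor_sum (zs' n)) @ \oo --> t - t by exact: cvgB.
rewrite subrr => /cvg_seqP /(_ _ e0) [N HN]; exists N => n /HN.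
by rewrite sub0r normrN; apply: le_trans.
Qed.

Lemma tensor_extension : exists g : star_hom T T', forall a b, g (iota a b) = f a b.
Proof.
have /choice [g gP] := graph_ex.
have gl : linear g.
  move=> c t t'; have [zs [zt zgt]] := gP t; have [zs' [zt' zgt']] := gP t'.
  apply: (graph_uniq (gP _)); exists (fun n => comb c (zs n) (zs' n)); split.
    by under eq_fun do rewrite combT; apply: cvgD => //; exact: cvgZr.
  by under eq_fun do rewrite combF; apply: cvgD => //; exact: cvgZr.
pose g' : {linear T -> T'} := HB.pack g (GRing.isLinear.Build k T T' _ g gl).
have gm t t' : g' (amul t t') = amul (g' t) (g' t').
  have [zs [zt zgt]] := gP t; have [zs' [zt' zgt']] := gP t'.
  apply: (graph_uniq (gP _)).
  exists (fun n => [seq (amul w.1 w'.1, amul w.2 w'.2) | w <- zs n, w' <- zs' n]); split.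
    suff E : (fun n => tensor_sum [seq (amul w.1 w'.1, amul w.2 w'.2) | w <- zs n, w' <- zs' n]) =
      (fun n => amul (tensor_sum (zs n)) (tensor_sum (zs' n))) by rewrite E; exact: cvg_amul.
    apply/funext => n; rewrite /tensor_sum big_allpairs_dep amul_suml.
    apply: eq_bigr => w _; rewrite amul_sumr; apply: eq_bigr => w' _ /=.
    exact: (mt_mul mt).
  suff E : (fun n => fsum [seq (amul w.1 w'.1, amul w.2 w'.2) | w <- zs n, w' <- zs' n]) =
      (fun n => amul (fsum (zs n)) (fsum (zs' n))) by rewrite E; exact: cvg_amul.
  apply/funext => n; rewrite /fsum big_allpairs_dep amul_suml.
  apply: eq_bigr => w _; rewrite amul_sumr; apply: eq_bigr => w' _ /=.
  exact: f_mul.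
have gs t : g' (astar t) = astar (g' t).
  have [zs [zt zgt]] := gP t; apply: (graph_uniq (gP _)).
  exists (fun n => [seq (astar w.1, astar w.2) | w <- zs n]); split.
    suff E : (fun n => tensor_sum [seq (astar w.1, astar w.2) | w <- zs n]) =
      (fun n => astar (tensor_sum (zs n))) by rewrite E; exact: cvg_astar.
    apply/funext => n; rewrite /tensor_sum big_map astar_sum.
    by apply: eq_bigr => w _; rewrite (mt_star mt).
  suff E : (fun n => fsum [seq (astar w.1, astar w.2) | w <- zs n]) =
      (fun n => astar (fsum (zs n))) by rewrite E; exact: cvg_astar.
  apply/funext => n; rewrite /fsum big_map astar_sum.
  by apply: eq_bigr => w _; rewrite f_star.
exists (StarHom gm gs) => a b /=; apply: (graph_uniq (gP _)).
exists (fun=> [:: (a, b)]); rewrite /tensor_sum /fsum big_seq1 big_seq1.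
by split; exact: cvg_cst.
Qed.

End Extension.

Lemma star_hom_tensor_ext (T' : cstar k) (g h : star_hom T T') :
  (forall a b, g (iota a b) = h (iota a b)) -> g =1 h.
Proof.
move=> gh t; have [zs zt] := tensor_dense t.
have := cvg_star_hom (f := g) zt; move/cvg_seq_unique; apply.
suff -> : (fun n => g (tensor_sum (zs n))) = fun n => h (tensor_sum (zs n)).
  exact: cvg_star_hom.
apply/funext => n; rewrite /tensor_sum !linear_sum; exact: eq_bigr.
Qed.

End MinimalTensor.

(** * C*-algebras from operators *)

Section BoundedOperators.
Context {R : realType} {k : ground R}.

Lemma bounded_linear_continuous (V W : normedModType k) (f : {linear V -> W}) (C : k) :
  0 <= C -> (forall x, `|f x| <= C * `|x|) -> continuous f.
Proof.
move=> C0 fC x; apply/cvgrPdist_le => e e0.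
have C1 : 0 < C + 1 by rewrite ltr_wpDl.
near=> y; rewrite -linearB (le_trans (fC _))//.
apply: (@le_trans _ _ ((C + 1) * `|x - y|)); first by rewrite ler_wpM2r// lerDl.
rewrite mulrC -ler_pdivlMr//.
by near: y; apply: cvgr_dist_le; [exact: cvg_id|exact: divr_gt0].
Unshelve. all: by end_near. Qed.

Lemma opnorm_ex (H : hilbert k) (T : H -> H) (C : k) : 0 <= C ->
  (forall x, `|T x| <= C * `|x|) -> exists n, is_opnorm T n.
Proof.
move=> C0 TC.
have [| |n [n0 nT nmin]] := @scalar_least R k (fun c => forall x, `|T x| <= c * `|x|) C C0 TC.
- move=> c c0 cT x; apply/ler_addgt0Pr => e e0.
  have x1 : 0 < `|x| + 1 by rewrite ltr_wpDl.
  rewrite (le_trans (cT _ (divr_gt0 e0 x1) x))// mulrDl lerD2l.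
  by rewrite mulrAC ler_pdivrMr// ler_wpM2l ?(ltW e0)// lerDl.
- by move=> c d c0 cd cT x; rewrite (le_trans (cT x))// ler_wpM2r.
by exists n; split.
Qed.

Definition nonneg_sqrt (x : k) : k := xget 0 [set y | 0 <= y /\ y ^+ 2 = x].

Lemma nonneg_sqrtP x : 0 <= x -> 0 <= nonneg_sqrt x /\ nonneg_sqrt x ^+ 2 = x.
Proof.
move=> /scalar_sqrt [y y0 yx]; rewrite /nonneg_sqrt.
by case: xgetP => [z -> //|/(_ y)]; case.
Qed.

End BoundedOperators.

(** * The Hilbert space direct sum *)

Section DirectSum.
Context {R : realType} {k : ground R} {H1 H2 : hilbert k}.

(** A new name for the product, which already has the maximum norm as a normed module; only the
    linear structure is copied, and the Hilbert norm is put on it below. *)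
Definition hsum : Type := (H1 * H2)%type.

HB.instance Definition _ := GRing.Lmodule.copy hsum (H1 * H2)%type.

Implicit Types (w z : hsum).

Definition hsum_ip w z : k := ip w.1 z.1 + ip w.2 z.2.

Definition hsum_norm w : k := nonneg_sqrt (hsum_ip w w).

Lemma hsum_normP w : 0 <= hsum_norm w /\ hsum_norm w ^+ 2 = `|w.1| ^+ 2 + `|w.2| ^+ 2.
Proof.
have w0 : 0 <= hsum_ip w w by rewrite addr_ge0// ip_ge0.
by have [n0 nw] := nonneg_sqrtP w0; rewrite {2}/hsum_norm nw /hsum_ip !ip_norm.
Qed.

Lemma hsum_norm_uniq w (x : k) : 0 <= x -> x ^+ 2 = `|w.1| ^+ 2 + `|w.2| ^+ 2 -> hsum_norm w = x.
Proof.
move=> x0 xw; have [n0 nw] := hsum_normP w.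
by apply/eqP; rewrite -(@eqrXn2 _ 2)// xw nw.
Qed.

Lemma hsum_norm_triangle w z : hsum_norm (w + z) <= hsum_norm w + hsum_norm z.
Proof.
have [n0 nwz] := hsum_normP (w + z).
have [w0 nw] := hsum_normP w; have [z0 nz] := hsum_normP z.
rewrite -(@ler_pXn2r _ 2)// ?nnegrE ?addr_ge0// nwz sqrrD nw nz.
set a := `|w.1|; set b := `|w.2|; set c := `|z.1|; set d := `|z.2|.
have [a0 b0 c0 d0] : [/\ 0 <= a, 0 <= b, 0 <= c & 0 <= d] by split; exact: normr_ge0.
apply: (@le_trans _ _ ((a + c) ^+ 2 + (b + d) ^+ 2)).
  by apply: lerD; rewrite ler_pXn2r ?nnegrE ?addr_ge0// ler_normD.
(* Cauchy-Schwarz for two pairs of numbers, with the defect [(a * d - b * c) ^+ 2] of Lagrange's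
   identity. *)
have h : a * c + b * d <= hsum_norm w * hsum_norm z.
  rewrite -(@ler_pXn2r _ 2)// ?nnegrE ?addr_ge0 ?mulr_ge0//.
  rewrite exprMn nw nz -subr_ge0.
  rewrite [X in 0 <= X](_ : _ = (a * d - b * c) ^+ 2).
    apply: real_exprn_even_ge0 => //.
    by apply: realB; apply: realM; exact: ger0_real.
  by rewrite -/a -/b -/c -/d; ring.
rewrite !sqrrD; rewrite [leLHS](_ : _ = a ^+ 2 + b ^+ 2 + (a * c + b * d) *+ 2 + (c ^+ 2 + d ^+ 2)).
  by rewrite lerD2r lerD2l lerMn2r.
by ring.
Qed.

Lemma hsum_normZ (c : k) w : hsum_norm (c *: w) = `|c| * hsum_norm w.
Proof.
have [w0 nw] := hsum_normP w; apply: hsum_norm_uniq; first by rewrite mulr_ge0.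
by rewrite exprMn nw /= !normrZ !exprMn mulrDr.
Qed.

Lemma hsum_norm0_eq0 w : hsum_norm w = 0 -> w = 0.
Proof.
move=> nw0; have [_] := hsum_normP w; rewrite nw0 expr0n /= => /esym/eqP.
rewrite paddr_eq0 ?exprn_ge0// !sqrf_eq0 !normr_eq0.
by case: w {nw0} => u v /= /andP[/eqP-> /eqP->].
Qed.

HB.instance Definition _ := Lmodule_isNormed.Build k hsum
  hsum_norm_triangle hsum_normZ hsum_norm0_eq0.

Lemma hsum_normE w : `|w| ^+ 2 = `|w.1| ^+ 2 + `|w.2| ^+ 2.
Proof. exact: (hsum_normP w).2. Qed.

Lemma hsum_norm_fst w : `|w.1| <= `|w|.
Proof.
by rewrite -(@ler_pXn2r _ 2)// ?nnegrE// hsum_normE lerDl exprn_ge0.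
Qed.

Lemma hsum_norm_snd w : `|w.2| <= `|w|.
Proof.
by rewrite -(@ler_pXn2r _ 2)// ?nnegrE// hsum_normE lerDr exprn_ge0.
Qed.

Lemma hsum_norm_le w : `|w| <= `|w.1| + `|w.2|.
Proof.
rewrite -(@ler_pXn2r _ 2)// ?nnegrE ?addr_ge0// hsum_normE sqrrD addrAC lerDl.
by rewrite mulrn_wge0// mulr_ge0.
Qed.

Lemma hsum_norm_inl (x : H1) : `|((x, 0) : hsum)| = `|x|.
Proof.
by apply/eqP; rewrite -(@eqrXn2 _ 2)// hsum_normE /= normr0 expr0n addr0.
Qed.

Lemma hsum_norm_inr (y : H2) : `|((0, y) : hsum)| = `|y|.
Proof.
by apply/eqP; rewrite -(@eqrXn2 _ 2)// hsum_normE /= normr0 expr0n add0r.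
Qed.

Lemma hsum_complete (F : set_system hsum) : ProperFilter F -> cauchy F -> cvg F.
Proof.
move: F; apply: seq_complete => u uC.
have [x ux] : exists x : H1, (fun n => (u n).1) @ \oo --> x.
  apply: cauchy_seq_cvg => e e0; have [N HN] := uC e e0; exists N => m n Nm mn.
  exact: le_trans (hsum_norm_fst (u n - u m)) (HN m n Nm mn).
have [y uy] : exists y : H2, (fun n => (u n).2) @ \oo --> y.
  apply: cauchy_seq_cvg => e e0; have [N HN] := uC e e0; exists N => m n Nm mn.
  exact: le_trans (hsum_norm_snd (u n - u m)) (HN m n Nm mn).
exists ((x, y) : hsum); apply/cvg_seqP => e e0.
have e20 : 0 < e / 2 by rewrite divr_gt0.
have /cvg_seqP /(_ _ e20) [N HN] := ux; have /cvg_seqP /(_ _ e20) [M HM] := uy.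
exists (maxn N M) => n; rewrite geq_max => /andP[Nn Mn].
apply: le_trans (hsum_norm_le _) _.
by rewrite [e]splitr; apply: lerD; [exact: HN|exact: HM].
Qed.

HB.instance Definition _ := Uniform_isComplete.Build hsum hsum_complete.

Definition hsum_hilbert : hilbert k.
Proof.
refine (@Hilbert R k (hsum : completeNormedModType k) hsum_ip _ _ _).
- move=> c x y z; rewrite /hsum_ip /= !ip_linear mulrDr !addrA.
  by rewrite (ACl (1*3*2*4)).
- by move=> x y; rewrite /hsum_ip (ip_conj x.1) (ip_conj x.2) sconjD.
- by move=> x; rewrite hsum_normE /hsum_ip !ip_norm.
Defined.

End DirectSum.
Arguments hsum {R k} H1 H2.
Arguments hsum_hilbert {R k} H1 H2.

(** No norm is part of the data: boundedness and completeness are phrased through the operators, and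
    the operator norm is added afterwards. The algebraic laws of [oa_mul] and [oa_star] follow from
    those of operators, because the action is faithful. *)
Record operator_algebra (R : realType) (k : ground R) := OperatorAlgebra {
  oa_space : lmodType k;
  oa_hilbert : hilbert k;
  oa_op : oa_space -> {linear oa_hilbert -> oa_hilbert};
  oa_mul : oa_space -> oa_space -> oa_space;
  oa_star : oa_space -> oa_space;
  oa_linear : forall (c : k) a b x,
    oa_op (c *: a + b) x = c *: oa_op a x + oa_op b x;
  oa_bounded : forall a, exists2 C : k, 0 <= C & forall x, `|oa_op a x| <= C * `|x|;
  oa_inj : forall a, (forall x, oa_op a x = 0) -> a = 0;
  oa_mulE : forall a b x, oa_op (oa_mul a b) x = oa_op a (oa_op b x);
  oa_starE : forall a x y, ip (oa_op a x) y = ip x (oa_op (oa_star a) y);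
  oa_complete : forall u : nat -> oa_space,
    (forall e : k, 0 < e -> exists N, forall m n, (N <= m)%N -> (m <= n)%N ->
      forall x, `|oa_op (u n - u m) x| <= e * `|x|) ->
    exists l, forall e : k, 0 < e -> exists N, forall n, (N <= n)%N ->
      forall x, `|oa_op (l - u n) x| <= e * `|x| }.

Section OperatorAlgebra.
Context {R : realType} {k : ground R} (D : operator_algebra k).

Definition oa_carrier : Type := oa_space D.

HB.instance Definition _ := GRing.Lmodule.copy oa_carrier (oa_space D).

Implicit Types (a b : oa_carrier) (c : k).
Local Notation op := (@oa_op R k D).
Local Notation H := (oa_hilbert D).

Definition oa_norm a : k := xget 0 [set n | is_opnorm (op a) n].

Lemma oa_normP a : is_opnorm (op a) (oa_norm a).
Proof.
have [C C0 aC] := oa_bounded a; have [n an] := opnorm_ex C0 aC.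
by rewrite /oa_norm; case: xgetP => [m -> //|/(_ n)].
Qed.

Lemma oa_norm_ge0 a : 0 <= oa_norm a.
Proof. by case: (oa_normP a). Qed.

Lemma oa_op_norm a x : `|op a x| <= oa_norm a * `|x|.
Proof. by case: (oa_normP a). Qed.

Lemma oa_norm_le a c : 0 <= c -> (forall x, `|op a x| <= c * `|x|) -> oa_norm a <= c.
Proof. by move=> c0; case: (oa_normP a) => _ _; apply. Qed.

Lemma oa_opD a b x : op (a + b) x = op a x + op b x.
Proof. by have := oa_linear 1 a b x; rewrite !scale1r. Qed.

Lemma oa_op0 x : op 0 x = 0.
Proof. by apply: (addrI (op 0 x)); rewrite -oa_opD !addr0. Qed.

Lemma oa_opZ c a x : op (c *: a) x = c *: op a x.
Proof. by have := oa_linear c a 0 x; rewrite oa_op0 !addr0. Qed.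

Lemma oa_opN a x : op (- a) x = - op a x.
Proof. by rewrite -scaleN1r oa_opZ scaleN1r. Qed.

Lemma oa_ext a b : (forall x, op a x = op b x) -> a = b.
Proof.
move=> ab; apply/eqP; rewrite -subr_eq0; apply/eqP/oa_inj => x.
by rewrite oa_opD oa_opN ab subrr.
Qed.

Lemma oa_norm_triangle a b : oa_norm (a + b) <= oa_norm a + oa_norm b.
Proof.
apply: oa_norm_le => [|x]; first by rewrite addr_ge0 ?oa_norm_ge0.
by rewrite oa_opD mulrDl (le_trans (ler_normD _ _))// lerD ?oa_op_norm.
Qed.

Lemma oa_normZ c a : oa_norm (c *: a) = `|c| * oa_norm a.
Proof.
have le d b : oa_norm (d *: b) <= `|d| * oa_norm b.
  apply: oa_norm_le => [|x]; first by rewrite mulr_ge0 ?oa_norm_ge0.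
  by rewrite oa_opZ normrZ -mulrA ler_wpM2l// oa_op_norm.
apply/eqP; rewrite eq_le le /=; have [->|c0] := eqVneq c 0.
  by rewrite normr0 mul0r oa_norm_ge0.
have := le c^-1 (c *: a); rewrite scalerA mulVf// scale1r normfV.
by rewrite ler_pdivlMl// normr_gt0.
Qed.

Lemma oa_norm0_eq0 a : oa_norm a = 0 -> a = 0.
Proof.
move=> a0; apply: oa_inj => x; apply/eqP.
by rewrite -normr_le0 (le_trans (oa_op_norm a x))// a0 mul0r.
Qed.

HB.instance Definition _ := Lmodule_isNormed.Build k oa_carrier
  oa_norm_triangle oa_normZ oa_norm0_eq0.

Lemma oa_carrier_complete (F : set_system oa_carrier) :
  ProperFilter F -> cauchy F -> cvg F.
Proof.
move: F; apply: seq_complete => u uC.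
have [|l ul] := @oa_complete R k D u.
  move=> e e0; have [N HN] := uC e e0; exists N => m n Nm mn x.
  by rewrite (le_trans (oa_op_norm _ _))// ler_wpM2r//; exact: HN.
exists (l : oa_carrier); apply/cvg_seqP => e e0.
have [N HN] := ul e e0; exists N => n Nn.
by apply: oa_norm_le => [|x]; [exact: ltW|exact: HN].
Qed.

HB.instance Definition _ := Uniform_isComplete.Build oa_carrier oa_carrier_complete.

Lemma oa_star_norm_le a : oa_norm (oa_star a) <= oa_norm a.
Proof.
apply: oa_norm_le => [|x]; first exact: oa_norm_ge0.
have [->|y0] := eqVneq (op (oa_star a) x) 0.
  by rewrite normr0 mulr_ge0 ?oa_norm_ge0.
rewrite -(ler_pM2l (x := `|op (oa_star a) x|)) ?normr_gt0// -expr2 -ip_norm.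
rewrite -oa_starE; have := cauchy_schwarz (op a (op (oa_star a) x)) x.
rewrite oa_starE ger0_norm ?ip_ge0// => /le_trans; apply.
by rewrite mulrA ler_wpM2r// mulrC oa_op_norm.
Qed.

Definition oa_banach : banach_star_alg k.
Proof.
refine (@BanachStarAlg R k (oa_carrier : completeNormedModType k)
  (@oa_mul R k D) (@oa_star R k D) _ _ _ _ _ _ _).
- by move=> a b c; apply: oa_ext => x; rewrite !oa_mulE.
- by move=> c a b d; apply: oa_ext => x; rewrite oa_opD oa_opZ !oa_mulE oa_opD oa_opZ.
- move=> c a b d; apply: oa_ext => x.
  by rewrite oa_opD oa_opZ !oa_mulE oa_opD oa_opZ linearP.
- move=> c a b; apply: oa_ext => x; apply: ip_ext => y.
  rewrite ip_conj -oa_starE [RHS]ip_conj; congr sconj.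
  by rewrite !oa_opD !oa_opZ ipDl ipZl ipDr ipZr sconjK !oa_starE.
- move=> a b; apply: oa_ext => x; apply: ip_ext => y.
  rewrite ip_conj -oa_starE [RHS]ip_conj; congr sconj.
  by rewrite !oa_mulE !oa_starE.
- move=> a; apply: oa_ext => x; apply: ip_ext => y.
  by rewrite [LHS]ip_conj -oa_starE -ip_conj oa_starE.
- move=> a b; apply: oa_norm_le => [|x]; first by rewrite mulr_ge0 ?oa_norm_ge0.
  rewrite oa_mulE (le_trans (oa_op_norm _ _))// -mulrA.
  by rewrite ler_wpM2l ?oa_norm_ge0 ?oa_op_norm.
Defined.

Definition oa_rep : representation oa_banach H.
Proof.
refine (@Representation R k oa_banach H (@oa_op R k D) _ _ _ _).
- by move=> a; apply: (bounded_linear_continuous (oa_norm_ge0 a)); exact: oa_op_norm.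
- by move=> c a b x; exact: oa_linear.
- exact: oa_mulE.
- exact: oa_starE.
Defined.

Definition oa_cstar : cstar k.
Proof.
refine (@Cstar R k oa_banach _ _).
- move=> a; apply/eqP; rewrite eq_le; apply/andP; split.
    rewrite (le_trans (amul_norm _ _))// expr2 ler_wpM2r//.
    exact: oa_star_norm_le.
  have n0 : 0 <= `|amul (astar a) a| by exact: normr_ge0.
  (* The remaining half of the C*-identity says that [r], the square root of [|a^* a|], bounds [a];
     this holds as [|a x|^2] is the inner product of [x] and [a^* a x]. *)
  have [r r0 rn] := scalar_sqrt n0.
  suff ar : `|a| <= r by rewrite -rn ler_pXn2r// nnegrE.
  apply: oa_norm_le => // x.
  rewrite -(@ler_pXn2r _ 2)// ?nnegrE ?mulr_ge0// -ip_norm oa_starE.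
  rewrite exprMn rn -oa_mulE.
  have := cauchy_schwarz x (op (oa_mul (oa_star a) a) x).
  rewrite oa_mulE -oa_starE ger0_norm ?ip_ge0// => /le_trans; apply.
  rewrite expr2 mulrA [leRHS]mulrC ler_wpM2l//.
  by rewrite -oa_mulE; exact: oa_op_norm.
- by exists H, oa_rep => a; exact: oa_normP.
Defined.

End OperatorAlgebra.

(** * Extensions defined by multipliers *)

(* A *-homomorphism from T to the multipliers of J, realized on the Hilbert
   space L of a representation of J. *)
Record multiplier_hom (R : realType) (k : ground R) (T J : cstar k) (L : hilbert k)
    (Pi : representation J L) (al : T -> L -> L) : Prop := MultiplierHom {
  mh_linear : forall (c : k) s t y, al (c *: s + t) y = c *: al s y + al t y;
  mh_op_linear : forall t (c : k) x y, al t (c *: x + y) = c *: al t x + al t y;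
  mh_bound : exists2 C : k, 0 <= C & forall t y, `|al t y| <= C * `|t| * `|y|;
  mh_mul : forall s t y, al (amul s t) y = al s (al t y);
  mh_star : forall t x y, ip (al t x) y = ip x (al (astar t) y);
  mh_ideal : forall t j, exists l, forall y, Pi l y = al t (Pi j y) }.

(* [B] is the algebra of all pairs (t, al t + Pi j), an extension of T by J. *)
Record is_extension (R : realType) (k : ground R) (T J : cstar k) (L : hilbert k)
    (Pi : representation J L) (al : T -> L -> L) (B : cstar k) (mk : T -> J -> B)
    : Prop := IsExtension {
  ext_surj : forall b, exists t j, b = mk t j;
  ext_inj : forall t j t' j', mk t j = mk t' j' -> t = t' /\ j = j';
  ext_linear : forall (c : k) t j t' j',
    mk (c *: t + t') (c *: j + j') = c *: mk t j + mk t' j';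
  ext_mul : forall t j t' j' l,
    (forall y, al (amul t t') y + Pi l y = al t (al t' y + Pi j' y) + Pi j (al t' y + Pi j' y)) ->
    amul (mk t j) (mk t' j') = mk (amul t t') l;
  ext_mul_ex : forall t j t' j', exists l, forall y,
    al (amul t t') y + Pi l y = al t (al t' y + Pi j' y) + Pi j (al t' y + Pi j' y);
  ext_star : forall t j, astar (mk t j) = mk (astar t) (astar j) }.

Section ExtensionExists.
Context {R : realType} {k : ground R} {T J : cstar k} {LT L : hilbert k}.
Context {tau : representation T LT} {Pi : representation J L} {al : T -> L -> L}.
Hypotheses (tau_iso : isometric_rep tau) (Pi_iso : isometric_rep Pi)
  (mh : multiplier_hom Pi al).
Implicit Types (t : T) (j : J) (x y : L) (c : k).

Let alD s t y : al (s + t) y = al s y + al t y.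
Proof. by have := mh_linear mh 1 s t y; rewrite !scale1r. Qed.

Let al_opD t x y : al t (x + y) = al t x + al t y.
Proof. by have := mh_op_linear mh t 1 x y; rewrite !scale1r. Qed.

(** The summand [tau] remembers [t]: on [L] alone, [al t + Pi j] need not determine the pair, since
    [al t] may itself lie in the image of [Pi]. *)
Let op_fun (p : (T * J)%type) (w : hsum_hilbert LT L) : hsum_hilbert LT L :=
  (tau p.1 w.1, al p.1 w.2 + Pi p.2 w.2).

Let op_linear p : linear (op_fun p).
Proof.
move=> c w z; rewrite /op_fun /=; congr (_, _); first by rewrite linearP.
rewrite -[RHS]/(c *: (al p.1 w.2 + Pi p.2 w.2) + (al p.1 z.2 + Pi p.2 z.2)).
rewrite (mh_op_linear mh) linearP scalerDr !addrA.
by rewrite (ACl (1*3*2*4)).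
Qed.

Let op p : {linear hsum_hilbert LT L -> hsum_hilbert LT L} :=
  HB.pack (op_fun p) (GRing.isLinear.Build k _ _ _ (op_fun p) (op_linear p)).

Let op_lin (c : k) p q w : op (c *: p + q) w = c *: op p w + op q w.
Proof.
rewrite /= /op_fun /=; congr (_, _); first by rewrite rep_linear.
rewrite -[RHS]/(c *: (al p.1 w.2 + Pi p.2 w.2) + (al q.1 w.2 + Pi q.2 w.2)).
by rewrite (mh_linear mh) rep_linear scalerDr !addrA (ACl (1*3*2*4)).
Qed.

Let hnorm_fst (w : hsum_hilbert LT L) : `|w.1| <= `|w|.
Proof. exact: hsum_norm_fst. Qed.

Let hnorm_snd (w : hsum_hilbert LT L) : `|w.2| <= `|w|.
Proof. exact: hsum_norm_snd. Qed.

Let op_bound : exists2 C : k, 0 <= C &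
  forall p w, `|op p w| <= (`|p.1| + C * `|p.1| + `|p.2|) * `|w|.
Proof.
have [C C0 aC] := mh_bound mh; exists C => // p w.
apply: le_trans (hsum_norm_le _) _; rewrite /= !mulrDl -addrA.
apply: lerD; first by rewrite (le_trans (isorep_norm tau_iso _ _))// ler_wpM2l.
rewrite (le_trans (ler_normD _ _))//; apply: lerD.
  by rewrite (le_trans (aC _ _))// ler_wpM2l ?mulr_ge0.
by rewrite (le_trans (isorep_norm Pi_iso _ _))// ler_wpM2l.
Qed.

(** Multipliers act on [J] from the right too, by passing to adjoints. *)
Let al_ideal_r t j : exists l, forall y, Pi l y = Pi j (al t y).
Proof.
have [l lP] := mh_ideal mh (astar t) (astar j).
exists (astar l) => y; apply: ip_ext => z.
by rewrite !rep_star astarK lP (mh_star mh).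
Qed.

Let mul_ex t j t' j' : exists l, forall y,
  al (amul t t') y + Pi l y = al t (al t' y + Pi j' y) + Pi j (al t' y + Pi j' y).
Proof.
have [l1 h1] := mh_ideal mh t j'; have [l2 h2] := al_ideal_r t' j.
exists (l1 + (l2 + amul j j')) => y.
by rewrite !repD h1 h2 rep_mul (mh_mul mh) al_opD linearD !addrA.
Qed.

Let mul_fun : exists m : (T * J)%type -> (T * J)%type -> (T * J)%type,
  forall p q, (m p q).1 = amul p.1 q.1 /\
    forall y, al (m p q).1 y + Pi (m p q).2 y = al p.1 (al q.1 y + Pi q.2 y) + Pi p.2 (al q.1 y + Pi q.2 y).
Proof.
have /choice [m mP] : forall pq : ((T * J) * (T * J))%type, exists l, forall y,
    al (amul pq.1.1 pq.2.1) y + Pi l y =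
    al pq.1.1 (al pq.2.1 y + Pi pq.2.2 y) + Pi pq.1.2 (al pq.2.1 y + Pi pq.2.2 y).
  by move=> pq; exact: mul_ex.
by exists (fun p q => (amul p.1 q.1, m (p, q))) => p q; split => //= y; rewrite (mP (p, q)).
Qed.

Let op_inj p : (forall w, op p w = 0) -> p = 0.
Proof.
case: p => t j p0; have t0 : t = 0.
  apply: (isorep_inj tau_iso) => x; rewrite rep0.
  by have /(congr1 fst) := p0 (x, 0).
congr (_, _) => //; apply: (isorep_inj Pi_iso) => y; rewrite rep0.
have /(congr1 snd) /= := p0 (0, y).
have -> : al t y = 0; last by rewrite add0r.
by rewrite t0; apply: (addrI (al 0 y)); rewrite -alD !addr0.
Qed.

Let op_complete (u : nat -> (T * J)%type) :
  (forall e : k, 0 < e -> exists N, forall m n, (N <= m)%N -> (m <= n)%N ->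
    forall w, `|op (u n - u m) w| <= e * `|w|) ->
  exists l, forall e : k, 0 < e -> exists N, forall n, (N <= n)%N ->
    forall w, `|op (l - u n) w| <= e * `|w|.
Proof.
move=> uC; have [C C0 aC] := mh_bound mh; have [D D0 oD] := op_bound.
have uT (e : k) : 0 < e -> exists N, forall m n, (N <= m)%N -> (m <= n)%N ->
    `|(u n).1 - (u m).1| <= e.
  move=> e0; have [N HN] := uC e e0; exists N => m n Nm mn.
  apply: (isorep_le tau_iso) => [|x]; first exact: ltW.
  have := HN m n Nm mn (x, 0); have := hsum_norm_inl (H2 := L) x; rewrite /Num.norm /= => ->.
  by apply: le_trans; apply: le_trans (hnorm_fst _).
have [t ut] := cauchy_seq_cvg uT.
(* On [L] the operator norm controls only the sum of both parts; the part of [al] is small because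
   the first components are Cauchy, and subtracting it bounds the second components. *)
have [j uj] : exists j : J, (fun n => (u n).2) @ \oo --> j.
  apply: cauchy_seq_cvg => e e0; have e20 : 0 < e / 2 by rewrite divr_gt0.
  have C1 : 0 < C + 1 by rewrite ltr_wpDl.
  have [N HN] := uC _ e20; have [M HM] := uT _ (divr_gt0 e20 C1).
  exists (maxn N M) => m n; rewrite geq_max => /andP[Nm Mm] mn.
  apply: (isorep_le Pi_iso) => [|y]; first exact: ltW.
  have := HN m n Nm mn (0, y); have := hsum_norm_inr (H1 := LT) y; rewrite /Num.norm /= => ->.
  move=> /(le_trans (hnorm_snd _)) /= h.
  have {}h : `|al ((u n).1 - (u m).1) y + Pi ((u n).2 - (u m).2) y| <= e / 2 * `|y| by exact: h.
  rewrite -(addKr (al ((u n).1 - (u m).1) y) (Pi _ y)) (le_trans (ler_normD _ _))//.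
  rewrite [e]splitr mulrDl lerD// normrN (le_trans (aC _ _))// ler_wpM2r//.
  apply: (@le_trans _ _ ((C + 1) * `|(u n).1 - (u m).1|)).
    by rewrite ler_wpM2r// lerDl.
  by rewrite mulrC -ler_pdivlMr// HM.
exists (t, j) => e e0; have D2 : 0 < 2 + D by rewrite ltr_pwDl.
have eD := divr_gt0 e0 D2.
have /cvg_seqP /(_ _ eD) [N HN] := ut; have /cvg_seqP /(_ _ eD) [M HM] := uj.
exists (maxn N M) => n; rewrite geq_max => /andP[Nn Mn] w.
rewrite (le_trans (oD _ _))// ler_wpM2r//=.
(* The three summands in [op_bound] are at most [d], [D * d] and [d]. *)
set d := e / (2 + D) in eD HN HM.
have -> : e = d + D * d + d.
  rewrite addrAC -mulr2n -mulr_natl -mulrDl /d mulrC divfK//.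
  by rewrite gt_eqF.
by rewrite !lerD ?HN ?HM// ler_wpM2l ?HN.
Qed.

Lemma extension_exists : exists (B : cstar k) (mk : T -> J -> B), is_extension Pi al mk.
Proof.
have [m mP] := mul_fun.
have opM p q w : op (m p q) w = op p (op q w).
  have [m1 m2] := mP p q; rewrite /= /op_fun /= m2 m1; congr (_, _).
  exact: rep_mul.
have opS (p : (T * J)%type) (w z : hsum_hilbert LT L) :
    ip (op p w) z = ip w (op (astar p.1, astar p.2) z).
  rewrite /= /hsum_ip /= rep_star; congr (_ + _).
  by rewrite ipDl ipDr (mh_star mh) rep_star.
have opB p : exists2 C : k, 0 <= C & forall w, `|op p w| <= C * `|w|.
  have [C C0 oC] := op_bound; exists (`|p.1| + C * `|p.1| + `|p.2|).
    by rewrite !addr_ge0 ?mulr_ge0.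
  exact: oC.
pose D := @OperatorAlgebra R k (T * J)%type (hsum_hilbert LT L) op m
  (fun p => (astar p.1, astar p.2)) op_lin opB op_inj opM opS op_complete.
exists (oa_cstar D), (fun t j => (t, j) : oa_carrier D); split.
- by move=> [t j]; exists t, j.
- by move=> t j t' j' [].
- by [].
- move=> t j t' j' l lP; apply: (@oa_ext R k D) => w.
  rewrite [LHS]opM /= /op_fun /=; congr (_, _); first by rewrite rep_mul.
  by rewrite lP.
- exact: mul_ex.
- by [].
Qed.

End ExtensionExists.

Section ExtensionMaps.
Context {R : realType} {k : ground R} {T J B : cstar k} {L : hilbert k}.
Context {Pi : representation J L} {al : T -> L -> L} {mk : T -> J -> B}.
Hypotheses (mh : multiplier_hom Pi al) (ext : is_extension Pi al mk).

(** A homomorphism out of the extension, given in coordinates. Multiplicativity is tested on an [l]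
    that represents the product, for the ideal component of a product is known only through its
    action on [L]. *)
Lemma from_extension (Y : cstar k) (h : T -> J -> Y) :
  (forall (c : k) t j t' j', h (c *: t + t') (c *: j + j') = c *: h t j + h t' j') ->
  (forall t j t' j' l,
    (forall y, al (amul t t') y + Pi l y = al t (al t' y + Pi j' y) + Pi j (al t' y + Pi j' y)) ->
    h (amul t t') l = amul (h t j) (h t' j')) ->
  (forall t j, h (astar t) (astar j) = astar (h t j)) ->
  exists th : star_hom B Y, forall t j, th (mk t j) = h t j.
Proof.
move=> hl hm hs.
have /choice [p pP] : forall b, exists p : (T * J)%type, b = mk p.1 p.2.
  by move=> b; have [t [j ->]] := ext_surj ext b; exists (t, j).
have pE t j : p (mk t j) = (t, j).
  by have /esym/(ext_inj ext) [] := pP (mk t j); case: (p _) => a b /= -> ->.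
pose f b := h (p b).1 (p b).2.
have fE t j : f (mk t j) = h t j by rewrite /f pE.
have fl : linear f.
  by move=> c a b; rewrite (pP a) (pP b) -(ext_linear ext) !fE hl.
pose f' : {linear B -> Y} := HB.pack f (GRing.isLinear.Build k B Y _ f fl).
have fm (a b : B) : f' (amul a b) = amul (f' a) (f' b).
  rewrite (pP a) (pP b) /=.
  have [l lP] := ext_mul_ex ext (p a).1 (p a).2 (p b).1 (p b).2.
  by rewrite (ext_mul ext lP) !fE (hm _ _ _ _ _ lP).
have fs (a : B) : f' (astar a) = astar (f' a).
  by rewrite (pP a) (ext_star ext) /= !fE hs.
by exists (StarHom fm fs) => t j /=; exact: fE.
Qed.

(** The last hypothesis says that the operator [al (f a) + Pi (g a)] is multiplicative in [a]. *)
Lemma into_extension (X : cstar k) (f : star_hom X T) (g : X -> J) :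
  (forall (c : k) a b, g (c *: a + b) = c *: g a + g b) ->
  (forall a, g (astar a) = astar (g a)) ->
  (forall a b y, al (f (amul a b)) y + Pi (g (amul a b)) y =
    al (f a) (al (f b) y + Pi (g b) y) + Pi (g a) (al (f b) y + Pi (g b) y)) ->
  exists th : star_hom X B, forall a, th a = mk (f a) (g a).
Proof.
move=> gl gs gm.
pose h a := mk (f a) (g a).
have hl : linear h.
  by move=> c a b; rewrite /h linearP gl (ext_linear ext).
pose h' : {linear X -> B} := HB.pack h (GRing.isLinear.Build k X B _ h hl).
have hm (a b : X) : h' (amul a b) = amul (h' a) (h' b).
  rewrite /= /h (@ext_mul _ _ _ _ _ _ _ _ _ ext _ _ _ _ (g (amul a b))) ?sh_mul// => y.
  by rewrite -gm sh_mul.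
have hs (a : X) : h' (astar a) = astar (h' a).
  by rewrite /= /h (ext_star ext) sh_star gs.
by exists (StarHom hm hs).
Qed.

Let al0 y : al 0 y = 0.
Proof.
by apply: (addrI (al 0 y)); have := mh_linear mh 1 0 0 y; rewrite !scale1r !addr0 => <-.
Qed.

Lemma extension_split : exists (i : star_hom J B) (q : star_hom B T),
  [/\ split_exact_cstar i q, forall j, i j = mk 0 j & forall t j, q (mk t j) = t].
Proof.
have [q qE] : exists q : star_hom B T, forall t j, q (mk t j) = t.
  by apply: (@from_extension T (fun t j => t)).
have mkl : linear (mk 0).
  by move=> c a b; rewrite -(ext_linear ext) scaler0 addr0.
pose i' : {linear J -> B} := HB.pack (mk 0) (GRing.isLinear.Build k J B _ (mk 0) mkl).
have im (a b : J) : i' (amul a b) = amul (i' a) (i' b).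
  rewrite /= (@ext_mul _ _ _ _ _ _ _ _ _ ext _ _ _ _ (amul a b)) ?amul0l// => y.
  by rewrite !al0 !add0r rep_mul.
have is' (a : J) : i' (astar a) = astar (i' a) by rewrite /= (ext_star ext) astar0.
exists (StarHom im is'), q; split=> //.
(* The pairs [(t, 0)] are closed under products because [al] is multiplicative. *)
have [s sE] : exists s : star_hom T B, forall t, s t = mk t 0.
  apply: (@into_extension T (sh_id T) (fun=> 0)) => /=.
  - by move=> c a b; rewrite scaler0 addr0.
  - by move=> a; rewrite astar0.
  - by move=> a b y; rewrite !rep0 !addr0 (mh_mul mh).
split.
- by move=> j j' /= /(ext_inj ext) [].
- apply/seteqP; split => [_ [j _ <-]|b] /=; first exact: qE.
  have [t [j ->]] := ext_surj ext b; rewrite qE => ->; by exists j.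
- by exists s => t; rewrite sE qE.
Qed.

End ExtensionMaps.

(** * Compact operators *)

Section CompactOperators.
Context {R : realType} {k : ground R} {H : hilbert k} {KK : cstar k}
  {rho : representation KK H} {p : KK}.
Hypotheses (Hinf : infinite_dimensional H) (HKK : is_compact_algebra rho)
  (Hp : rank_one_projection rho p).
Implicit Types (a b : KK) (x y : H).

Let rho_iso : isometric_rep rho := HKK.1.

(** [Y] maps the unit ball into itself, so the image of the ball under [Z] lies in the image under
    [X] of a compact set. *)
Lemma compact_operator_comp (X S Y : {linear H -> H}) (C : k) : 0 <= C ->
  (forall x, `|X x| <= C * `|x|) -> (forall x, `|Y x| <= `|x|) ->
  compact_operator S -> forall Z : {linear H -> H},
  (forall x, Z x = X (S (Y x))) -> compact_operator Z.
Proof.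
move=> C0 XC YC Sc Z ZE; rewrite /compact_operator.
have Kc : compact (X @` closure (S @` [set x : H | `|x| <= 1])).
  apply: continuous_compact Sc; apply: continuous_subspaceT.
  exact: bounded_linear_continuous C0 XC.
apply: (subclosed_compact _ Kc); first exact: closed_closure.
have Kcl : closed (X @` closure (S @` [set x : H | `|x| <= 1])).
  by apply: compact_closed Kc; exact: norm_hausdorff.
rewrite closureE; apply: smallest_sub => // _ [x /= x1 <-]; rewrite ZE.
exists (S (Y x)) => //; apply: subset_closure; exists (Y x) => //=.
exact: le_trans (YC x) x1.
Qed.

Lemma compact_algebra_comp (f g : H -> H) (C : k) b : linear f -> linear g -> 0 <= C ->
  (forall x, `|f x| <= C * `|x|) -> (forall x, `|g x| <= `|x|) ->
  exists b', forall x, rho b' x = f (rho b (g x)).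
Proof.
move=> fl gl C0 fC gC.
pose X : {linear H -> H} := HB.pack f (GRing.isLinear.Build k H H _ f fl).
pose Y : {linear H -> H} := HB.pack g (GRing.isLinear.Build k H H _ g gl).
pose Z : {linear H -> H} := X \o (rho b \o Y).
have [|a aE] := (HKK.2 Z).1; last by exists a.
apply: (@compact_operator_comp X (rho b) Y C) => //.
by apply/(HKK.2 (rho b)).2; exists b.
Qed.

Lemma rank_one_vector : exists2 e0 : H, ip e0 e0 = 1 &
  forall x, rho p x = ip x e0 *: e0.
Proof.
have [p2 ps [v [v0 pv]]] := Hp.
have nv : `|v| != 0 by rewrite normr_eq0.
pose e := `|v|^-1 *: v.
have e1 : ip e e = 1 by rewrite ip_norm /e normrZ normfV normr_id mulVf// expr1n.
have pe : rho p e = e.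
  have : range (fun c : k => c *: v) e by exists `|v|^-1.
  by rewrite -pv => -[y _ <-]; rewrite -rep_mul p2.
exists e => // x.
have : range (rho p) (rho p x) by exists x.
rewrite pv => -[c _ cE].
have cE' : rho p x = (c * `|v|) *: e by rewrite -cE /e scalerA mulfK.
have : ip (rho p x) e = ip x e by rewrite rep_star ps pe.
by rewrite cE' ipZl e1 mulr1 => ->.
Qed.

Lemma interval_bessel (e : nat -> H) y N M : orthonormal e ->
  `|\sum_(N <= n < M) ip y (e n) *: e n| <= `|y|.
Proof.
move=> eo; rewrite -{1}[N]add0n big_addn big_mkord.
apply: (@bessel _ _ _ (fun n => e (n + N)%N) (fun n => e (n + N)%N));
  by move=> m n; rewrite eo eqn_add2r.
Qed.

Lemma interval_tail (e : nat -> H) y (eps : k) : orthonormal e -> 0 < eps ->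
  exists N, forall N' M, (N <= N')%N -> `|\sum_(N' <= n < M) ip y (e n) *: e n| <= eps.
Proof.
move=> eo e0; have e20 : 0 < eps / 2 by rewrite divr_gt0.
have /cvg_seqP /(_ _ e20) [N HN] := transport_cvg eo eo y.
exists N => N' M NN'; have [N'M|MN'] := leqP N' M; last first.
  by rewrite big_geq ?normr0 ?(ltW e0)// ltnW.
have -> : \sum_(N' <= n < M) ip y (e n) *: e n =
    \sum_(n < M) ip y (e n) *: e n - \sum_(n < N') ip y (e n) *: e n.
  rewrite -!(big_mkord xpredT (fun n => ip y (e n) *: e n)).
  by rewrite [in X in _ = X - _](big_cat_nat _ N'M)//= addrAC subrr add0r.
rewrite (le_trans (ler_distD (transport e e y) _ _))// [eps]splitr lerD//.
  by rewrite distrC HN// (leq_trans NN').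
exact: HN.
Qed.

(** The tail projections of [e] are contractions tending to 0 at each vector, hence uniformly on a
    compact set; here it is the closure of the image of the unit ball under [rho b]. *)
Lemma compact_tail (e : nat -> H) b (eps : k) : orthonormal e -> 0 < eps ->
  exists N, forall M x, `|\sum_(N <= n < M) ip (rho b x) (e n) *: e n| <= eps * `|x|.
Proof.
move=> eo e0; have e20 : 0 < eps / 2 by rewrite divr_gt0.
have /compact_near_coveringP cov : compact_operator (rho b).
  by apply/(HKK.2 (rho b)).2; exists b.
pose P N (y : H) := forall M, `|\sum_(N <= n < M) ip y (e n) *: e n| <= eps.
have [|N0 _ HN] := cov nat \oo P _.
  move=> y _; have [N HN] := interval_tail y eo e20.
  exists ([set y' | `|y - y'| <= eps / 2], [set n | (N <= n)%N]) => /=.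
    split; last by exists N.
    by apply: cvgr_dist_le => //; exact: cvg_id.
  move=> [y' n] /= [yy' Nn] M.
  have -> : \sum_(n <= n0 < M) ip y' (e n0) *: e n0 =
      \sum_(n <= n0 < M) ip y (e n0) *: e n0 - \sum_(n <= n0 < M) ip (y - y') (e n0) *: e n0.
    rewrite -sumrB; apply: eq_bigr => i _.
    by rewrite -scalerBl ipBl opprB addrC subrK.
  rewrite (le_trans (ler_normB _ _))// [eps]splitr lerD//; first exact: HN.
  by rewrite (le_trans (interval_bessel _ _ _ eo)).
exists N0 => M x; have [->|x0] := eqVneq x 0.
  rewrite big1 ?normr0 ?mulr0// => n _; by rewrite linear0 ip0l scale0r.
have nx : 0 < `|x| by rewrite normr_gt0.
have := HN N0 (leqnn _) (rho b (`|x|^-1 *: x)) _ M.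
have -> : \sum_(N0 <= n < M) ip (rho b (`|x|^-1 *: x)) (e n) *: e n =
    `|x|^-1 *: \sum_(N0 <= n < M) ip (rho b x) (e n) *: e n.
  by rewrite scaler_sumr; apply: eq_bigr => n _; rewrite linearZ ipZl scalerA.
rewrite normrZ normfV normr_id ler_pdivrMl// mulrC; apply.
apply: subset_closure; exists (`|x|^-1 *: x) => //=.
by rewrite normrZ normfV normr_id mulVf// gt_eqF.
Qed.

(* Diagonal matrix units of KK for an orthonormal sequence starting at p; the
   reindexings are conjugations by isometries of H. *)
Record diagonal_units (p : KK) (u : nat -> KK) : Prop := DiagonalUnits {
  du_proj : orthogonal_projections u;
  du_0 : u 0%N = p;
  du_reindex : forall i : nat -> nat, injective i ->
    exists mu : star_hom KK KK, (forall n, mu (u n) = u (i n)) /\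
      forall m b, (forall n, i n <> m) -> amul (u m) (mu b) = 0;
  du_tail : forall b (eps : k), 0 < eps -> exists N, forall M,
    `|amul (\sum_(N <= n < M) u n) b| <= eps }.

Lemma diagonal_units_ex : exists u, diagonal_units p u.
Proof.
have [e0 e01 pE] := rank_one_vector.
have [e eo ee0] := orthonormal_sequence Hinf e01.
have ne n : `|e n| = 1.
  by apply/eqP; rewrite -(@eqrXn2 _ 2)// -ip_norm eo eqxx expr1n.
have r1l (x y : H) : linear (fun z : H => ip z x *: y).
  by move=> c a b; rewrite ip_linear scalerDl scalerA.
have r1b m n z : `|ip z (e m) *: e n| <= `|z|.
  by rewrite normrZ ne mulr1 (le_trans (cauchy_schwarz _ _))// ne mulr1.
have /choice [u uE] : forall n, exists b, forall x, rho b x = ip x (e n) *: e n.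
  move=> n.
  (* The projection to [e n] is [p] between the rank one operators that move [e n] to [e 0] and
     [e 0] to [e n]. *)
  have [|b bE] := @compact_algebra_comp _ _ 1 p (r1l (e 0%N) (e n)) (r1l (e n) (e 0%N)) ler01 _ (r1b n 0%N).
    by move=> x; rewrite mul1r.
  exists b => x; by rewrite bE pE ee0 !ipZl -ee0 !eo eqxx !mulr1.
exists u; split.
- split=> [n|m n]; apply: (isorep_inj rho_iso) => x.
    apply: ip_ext => z; rewrite rep_star astarK !uE ipZr ipZl -ip_conj mulrC.
    by [].
  rewrite rep_mul !uE ipZl eo; case: (m == n) / eqP => [->|mn].
    by rewrite eqxx uE mulr1.
  have /negbTE -> : n != m by apply/eqP => nm; apply: mn.
  by rewrite mulr0 scale0r rep0.
- by apply: (isorep_inj rho_iso) => x; rewrite uE pE ee0.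
- move=> i inj_i.
  (* For the isometry [V = iso e i], the map [b |-> V b V^*] is multiplicative since [V^* V = 1]. *)
  have /choice [mu muE] : forall b, exists b', forall x, rho b' x = iso e i (rho b (coiso e i x)).
    move=> b; apply: (@compact_algebra_comp _ _ 1).
    + by move=> c x y; exact: iso_linear.
    + by move=> c x y; exact: coiso_linear.
    + exact: ler01.
    + by move=> x; rewrite mul1r iso_norm.
    + by move=> x; exact: coiso_norm.
  have mul : linear mu.
    move=> c a b; apply: (isorep_inj rho_iso) => x.
    by rewrite rep_linear !muE rep_linear iso_linear.
  pose mu' : {linear KK -> KK} := HB.pack mu (GRing.isLinear.Build k KK KK _ mu mul).
  have mum a b : mu' (amul a b) = amul (mu' a) (mu' b).
    apply: (isorep_inj rho_iso) => x.
    by rewrite /= rep_mul !muE rep_mul isoK.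
  have mus a : mu' (astar a) = astar (mu' a).
    apply: (isorep_inj rho_iso) => x; apply: ip_ext => z.
    rewrite /= [RHS]rep_star astarK !muE iso_adj// rep_star astarK.
    by rewrite [RHS]ip_conj iso_adj// -ip_conj.
  exists (StarHom mum mus); split=> [n|m b im] /=; apply: (isorep_inj rho_iso) => x.
    rewrite muE !uE -(iso_basis eo inj_i).
    have isoZ c y : iso e i (c *: y) = c *: iso e i y.
      rewrite -[c *: y]addr0 iso_linear//.
      suff -> : iso e i 0 = 0 by rewrite addr0.
      by apply/eqP; rewrite -normr_eq0 iso_norm// normr0.
    by rewrite isoZ [ip x _]ip_conj iso_adj// -ip_conj.
  by rewrite rep_mul uE muE rep0 iso_adj// coiso0// ip0r scale0r.
- move=> b eps e_gt0; have [N HN] := compact_tail b eo e_gt0.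
  exists N => M; apply: (isorep_le rho_iso) => [|x]; first exact: ltW.
  rewrite rep_mul rep_sum; under eq_bigr do rewrite uE.
  exact: HN.
Qed.

End CompactOperators.

(** * Diagonal multipliers *)

Lemma injective_tends (i : nat -> nat) : injective i ->
  forall K, exists N, forall n, (N <= n)%N -> (K <= i n)%N.
Proof.
move=> inj_i; elim=> [|K [N HN]]; first by exists 0%N.
have [[n0 n0K]|nK] := pselect (exists n, i n = K).
  exists (maxn N n0.+1) => n; rewrite geq_max => /andP[Nn n0n].
  rewrite ltn_neqAle HN// andbT; apply/eqP => E.
  by move: n0n; rewrite (inj_i n0 n) ?ltnn// n0K.
exists N => n Nn; rewrite ltn_neqAle HN// andbT; apply/eqP => E.
by apply: nK; exists n.
Qed.

Lemma sum_reindex (V : nmodType) (i : nat -> nat) (F : nat -> V) N M :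
  injective i -> (forall n, (n < N)%N -> (i n < M)%N) ->
  \sum_(0 <= n < N) F (i n) =
  \sum_(0 <= m < M) (if m \in [seq i n | n <- index_iota 0 N] then F m else 0).
Proof.
move=> inj_i iM; rewrite -big_mkcond -big_filter /=.
rewrite -(big_map i xpredT F); apply/perm_big/uniq_perm.
- by rewrite map_inj_uniq// iota_uniq.
- by rewrite filter_uniq// iota_uniq.
move=> m; rewrite mem_filter mem_index_iota /=.
case: (boolP (m \in _)) => //= /mapP[n]; rewrite mem_index_iota => /= nN ->.
by rewrite iM.
Qed.

Section Diagonals.
Context {R : realType} {k : ground R} {A KK J : cstar k} {L : hilbert k}.
Context {tensor : A -> KK -> J} {p : KK} {u : nat -> KK} {Pi : representation J L}.
Hypotheses (mt : is_min_tensor tensor) (du : diagonal_units p u) (Pi_iso : isometric_rep Pi).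
Implicit Types (a b : nat -> A) (j : J) (x y : L).

Definition diag a N M : J := \sum_(N <= n < M) tensor (a n) (u n).

Definition bounded_seq a := exists2 C : k, 0 < C & forall n, `|a n| <= C.

Lemma diag_bound a N M (c : k) : 0 < c ->
  (forall n, (N <= n < M)%N -> `|a n| <= c) -> `|diag a N M| <= 2 * c.
Proof.
move=> c0 ac; apply: (diagonal_norm mt (du_proj du)) => //; first exact: iota_uniq.
by move=> n; rewrite mem_index_iota; exact: ac.
Qed.

Lemma diag_linear (c : k) a b N M :
  diag (fun n => c *: a n + b n) N M = c *: diag a N M + diag b N M.
Proof.
rewrite /diag scaler_sumr -big_split; apply: eq_bigr => n _ /=.
exact: (mt_linearl mt).
Qed.

Lemma diagB a b N M : diag (fun n => a n - b n) N M = diag a N M - diag b N M.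
Proof.
by rewrite /diag -sumrB; apply: eq_bigr => n _; rewrite (tensorBl mt).
Qed.

Lemma diag_mul a b N M :
  amul (diag a N M) (diag b N M) = diag (fun n => amul (a n) (b n)) N M.
Proof.
have [_ pp] := du_proj du.
rewrite /diag amul_suml; apply: eq_big_seq => n nr; rewrite amul_sumr.
rewrite (bigD1_seq n)//= ?iota_uniq// -(mt_mul mt) pp eqxx big1 ?addr0// => m mn.
by rewrite -(mt_mul mt) pp eq_sym (negbTE mn) (tensor0r mt).
Qed.

Lemma diag_star a N M : astar (diag a N M) = diag (fun n => astar (a n)) N M.
Proof.
have [ps _] := du_proj du.
by rewrite /diag astar_sum; apply: eq_bigr => n _; rewrite -(mt_star mt) ps.
Qed.

Lemma diag_cat a N M K : (N <= M)%N -> (M <= K)%N -> diag a N K = diag a N M + diag a M K.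
Proof. by move=> NM MK; rewrite /diag (big_cat_nat NM MK). Qed.

Lemma bounded_seq_lin (c : k) a b : bounded_seq a -> bounded_seq b ->
  bounded_seq (fun n => c *: a n + b n).
Proof.
move=> [C C0 aC] [D D0 bD]; exists (`|c| * C + D).
  by rewrite ltr_wpDl// mulr_ge0// ltW.
move=> n; rewrite (le_trans (ler_normD _ _))// normrZ lerD//.
by rewrite ler_wpM2l.
Qed.

Lemma bounded_seqB a b : bounded_seq a -> bounded_seq b ->
  bounded_seq (fun n => a n - b n).
Proof.
move=> [C C0 aC] [D D0 bD]; exists (C + D); first by rewrite addr_gt0.
by move=> n; rewrite (le_trans (ler_normB _ _))// lerD.
Qed.

Lemma bounded_seq_mul a b : bounded_seq a -> bounded_seq b ->
  bounded_seq (fun n => amul (a n) (b n)).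
Proof.
move=> [C C0 aC] [D D0 bD]; exists (C * D); first by rewrite mulr_gt0.
by move=> n; rewrite (le_trans (amul_norm _ _))// ler_pM.
Qed.

Lemma bounded_seq_star a : bounded_seq a -> bounded_seq (fun n => astar (a n)).
Proof. by move=> [C C0 aC]; exists C => // n; rewrite norm_astar. Qed.

(** The terms are pairwise orthogonal vectors, as the [u n] are orthogonal projections, and
    [diag_bound] bounds the partial sums. *)
Lemma diag_cvg_ex a x : bounded_seq a ->
  exists l : L, (fun N => Pi (diag a 0 N) x) @ \oo --> l.
Proof.
have [ps pp] := du_proj du.
move=> [C C0 aC].
have E : (fun N => Pi (diag a 0 N) x) = (fun N => \sum_(n < N) Pi (tensor (a n) (u n)) x).
  by apply/funext => N; rewrite /diag rep_sum big_mkord.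
rewrite E; apply: (@orthogonal_series _ _ _ (fun n => Pi (tensor (a n) (u n)) x) (2 * C * `|x|)) => [m n mn|N].
  rewrite rep_star -rep_mul -(mt_star mt) -(mt_mul mt) ps pp (negbTE mn).
  by rewrite (tensor0r mt) rep0 ip0r.
rewrite -(congr1 (@^~ N) E) (le_trans (isorep_norm Pi_iso _ _))// ler_wpM2r//.
exact: diag_bound.
Qed.

(* Strong limit of the truncations; junk for unbounded sequences. *)
Definition diag_op a x : L := xget 0 [set l | (fun N => Pi (diag a 0 N) x) @ \oo --> l].

Lemma diag_cvg a (ab : bounded_seq a) x : (fun N => Pi (diag a 0 N) x) @ \oo --> diag_op a x.
Proof.
rewrite /diag_op; case: xgetP => [l -> //|].
by have [l al] := diag_cvg_ex x ab; move/(_ l).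
Qed.
Arguments diag_cvg {a} ab x : rename.

Lemma diag_op_linear (c : k) a b x : bounded_seq a -> bounded_seq b ->
  diag_op (fun n => c *: a n + b n) x = c *: diag_op a x + diag_op b x.
Proof.
move=> ab bb; apply: (cvg_seq_unique (diag_cvg (bounded_seq_lin c ab bb) x)).
under eq_fun do rewrite diag_linear rep_linear.
by apply: cvgD; [apply: cvgZr|]; exact: diag_cvg.
Qed.

Lemma diag_opB a b x : bounded_seq a -> bounded_seq b ->
  diag_op (fun n => a n - b n) x = diag_op a x - diag_op b x.
Proof.
move=> ab bb; apply: (cvg_seq_unique (diag_cvg (bounded_seqB ab bb) x)).
under eq_fun do rewrite diagB repB.
by apply: cvgB; exact: diag_cvg.
Qed.

Lemma diag_op_linear_r a (c : k) x y : bounded_seq a ->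
  diag_op a (c *: x + y) = c *: diag_op a x + diag_op a y.
Proof.
move=> ab; apply: (cvg_seq_unique (diag_cvg ab _)).
under eq_fun do rewrite linearP.
by apply: cvgD; [apply: cvgZr|]; exact: diag_cvg.
Qed.

Lemma diag_op_norm a (C : k) x : 0 < C -> (forall n, `|a n| <= C) ->
  `|diag_op a x| <= 2 * C * `|x|.
Proof.
move=> C0 aC; have ab : bounded_seq a by exists C.
apply: (cvg_norm_le (diag_cvg ab x)); exists 0%N => N _.
by rewrite (le_trans (isorep_norm Pi_iso _ _))// ler_wpM2r// diag_bound.
Qed.

Lemma diag_op_mul a b x : bounded_seq a -> bounded_seq b ->
  diag_op (fun n => amul (a n) (b n)) x = diag_op a (diag_op b x).
Proof.
move=> ab bb; have [C C0 aC] := ab.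
apply: (cvg_seq_unique (diag_cvg (bounded_seq_mul ab bb) x)).
under eq_fun do rewrite -diag_mul rep_mul.
have /cvg_seqP h1 := diag_cvg ab (diag_op b x); have /cvg_seqP h2 := diag_cvg bb x.
apply/cvg_seqP => e e0; have e20 : 0 < e / 2 by rewrite divr_gt0.
have C20 : 0 < 2 * C by rewrite mulr_gt0.
have [N HN] := h1 _ e20; have [M HM] := h2 _ (divr_gt0 e20 C20).
exists (maxn N M) => n; rewrite geq_max => /andP[Nn Mn].
rewrite (le_trans (ler_distD (Pi (diag a 0 n) (diag_op b x)) _ _))//.
rewrite [e]splitr lerD ?HN// -linearB (le_trans (isorep_norm Pi_iso _ _))//.
apply: (@le_trans _ _ (2 * C * `|diag_op b x - Pi (diag b 0 n) x|)).
  by rewrite ler_wpM2r// diag_bound.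
by rewrite mulrC -ler_pdivlMr// HM.
Qed.

Lemma diag_op_star a x y : bounded_seq a ->
  ip (diag_op a x) y = ip x (diag_op (fun n => astar (a n)) y).
Proof.
move=> ab; apply: (cvg_ip_eq (diag_cvg ab x) (diag_cvg (bounded_seq_star ab) y)).
by move=> N; rewrite rep_star diag_star.
Qed.

Lemma diag_op_limit a l : bounded_seq a ->
  (fun N => diag a 0 N) @ \oo --> l -> forall y, Pi l y = diag_op a y.
Proof.
move=> ab al y; apply: (cvg_seq_unique _ (diag_cvg ab y)).
apply: (@cvg_bounded_linear R k J L (fun j => Pi j y) `|y| (fun N => diag a 0 N) l _ _ _ al) => //.
  by move=> s t; rewrite repB.
by move=> s; rewrite mulrC isorep_norm.
Qed.

Lemma diag_op_ideal a j l : bounded_seq a ->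
  (fun N => amul (diag a 0 N) j) @ \oo --> l -> forall y, Pi l y = diag_op a (Pi j y).
Proof.
move=> ab al y; have := diag_cvg ab (Pi j y); under eq_fun do rewrite -rep_mul.
apply: cvg_seq_unique.
apply: (@cvg_bounded_linear R k J L (fun j => Pi j y) `|y| (fun N => amul (diag a 0 N) j) l _ _ _ al) => //.
  by move=> s t; rewrite repB.
by move=> s; rewrite mulrC isorep_norm.
Qed.

(** On an elementary tensor, a diagonal supported beyond [N] sees the second factor only through the
    tail projection of the units, and [du_tail] makes this small uniformly in [M] and in the
    contractive sequence [a]. *)
Lemma diag_tail_sum (z : seq (A * KK)) (e : k) : 0 < e -> exists N, forall M a,
  (forall n, `|a n| <= 1) -> `|amul (diag a N M) (tensor_sum (iota := tensor) z)| <= e.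
Proof.
have [ps pp] := du_proj du.
elim: z e => [|[a' b] z IH] e e0.
  exists 0%N => M a _; rewrite /tensor_sum big_nil amul0r normr0; exact: ltW.
have e20 : 0 < e / 2 by rewrite divr_gt0.
have [N1 H1] := IH _ e20.
(* 8 is the product of the constant 2 of [diag_bound] and the constant 4 of [tensor_norm]. *)
have c0 : 0 < 8 * (`|a'| + 1) by rewrite mulr_gt0// ltr_wpDl.
have [N2 H2] := du_tail du b (divr_gt0 e20 c0).
exists (maxn N1 N2) => M a a1.
rewrite /tensor_sum big_cons amulDr (le_trans (ler_normD _ _))// [e]splitr lerD//.
  set N := maxn N1 N2; set P := \sum_(N2 <= n < M) u n.
  have -> : amul (diag a N M) (tensor (a', b).1 (a', b).2) =
      amul (diag a N M) (tensor a' (amul P b)).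
    rewrite /= /diag [LHS]amul_suml [RHS]amul_suml; apply: eq_big_seq => n.
    rewrite mem_index_iota => /andP[Nn nM].
    rewrite -!(mt_mul mt) amulA; congr (tensor _ (amul _ _)).
    rewrite /P amul_sumr (bigD1_seq n)//= ?iota_uniq//; last first.
      by rewrite mem_index_iota nM (leq_trans _ Nn)// leq_maxr.
    rewrite pp eqxx big1 ?addr0// => m mn.
    by rewrite pp eq_sym (negbTE mn).
  rewrite (le_trans (amul_norm _ _))//.
  have d2 : `|diag a N M| <= 2 by rewrite -[leRHS]mulr1 diag_bound.
  apply: (@le_trans _ _ (2 * (4 * `|a'| * `|amul P b|))).
    by rewrite ler_pM// (tensor_norm mt).
  apply: (@le_trans _ _ (8 * (`|a'| + 1) * `|amul P b|)).
    rewrite !mulrA -natrM ler_wpM2r// ler_wpM2l// lerDl//.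
  by rewrite mulrC -ler_pdivlMr// H2.
(* The induction hypothesis speaks of diagonals that start at [N1]; filling up with zeros lets it
   apply to one that starts later. *)
pose b' n := if (maxn N1 N2 <= n)%N then a n else 0.
have -> : diag a (maxn N1 N2) M = diag b' N1 M.
  have [lM|Ml] := leqP (maxn N1 N2) M.
    rewrite (@diag_cat b' N1 (maxn N1 N2))// ?leq_maxl// {2}/diag big_nat.
    rewrite [X in _ = X + _]big1 ?add0r => [|n /andP[_ nl]]; last first.
      by rewrite /b' leqNgt nl (tensor0l mt).
    by rewrite /diag !big_nat; apply: eq_bigr => n /andP[nl _]; rewrite /b' nl.
  rewrite /diag big_geq ?(ltnW Ml)// big_nat big1// => n /andP[_ nM].
  by rewrite /b' leqNgt (ltn_trans nM Ml) (tensor0l mt).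
apply: H1 => n; rewrite /b'; case: ifP => _ //; by rewrite normr0.
Qed.

Lemma diag_tail j (e : k) : 0 < e -> exists N, forall M a,
  (forall n, `|a n| <= 1) -> `|amul (diag a N M) j| <= e.
Proof.
move=> e0; have e20 : 0 < e / 2 by rewrite divr_gt0.
have e40 : 0 < e / 2 / 2 by rewrite !divr_gt0.
have [zs /cvg_seqP/(_ _ e40)[K HK]] := tensor_dense mt j.
have [N HN] := diag_tail_sum (zs K) e20.
exists N => M a a1; rewrite -(subrK (tensor_sum (iota := tensor) (zs K)) j) amulDr.
rewrite (le_trans (ler_normD _ _))// [e]splitr lerD ?HN//.
rewrite (le_trans (amul_norm _ _))//.
apply: (@le_trans _ _ (2 * (e / 2 / 2))).
  by rewrite ler_pM ?HK// -[leRHS]mulr1 diag_bound.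
by rewrite mulrC divfK.
Qed.

Lemma diag_tail_bound j (C e : k) : 0 < C -> 0 < e -> exists N, forall M a,
  (forall n, `|a n| <= C) -> `|amul (diag a N M) j| <= e.
Proof.
move=> C0 e0; have [N HN] := diag_tail j (divr_gt0 e0 C0).
exists N => M a aC; have := HN M (fun n => C^-1 *: a n) _.
have -> : diag (fun n => C^-1 *: a n) N M = C^-1 *: diag a N M.
  by rewrite /diag scaler_sumr; apply: eq_bigr => n _; rewrite (tensorZl mt).
rewrite amulZl normrZ gtr0_norm ?invr_gt0// mulrC ler_pM2r ?invr_gt0//; apply.
by move=> n; rewrite normrZ gtr0_norm ?invr_gt0// ler_pdivrMl// mulr1.
Qed.

(** The tails tend to 0 in norm after multiplication by [j]; thus the strong limit [diag_op a]
    multiplies [J] into itself. *)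
Lemma diag_ideal_cvg a j : bounded_seq a ->
  exists l : J, (fun N => amul (diag a 0 N) j) @ \oo --> l.
Proof.
move=> [C C0 aC]; apply: cauchy_seq_cvg => e e0.
have e20 : 0 < e / 2 by rewrite divr_gt0.
have [N HN] := diag_tail_bound j C0 e20.
have h n : (N <= n)%N -> `|amul (diag a 0 n) j - amul (diag a 0 N) j| <= e / 2.
  move=> Nn; rewrite -amulBl (@diag_cat a 0 N n)// addrAC subrr add0r; exact: HN.
exists N => m n Nm mn; rewrite (le_trans (ler_distD (amul (diag a 0 N) j) _ _))//.
by rewrite [e]splitr lerD ?h ?(leq_trans Nm)// distrC h.
Qed.

(** A diagonal with entries tending to 0 converges in norm by [diag_bound], so it lies in [J] and is
    not merely a multiplier. Differences of two evaluation diagonals enter the ideal in this way. *)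
Lemma diag_null_cvg a : (forall e : k, 0 < e -> exists N, forall n, (N <= n)%N -> `|a n| <= e) ->
  exists d : J, (fun N => diag a 0 N) @ \oo --> d.
Proof.
move=> a0; apply: cauchy_seq_cvg => e e0; have e20 : 0 < e / 2 by rewrite divr_gt0.
have [N HN] := a0 _ e20; exists N => m n Nm mn.
rewrite (@diag_cat a 0 m n)// addrAC subrr add0r.
have -> : e = 2 * (e / 2) by rewrite mulrC divfK.
by apply: diag_bound => // i /andP[mi _]; rewrite HN// (leq_trans Nm).
Qed.

(** * Reindexing of diagonals along an injection *)

Section Reindex.
Context {i : nat -> nat} {ka : star_hom J J}.
Hypotheses (inj_i : injective i)
  (kaE : forall (a : A) n, ka (tensor a (u n)) = tensor a (u (i n)))
  (ka0 : forall m (a : A) j, (forall n, i n <> m) -> amul (tensor a (u m)) (ka j) = 0).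

Let img N := [seq i n | n <- index_iota 0 N].

Let i_bound N : exists M0, forall n, (n < N)%N -> (i n < M0)%N.
Proof.
elim: N => [|N [M0 HM]]; first by exists 0%N.
exists (maxn M0 (i N).+1) => n; rewrite ltnS leq_eqVlt => /orP[/eqP->|/HM h].
  by rewrite leq_max leqnn orbT.
by rewrite leq_max h.
Qed.

Let ka_diag (a a' : nat -> A) N M : (forall n, a' (i n) = a n) ->
  (forall n, (n < N)%N -> (i n < M)%N) ->
  diag a' 0 M - ka (diag a 0 N) = diag (fun m => if m \in img N then 0 else a' m) 0 M.
Proof.
move=> a'a iM; rewrite {2}/diag linear_sum.
under [X in _ - X]eq_bigr do rewrite /= kaE -a'a.
rewrite (sum_reindex (fun m => tensor (a' m) (u m)) inj_i iM) -sumrB.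
apply: eq_bigr => m _; rewrite -/(img N); case: ifP => _; last by rewrite subr0.
by rewrite subrr (tensor0l mt).
Qed.

(** [i] does not carry initial segments to initial segments, so the truncations correspond only up
    to a diagonal supported off the image of [[0, N)]. Its entries are 0 or some [a n] with
    [n >= N], hence small. *)
Lemma reindex_null (a a' : nat -> A) d d' :
  (forall e : k, 0 < e -> exists N, forall n, (N <= n)%N -> `|a n| <= e) ->
  (forall n, a' (i n) = a n) -> (forall m, (forall n, i n <> m) -> a' m = 0) ->
  (fun N => diag a 0 N) @ \oo --> d -> (fun N => diag a' 0 N) @ \oo --> d' ->
  d' = ka d.
Proof.
move=> a0 a'a a'0 ad a'd; have kad := cvg_star_hom (f := ka) ad.
apply/eqP; rewrite -subr_eq0; apply/eqP/(@scalar_squeeze0 R k) => e e0.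
have e40 : 0 < e / 2 / 2 by rewrite !divr_gt0.
have e20 : 0 < e / 2 by rewrite !divr_gt0.
have eE : e = e / 2 / 2 + (e / 2 / 2 + e / 2) by rewrite addrA -!splitr.
have [N1 H1] := a0 _ e40.
have /cvg_seqP /(_ _ e40) [N2 H2] := kad; have /cvg_seqP /(_ _ e40) [N3 H3] := a'd.
set N := maxn N1 N2; have [M0 HM0] := i_bound N.
set M := maxn M0 N3.
have E : `|diag a' 0 M - ka (diag a 0 N)| <= e / 2.
  rewrite ka_diag//; last by move=> n /HM0 h; rewrite leq_max h.
  have -> : e / 2 = 2 * (e / 2 / 2) by rewrite [RHS]mulrC divfK.
  apply: diag_bound => // m _; case: ifPn => [_|mi]; first by rewrite normr0 ltW.
  have [[n nm]|nm] := pselect (exists n, i n = m); last first.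
    by rewrite a'0 ?normr0 ?(ltW e40)// => n E; apply: nm; exists n.
  rewrite -nm a'a; apply: H1; rewrite leqNgt; apply: contra mi => nN1.
  rewrite -nm; apply: map_f; rewrite mem_index_iota /=.
  by rewrite (leq_trans nN1)// leq_maxl.
rewrite (le_trans (ler_distD (diag a' 0 M) _ _))//.
rewrite [leRHS]eE lerD ?H3 ?leq_maxr//.
rewrite (le_trans (ler_distD (ka (diag a 0 N)) _ _))// addrC lerD//.
by rewrite distrC H2// leq_maxr.
Qed.

(** As for [reindex_null], but the leftover entries are merely bounded. Those off the range of [i]
    are annihilated by [ka j]; the others sit at indices [i n] with [n >= N], which exceed [N0], and
    there the tail estimate for [ka j] applies. *)
Lemma reindex_ideal (a a' : nat -> A) j l l' :
  bounded_seq a' -> (forall n, a' (i n) = a n) ->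
  (fun N => amul (diag a 0 N) j) @ \oo --> l ->
  (fun N => amul (diag a' 0 N) (ka j)) @ \oo --> l' -> l' = ka l.
Proof.
move=> [C C0 aC] a'a al a'l; have kal := cvg_star_hom (f := ka) al.
apply/eqP; rewrite -subr_eq0; apply/eqP/(@scalar_squeeze0 R k) => e e0.
have e40 : 0 < e / 2 / 2 by rewrite !divr_gt0.
have e20 : 0 < e / 2 by rewrite !divr_gt0.
have eE : e = e / 2 / 2 + (e / 2 / 2 + e / 2) by rewrite addrA -!splitr.
have [N0 H0] := diag_tail_bound (ka j) C0 e20.
have [N1 H1] := injective_tends inj_i N0.
have /cvg_seqP /(_ _ e40) [N2 H2] := kal; have /cvg_seqP /(_ _ e40) [N3 H3] := a'l.
set N := maxn N1 N2; have [M0 HM0] := i_bound N.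
set M := maxn (maxn M0 N3) N0.
have NM n : (n < N)%N -> (i n < M)%N by move=> /HM0 h; rewrite !leq_max h.
pose b m := if `[< exists2 n, (N <= n)%N & i n = m >] then a' m else 0.
have bC m : `|b m| <= C by rewrite /b; case: ifP => // _; rewrite normr0 ltW.
have E : `|amul (diag a' 0 M) (ka j) - ka (amul (diag a 0 N) j)| <= e / 2.
  rewrite sh_mul -amulBl (ka_diag a'a NM).
  have -> : amul (diag (fun m => if m \in img N then 0 else a' m) 0 M) (ka j) =
      amul (diag b N0 M) (ka j).
    transitivity (amul (diag b 0 M) (ka j)); last first.
      rewrite (@diag_cat b 0 N0)// ?leq_maxr//.
      rewrite [X in amul (X + _) _](_ : _ = 0) ?add0r// /diag big_nat big1// => m /andP[_ mN].
      rewrite /b; case: asboolP => [[n Nn nm]|_]; last by rewrite (tensor0l mt).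
      have h : (N0 <= i n)%N by apply: H1; apply: leq_trans Nn; exact: leq_maxl.
      by move: h; rewrite nm leqNgt mN.
    rewrite /diag !amul_suml; apply: eq_bigr => m _.
    case: ifPn => mi; rewrite /b; case: asboolP => [[n Nn nm]|nm] //.
    - move: mi => /mapP[n']; rewrite mem_index_iota /= => n'N; rewrite -nm => /inj_i nn'.
      by move: n'N; rewrite -nn' ltnNge Nn.
    - rewrite (tensor0l mt) amul0l; apply: ka0 => n nm'.
      apply: nm; exists n => //; rewrite leqNgt; apply: contra mi => nN.
      by rewrite -nm'; apply: map_f; rewrite mem_index_iota.
  exact: H0.
rewrite (le_trans (ler_distD (amul (diag a' 0 M) (ka j)) _ _))//.
rewrite [leRHS]eE lerD ?H3//; last first.
  rewrite (le_trans (ler_distD (ka (amul (diag a 0 N) j)) _ _))// addrC lerD//.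
  by rewrite distrC H2// leq_maxr.
by rewrite !leq_max leqnn orbT.
Qed.

End Reindex.

End Diagonals.
Arguments diag_cvg {R k A KK J L tensor p u Pi} mt du Pi_iso {a} ab x : rename.

Definition zero_hom (R : realType) (k : ground R) (A B : cstar k) : star_hom A B.
Proof.
by refine (@StarHom R k A B \0 _ _) => * /=; rewrite ?amul0l ?astar0.
Defined.
Arguments zero_hom {R k A B}.

Section DiagonalHoms.
Context {R : realType} {k : ground R} {T A KK J : cstar k} {L : hilbert k}.
Context {tensor : A -> KK -> J} {p : KK} {u : nat -> KK} {Pi : representation J L}.
Hypotheses (mt : is_min_tensor tensor) (du : diagonal_units p u) (Pi_iso : isometric_rep Pi).
Implicit Types (x y z : nat -> star_hom T A) (t : T) (j : J) (v : L).

(* The multiplier [sum_n x_n(t) (x) e_nn] of [A (x) K]. *)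
Definition diag_hom x t v : L := diag_op (tensor := tensor) (u := u) (Pi := Pi) (fun n => x n t) v.

Lemma bounded_family x t : bounded_seq (fun n => x n t).
Proof.
exists (2 * `|t| + 1); first by rewrite ltr_wpDl// mulr_ge0.
by move=> n; rewrite (le_trans (star_hom_bound _ _))// lerDl.
Qed.

Lemma diag_hom_multiplier x : multiplier_hom Pi (diag_hom x).
Proof.
have bf := bounded_family x.
split.
- move=> c s t y; rewrite /diag_hom -(diag_op_linear mt du Pi_iso)//.
  by congr (diag_op _ _); apply/funext => n; rewrite linearP.
- by move=> t c v w; exact: (diag_op_linear_r mt du Pi_iso).
(* 4 is 2 from [diag_op_norm] times 2 from [star_hom_bound]; the former wants a positive bound on
   the entries, so [t = 0] is treated apart. *)
- exists 4 => // t v; have [->|t0] := eqVneq t 0.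
    rewrite normr0 mulr0 mul0r normr_le0; apply/eqP.
    apply: (cvg_seq_unique (diag_cvg mt du Pi_iso (bf 0) v)).
    suff -> : (fun N => Pi (diag (tensor := tensor) (u := u) (fun n => x n 0) 0 N) v) = fun=> 0.
      exact: cvg_cst.
    apply/funext => N; rewrite /diag big1 ?rep0// => n _.
    by rewrite linear0 (tensor0l mt).
  have t20 : 0 < 2 * `|t| by rewrite mulr_gt0// normr_gt0.
  have := diag_op_norm mt du Pi_iso v t20 (fun n => star_hom_bound (x n) t).
  by rewrite mulrA -natrM.
- move=> s t v; rewrite /diag_hom -(diag_op_mul mt du Pi_iso)//.
  by congr (diag_op _ _); apply/funext => n; rewrite sh_mul.
- move=> t v w; rewrite /diag_hom (diag_op_star mt du Pi_iso)//.
  by congr (ip _ (diag_op _ _)); apply/funext => n; rewrite sh_star.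
- move=> t j; have [l al] := diag_ideal_cvg mt du j (bf t).
  by exists l => v; apply: (diag_op_ideal mt du Pi_iso (bf t) al).
Qed.

Definition close x y := forall t (e : k), 0 < e ->
  exists N, forall n, (N <= n)%N -> `|x n t - y n t| <= e.

Lemma close_refl x : close x x.
Proof. by move=> t e e0; exists 0%N => n _; rewrite subrr normr0 ltW. Qed.

Lemma close_sym x y : close x y -> close y x.
Proof.
by move=> xy t e /(xy t) [N HN]; exists N => n /HN; rewrite distrC.
Qed.

Lemma close_difference x y t : close x y -> exists d : J,
  (fun N => diag (tensor := tensor) (u := u) (fun n => y n t - x n t) 0 N) @ \oo --> d /\
  forall v, Pi d v = diag_hom y t v - diag_hom x t v.
Proof.
move=> xy; have [d dP] := diag_null_cvg mt du (close_sym xy t).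
exists d; split=> // v; rewrite (diag_op_limit mt du Pi_iso _ dP); last first.
  by apply: bounded_seqB; exact: bounded_family.
by rewrite (diag_opB mt du Pi_iso)//; exact: bounded_family.
Qed.

(* [s] is a homomorphism to the extension of [x] whose multiplier part is that
   of [y]. *)
Definition lifts {B : cstar k} (mk : T -> J -> B) x y (s : star_hom T B) :=
  forall t, exists2 d, s t = mk t d & forall v, Pi d v = diag_hom y t v - diag_hom x t v.

(** The pair [(t, d t)], with [d] the difference of the diagonals, acts on [L] exactly as the
    diagonal of [y], which is multiplicative. *)
Lemma lift_ex (B : cstar k) (mk : T -> J -> B) x y :
  is_extension Pi (diag_hom x) mk -> close x y -> exists s, lifts mk x y s.
Proof.
move=> ext xy; have mhx := diag_hom_multiplier x; have mhy := diag_hom_multiplier y.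
have /choice [d dP] : forall t, exists d, forall v, Pi d v = diag_hom y t v - diag_hom x t v.
  by move=> t; have [d [_ dP]] := close_difference t xy; exists d.
have [s sE] : exists s : star_hom T B, forall t, s t = mk (sh_id T t) (d t).
  apply: (into_extension ext (f := sh_id T)).
  - move=> c a b; apply: (isorep_inj Pi_iso) => v.
    rewrite rep_linear !dP (mh_linear mhx) (mh_linear mhy) scalerBr opprD !addrA.
    by rewrite (ACl (1*3*2*4)).
  - move=> a; apply: (isorep_inj Pi_iso) => v; apply: ip_ext => w.
    by rewrite [RHS]rep_star astarK !dP ipBl ipBr (mh_star mhx) (mh_star mhy) !astarK.
  - move=> a b v /=; have E c w : diag_hom x c w + Pi (d c) w = diag_hom y c w.
      by rewrite dP addrC subrK.
    by rewrite !E (mh_mul mhy).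
by exists s => t; exists (d t) => //; rewrite sE.
Qed.

Section Reindexing.
Context {i : nat -> nat} {ka : star_hom J J}.
Hypotheses (inj_i : injective i)
  (kaE : forall (a : A) n, ka (tensor a (u n)) = tensor a (u (i n)))
  (ka0 : forall m (a : A) j, (forall n, i n <> m) -> amul (tensor a (u m)) (ka j) = 0).

(** A substitute for extending [ka] to multipliers: [l = a j] implies [ka l = a' (ka j)]. The
    entries of [a'] off the range of [i] do not matter because they annihilate [ka j]. *)
Lemma reindex_mull (a a' : nat -> A) j l : bounded_seq a -> bounded_seq a' ->
  (forall n, a' (i n) = a n) ->
  (forall v, Pi l v = diag_op (tensor := tensor) (u := u) (Pi := Pi) a (Pi j v)) ->
  forall v, Pi (ka l) v = diag_op (tensor := tensor) (u := u) (Pi := Pi) a' (Pi (ka j) v).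
Proof.
move=> ab ab' a'a lj v.
have [l1 al1] := diag_ideal_cvg mt du j ab; have [l2 al2] := diag_ideal_cvg mt du (ka j) ab'.
have -> : l = l1.
  by apply: (isorep_inj Pi_iso) => w; rewrite lj (diag_op_ideal mt du Pi_iso ab al1).
rewrite -(reindex_ideal mt du inj_i kaE ka0 ab' a'a al1 al2).
exact: (diag_op_ideal mt du Pi_iso ab' al2).
Qed.

Lemma reindex_mulr (a a' : nat -> A) j l : bounded_seq a -> bounded_seq a' ->
  (forall n, a' (i n) = a n) ->
  (forall v, Pi l v = Pi j (diag_op (tensor := tensor) (u := u) (Pi := Pi) a v)) ->
  forall v, Pi (ka l) v = Pi (ka j) (diag_op (tensor := tensor) (u := u) (Pi := Pi) a' v).
Proof.
move=> ab ab' a'a lj v.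
have h := @reindex_mull (fun n => astar (a n)) (fun n => astar (a' n)) (astar j) (astar l)
  (bounded_seq_star ab) (bounded_seq_star ab').
apply: ip_ext => w; rewrite -[ka l]astarK rep_star astarK -sh_star.
rewrite h; last 2 first.
- by move=> n; rewrite a'a.
- move=> w'; apply: ip_ext => w''.
  rewrite rep_star astarK lj ip_conj rep_star (diag_op_star mt du Pi_iso)//.
  by rewrite -ip_conj.
by rewrite rep_star -sh_star (diag_op_star mt du Pi_iso).
Qed.

(** The map is [th (t, j) = (t, ka j + d t)], where [d t] is the difference of [b'] and the base
    [x]; the image acts as the diagonal of [b'] plus [ka j]. Off the range of [i] the families [z']
    and [b'] agree, so their difference is the reindexed difference of [z] and [b], and lifts go to
    lifts. *)
Lemma reindex_extension (B C : cstar k) (mkB : T -> J -> B) (mkC : T -> J -> C) b x b' :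
  is_extension Pi (diag_hom b) mkB -> is_extension Pi (diag_hom x) mkC ->
  close x b' -> (forall n, b' (i n) = b n) ->
  exists th : star_hom B C,
    (forall j, th (mkB 0 j) = mkC 0 (ka j)) /\
    (forall z z' s s', close b z -> (forall n, z' (i n) = z n) ->
       (forall m, (forall n, i n <> m) -> z' m = b' m) ->
       lifts mkB b z s -> lifts mkC x z' s' -> forall t, th (s t) = s' t).
Proof.
move=> extB extC xb' b'b.
have mhx := diag_hom_multiplier x; have mhb := diag_hom_multiplier b.
have mhb' := diag_hom_multiplier b'.
have /choice [d dP] : forall t, exists d, forall v, Pi d v = diag_hom b' t v - diag_hom x t v.
  by move=> t; have [d [_ dP]] := close_difference t xb'; exists d.
have dE t v : diag_hom x t v + Pi (d t) v = diag_hom b' t v.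
  by rewrite dP addrC subrK.
have dl c s t : d (c *: s + t) = c *: d s + d t.
  apply: (isorep_inj Pi_iso) => v.
  rewrite rep_linear !dP (mh_linear mhx) (mh_linear mhb') scalerBr opprD !addrA.
  by rewrite (ACl (1*3*2*4)).
have d0 : d 0 = 0.
  by apply: (addrI (d 0)); have := dl 1 0 0; rewrite !scale1r !addr0 => <-.
have hE t : forall n, (fun n => b' n t) (i n) = (fun n => b n t) n by move=> n; rewrite /= b'b.
have [th thE] : exists th : star_hom B C, forall t j, th (mkB t j) = mkC t (ka j + d t).
  apply: (from_extension extB) => [c t j t' j'|t j t' j' l lP|t j].
  - by rewrite linearP dl -(ext_linear extC) scalerDr !addrA (ACl (1*3*2*4)).
  - apply/esym/(ext_mul extC) => v.
    rewrite !repD ![Pi (ka _) _ + _]addrC !addrA !dE.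
    have [l1 l1P] := mh_ideal mhb t j'; have [l2 l2P] := mh_ideal mhb (astar t') (astar j).
    have l2P' w : Pi (astar l2) w = Pi j (diag_hom b t' w).
      apply: ip_ext => w'; rewrite rep_star astarK l2P [RHS]rep_star.
      by rewrite (mh_star mhb).
    (* The ideal component of the product is split into multiplier times ideal, ideal times
       multiplier and ideal times ideal, so that [ka] can be computed on each. *)
    have -> : l = l1 + (astar l2 + amul j j').
      apply: (isorep_inj Pi_iso) => w; apply: (addrI (diag_hom b (amul t t') w)).
      rewrite lP !repD l1P l2P' rep_mul (mh_mul mhb) [Pi j (_ + _)]linearD !addrA.
      congr (_ + _ + _).
      by have := mh_op_linear mhb t 1 (diag_hom b t' w) (Pi j' w); rewrite !scale1r.
    rewrite !linearD /= !repD.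
    rewrite (reindex_mull (bounded_family b t) (bounded_family b' t) (hE t) l1P).
    rewrite (reindex_mulr (bounded_family b t') (bounded_family b' t') (hE t') l2P').
    rewrite sh_mul rep_mul (mh_mul mhb') !addrA -/(diag_hom b' t _) -/(diag_hom b' t' _).
    have -> : diag_hom b' t (diag_hom b' t' v + Pi (ka j') v) =
        diag_hom b' t (diag_hom b' t' v) + diag_hom b' t (Pi (ka j') v).
      by have := mh_op_linear mhb' t 1 (diag_hom b' t' v) (Pi (ka j') v); rewrite !scale1r.
    by rewrite ?addrA.
  - rewrite (ext_star extC) astarD sh_star; congr (mkC _ (_ + _)).
    apply: (isorep_inj Pi_iso) => v; apply: ip_ext => w.
    by rewrite [RHS]rep_star astarK !dP ipBl ipBr (mh_star mhx) (mh_star mhb') !astarK.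
exists th; split=> [j|z z' s s' bz z'z zb' sz sz' t].
  by rewrite thE d0 addr0.
have [e -> eP] := sz t; have [e' -> eP'] := sz' t.
rewrite thE; congr (mkC t _); apply: (isorep_inj Pi_iso) => v.
rewrite repD dP eP'.
have [e1 [e1c e1P]] := close_difference t bz.
have -> : e = e1 by apply: (isorep_inj Pi_iso) => w; rewrite e1P eP.
(* Off the range of [i] the two families are equal; on it, a large [i n] forces a large [n]. *)
have b'z' : forall e0 : k, 0 < e0 -> exists N, forall n, (N <= n)%N -> `|z' n t - b' n t| <= e0.
  move=> e0 /(close_sym bz t) [N HN].
  have [M HM] : exists M, forall m, (M <= m)%N -> forall n, i n = m -> (N <= n)%N.
    elim: {HN}N => [|N [M HM]]; first by exists 0%N.
    exists (maxn M (i N).+1) => m; rewrite geq_max => /andP[Mm iNm] n nm.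
    rewrite ltn_neqAle (HM m)// andbT; apply/eqP => Nn.
    by move: iNm; rewrite -nm -Nn ltnn.
  exists M => m Mm; have [[n nm]|nm] := pselect (exists n, i n = m).
    by rewrite -nm z'z b'b HN// (HM m).
  rewrite zb' ?subrr ?normr0; last by move=> n E; apply: nm; exists n.
  by have := HN N (leqnn N) => /(le_trans (normr_ge0 _)).
have [e2 e2c] := diag_null_cvg mt du b'z'.
have a'a n : z' (i n) t - b' (i n) t = z n t - b n t by rewrite z'z b'b.
have -> : ka e1 = e2.
  apply/esym/(reindex_null mt du inj_i kaE (close_sym bz t) a'a _ e1c e2c) => m im.
  by rewrite zb'// subrr.
rewrite (diag_op_limit mt du Pi_iso _ e2c); last first.
  by apply: bounded_seqB; exact: bounded_family.
rewrite (diag_opB mt du Pi_iso _ (bounded_family z' t) (bounded_family b' t)).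
by rewrite addrA subrK.
Qed.

End Reindexing.

(** With a single nonzero entry the multiplier lies in [J] itself, and adding it to the ideal
    component is a homomorphism [pr] to [J]. It leads from classes in the extension back to a
    corner. *)
Lemma singleton_extension (B : cstar k) (mk : T -> J -> B) x n0 :
  is_extension Pi (diag_hom x) mk -> (forall n, n != n0 -> x n = zero_hom) ->
  exists pr : star_hom B J, forall y s, (forall n, n != n0 -> y n = zero_hom) ->
    lifts mk x y s -> forall t, pr (s t) = tensor (y n0 t) (u n0).
Proof.
move=> ext x0.
have single y t v : (forall n, n != n0 -> y n = zero_hom) ->
    diag_hom y t v = Pi (tensor (y n0 t) (u n0)) v.
  move=> y0; apply: (cvg_seq_unique (diag_cvg mt du Pi_iso (bounded_family y t) v)).
  apply/cvg_seqP => e e0; exists n0.+1 => N nN.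
  suff -> : diag (tensor := tensor) (u := u) (fun n => y n t) 0 N = tensor (y n0 t) (u n0).
    by rewrite subrr normr0 ltW.
  rewrite /diag (bigD1_seq n0)//= ?mem_index_iota ?iota_uniq// big1 ?addr0// => n nn0.
  by rewrite y0// /= (tensor0l mt).
have [pr prE] : exists pr : star_hom B J, forall t j, pr (mk t j) = tensor (x n0 t) (u n0) + j.
  have opE t j v : Pi (tensor (x n0 t) (u n0) + j) v = diag_hom x t v + Pi j v.
    by rewrite repD single.
  have [ps pp] := du_proj du.
  apply: (from_extension ext) => [c t j t' j'|t j t' j' l lP|t j].
  - by rewrite linearP (mt_linearl mt) scalerDr !addrA (ACl (1*3*2*4)).
  - by apply: (isorep_inj Pi_iso) => v; rewrite rep_mul !opE lP.
  - by rewrite astarD -(mt_star mt) ps sh_star.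
exists pr => y s y0 sy t; have [d -> dP] := sy t.
apply: (isorep_inj Pi_iso) => v.
by rewrite prE repD dP -(single x)// -(single y)// addrC subrK.
Qed.

End DiagonalHoms.

(** * Stable and split additive functors *)

Section TensorEndomorphisms.
Context {R : realType} {k : ground R} {A KK J : cstar k}.
Context {tensor : A -> KK -> J}.
Hypothesis mt : is_min_tensor tensor.

(** The norm bound holds because [(pi, sg)] on the image of [z] is [(pi, sg \o mu)] on [z], and the
    minimal norm runs over all pairs of representations. *)
Lemma tensor_endo (mu : star_hom KK KK) :
  exists ka : star_hom J J, forall a b, ka (tensor a b) = tensor a (mu b).
Proof.
apply: (tensor_extension mt (f := fun a b => tensor a (mu b))).
- by move=> c a a' b; exact: (mt_linearl mt).
- by move=> a a' b b' /=; rewrite sh_mul (mt_mul mt).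
- by move=> a b /=; rewrite sh_star (mt_star mt).
move=> z; rewrite -(big_map (fun w => (w.1, mu w.2)) xpredT (fun w => tensor w.1 w.2)).
apply: (tensor_norm_le mt) => // H1 H2 pi sg s.
have [_ /(_ H1 H2 pi (rep_pullback sg mu) s) + _] := mt_norm mt z.
by rewrite /tact allpairs_mapl.
Qed.

Lemma reindexing_ex (p : KK) (u : nat -> KK) (i : nat -> nat) :
  diagonal_units p u -> injective i ->
  exists ka : star_hom J J, [/\ forall (a : A) n, ka (tensor a (u n)) = tensor a (u (i n)) &
    forall m (a : A) j, (forall n, i n <> m) -> amul (tensor a (u m)) (ka j) = 0].
Proof.
move=> du inj_i; have [mu [muE mu0]] := du_reindex du inj_i.
have [ka kaE] := tensor_endo mu; exists ka; split=> [a n|m a j im].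
  by rewrite kaE muE.
have [zs zj] := tensor_dense mt j.
apply: (cvg_seq_unique (cvg_amulr (d := tensor a (u m)) (cvg_star_hom (f := ka) zj))).
suff -> : (fun n => amul (tensor a (u m)) (ka (tensor_sum (iota := tensor) (zs n)))) = fun=> 0.
  exact: cvg_cst.
apply/funext => n; rewrite linear_sum amul_sumr big1// => w _ /=.
by rewrite kaE -(mt_mul mt) mu0// (tensor0r mt).
Qed.

End TensorEndomorphisms.

Section Functor.
Local Notation fmap := Defs.fmap.
Context {R : realType} {k : ground R} {KK CI : cstar k} {p : KK} {u : nat -> KK}
  {S : cstar k -> Prop} {E : ab_functor S}.
Hypotheses (HS : admissible KK CI S) (Estable : stable p E) (Esplit : split_additive E)
  (du : diagonal_units p u).
Context {T A J : sobj S} {tensor : A -> KK -> J}.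
Hypothesis mt : is_min_tensor tensor.

Lemma fmapE (B C D : sobj S) (f : star_hom B C) (g : star_hom C D) (h : star_hom B D) :
  (forall b, g (f b) = h b) -> forall w, fmap E g (fmap E f w) = fmap E h w.
Proof.
move=> gf w; rewrite -Defs.fmap_comp; congr (fmap E _ w).
by apply: star_hom_ext => b /=.
Qed.

Let corner n : exists j : star_hom A J, forall a, j a = tensor a (u n).
Proof.
have [ps pp] := du_proj du.
by apply: (tensor_corner mt) => //; rewrite pp eqxx.
Qed.

(* A reindexing fixing 0 agrees with the identity on the corner [A (x) p],
   which carries all of [E J] by stability. *)
Lemma fmap_reindexing (i : nat -> nat) (ka : star_hom J J) : i 0%N = 0%N ->
  (forall (a : A) n, ka (tensor a (u n)) = tensor a (u (i n))) ->
  forall w, fmap E ka w = w.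
Proof.
move=> i0 kaE w; have [j jE] := corner 0%N.
have [|g jg gj] := Estable mt (j := j); first by move=> a; rewrite jE (du_0 du).
rewrite -(gj w); apply: fmapE => a.
by rewrite jE kaE i0.
Qed.

(** Stability speaks of the corner at [u 0 = p]; the transposition of 0 and [n] carries the corner
    at [n] to it. *)
Lemma fmap_corner_inj n (j : star_hom A J) : (forall a, j a = tensor a (u n)) ->
  injective (fmap E j).
Proof.
move=> jE v w vw; have [j0 j0E] := corner 0%N.
have [|g jg gj] := Estable mt (j := j0); first by move=> a; rewrite j0E (du_0 du).
pose i m := if m == 0%N then n else if m == n then 0%N else m.
have inj_i : injective i.
  move=> a b; rewrite /i; do ![case: eqP] => *; congruence.
have [ka [kaE _]] := reindexing_ex mt du inj_i.
have h w' : fmap E ka (fmap E j w') = fmap E j0 w'.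
  apply: fmapE => a; rewrite jE j0E kaE /i; congr (tensor a (u _)).
  by case: eqP => [->|]//; rewrite eqxx.
by apply: (can_inj jg); rewrite -!h vw.
Qed.

Context {LT L : hilbert k} {tau : representation T LT} {Pi : representation J L}.
Hypotheses (tau_iso : isometric_rep tau) (Pi_iso : isometric_rep Pi).
Implicit Types (x y b z : nat -> star_hom T A).

Local Notation al := (diag_hom (tensor := tensor) (u := u) (Pi := Pi)).

Record model x (B : sobj S) (mk : T -> J -> B) (i : star_hom J B) (q : star_hom B T) : Prop := Model {
  mod_ext : is_extension Pi (al x) mk;
  mod_split : split_exact_cstar i q;
  mod_i : forall j, i j = mk 0 j;
  mod_q : forall t j, q (mk t j) = t }.

Lemma model_ex x : exists (B : sobj S) mk i q, @model x B mk i q.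
Proof.
have mh := diag_hom_multiplier mt du Pi_iso x.
have [B [mk ext]] := extension_exists tau_iso Pi_iso mh.
have [i [q [sp iE qE]]] := extension_split mh ext.
by exists (SObj (adm_extension HS sp)), mk, i, q.
Qed.

Section Models.
Context {x : nat -> star_hom T A} {B : sobj S} {mk : T -> J -> B} {i : star_hom J B}
  {q : star_hom B T}.
Hypothesis mod : model x mk i q.

Lemma model_lift y : close x y -> exists s, lifts (tensor := tensor) (u := u) (Pi := Pi) mk x y s.
Proof. exact: (lift_ex mt du Pi_iso (mod_ext mod)). Qed.

Lemma fmap_model_inj : injective (fmap E i).
Proof. by have [] := Esplit (mod_split mod). Qed.

(** Both lifts are sections of [q], so their difference dies in [E T] and comes from [E J]. The
    element [w], unique by [fmap_model_inj], is the value at [v] of the map [Q] for the pair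
    [(y, z)]. *)
Lemma lift_difference y z s s' v :
  lifts (tensor := tensor) (u := u) (Pi := Pi) mk x y s ->
  lifts (tensor := tensor) (u := u) (Pi := Pi) mk x z s' ->
  exists w, fmap E s v - fmap E s' v = fmap E i w.
Proof.
move=> sy sz; have [_ rg _] := Esplit (mod_split mod).
have : [set b | fmap E q b = 0] (fmap E s v - fmap E s' v).
  rewrite /= raddfB /= (fmapE (h := sh_id T)); last by move=> t; have [d -> _] := sy t; rewrite (mod_q mod).
  rewrite (fmapE (h := sh_id T)); last by move=> t; have [d -> _] := sz t; rewrite (mod_q mod).
  by rewrite subrr.
by rewrite -rg => -[w _ <-]; exists w.
Qed.

End Models.

(** Invariance of [Q]: the pair [(b, z)] in its own extension and the reindexed pair [(b', z')] in
    the extension of [x] have the same value [w]. Indices off the range of [r], where [z'] and [b']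
    agree, contribute nothing. With [r] the identity this is independence of the base. *)
Lemma transfer (r : nat -> nat) b x b' z z'
  (B : sobj S) (mkB : T -> J -> B) iB qB (C : sobj S) (mkC : T -> J -> C) iC qC :
  injective r -> r 0%N = 0%N ->
  @model b B mkB iB qB -> @model x C mkC iC qC ->
  close x b' -> (forall n, b' (r n) = b n) ->
  close b z -> (forall n, z' (r n) = z n) ->
  (forall m, (forall n, r n <> m) -> z' m = b' m) ->
  forall sb sz sb' sz',
  lifts (tensor := tensor) (u := u) (Pi := Pi) mkB b b sb ->
  lifts (tensor := tensor) (u := u) (Pi := Pi) mkB b z sz ->
  lifts (tensor := tensor) (u := u) (Pi := Pi) mkC x b' sb' ->
  lifts (tensor := tensor) (u := u) (Pi := Pi) mkC x z' sz' ->
  forall v w, fmap E sb v - fmap E sz v = fmap E iB w ->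
    fmap E sb' v - fmap E sz' v = fmap E iC w.
Proof.
move=> inj_r r0 modB modC xb' b'b bz z'z z'b' sb sz sb' sz' lb lz lb' lz' v w vw.
have [ka [kaE ka0]] := reindexing_ex mt du inj_r.
have [th [thi ths]] := reindex_extension mt du Pi_iso inj_r kaE ka0 (mod_ext modB) (mod_ext modC) xb' b'b.
have thB := ths b b' sb sb' (close_refl b) b'b (fun _ _ => erefl) lb lb'.
have thZ := ths z z' sz sz' bz z'z z'b' lz lz'.
rewrite -(fmapE thB) -(fmapE thZ) -raddfB vw.
rewrite (fmapE (h := sh_comp iC ka)); last by move=> j /=; rewrite (mod_i modB) thi (mod_i modC).
by rewrite Defs.fmap_comp (fmap_reindexing r0 kaE).
Qed.

End Functor.

(** * Evaluations and dyadic intervals *)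

Section Evaluations.
Context {R : realType} {k : ground R} {A CI T : cstar k} {tensor : A -> CI -> T}
  {ev : CI -> R -> k} {H : hilbert k} {e0 : H}.
Hypotheses (mt : is_min_tensor tensor) (HCI : is_interval_algebra ev) (e01 : ip e0 e0 = 1).
Implicit Types (r s : R) (t : T).

Lemma evaluation_rep r : r \in `[0, 1] ->
  exists sg : representation CI H, forall f x, sg f x = ev f r *: x.
Proof.
move=> r01; pose op (f : CI) : {linear H -> H} := *:%R (ev f r).
have opc f : continuous (op f).
  by apply: (@bounded_linear_continuous _ _ _ _ _ `|ev f r|) => // x; rewrite normrZ.
unshelve eexists (@Representation R k CI H op opc _ _ _) => //.
- by move=> c a b x /=; rewrite (ia_linear HCI)// scalerDl scalerA.
- by move=> a b x /=; rewrite (ia_mul HCI)// scalerA.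
- by move=> a x y /=; rewrite ipZl ipZr (ia_star HCI)// sconjK.
Qed.

(** Bounded for the minimal norm: let [CI] act on [H] by the scalars [ev f r] and test on
    [x (x) e0]; the outcome is the norm of the evaluated sum applied to [x]. *)
Lemma evaluation_hom r : r \in `[0, 1] ->
  exists g : star_hom T A, forall a f, g (tensor a f) = ev f r *: a.
Proof.
move=> r01; apply: (tensor_extension mt (f := fun a f => ev f r *: a)).
- by move=> c a a' f; rewrite scalerDr !scalerA mulrC.
- move=> a a' f f' /=.
  by rewrite (ia_mul HCI)// amulZl amulZr scalerA.
- by move=> a f /=; rewrite (ia_star HCI)// astarZ.
move=> z; have [H1 [pi pi_iso]] := cs_concrete A.
have [sg sgE] := evaluation_rep r01.
apply: (isorep_le pi_iso) => // x.
have [_ /(_ H1 H pi sg [:: (x, e0)]) + _] := mt_norm mt z.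
have -> : tact pi sg z [:: (x, e0)] = [seq (pi w.1 x, ev w.2 r *: e0) | w <- z].
  by rewrite /tact; elim: z => //= w z ->; rewrite sgE.
rewrite /tsqnorm !big_seq1 /= e01 mulr1 big_map.
under eq_bigr do rewrite big_map /=.
under eq_bigr do under eq_bigr do rewrite ipZl ipZr e01 mulr1.
rewrite ip_norm -exprMn => h.
rewrite -(@ler_pXn2r _ 2)// ?nnegrE ?mulr_ge0//; apply: le_trans h.
rewrite -ip_norm rep_sum ip_suml le_eqVlt; apply/orP; left; apply/eqP.
apply: eq_bigr => w _; rewrite ip_sumr; apply: eq_bigr => w' _.
by rewrite !repZ ipZl ipZr mulrA mulrC.
Qed.

Lemma eval_unif_continuous f (e : k) : 0 < e -> exists2 d : R, 0 < d &
  forall r s, r \in `[0, 1] -> s \in `[0, 1] -> `|r - s| <= d -> `|ev f r - ev f s| <= e.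
Proof.
move=> e_gt0; have e20 : 0 < e / 2 by rewrite divr_gt0.
have /subspace_continuousP evc : {within `[0, 1], continuous (ev f)} by exact: (ia_continuous HCI).
have /compact_near_coveringP cov := @segment_compact R 0 1.
pose P (n : nat) r := forall s, r \in `[0, 1] -> s \in `[0, 1] ->
  `|r - s| <= n.+1%:R^-1 -> `|ev f r - ev f s| <= e.
have [|N _ HN] := cov nat \oo P _.
  move=> r r01; have /cvgrPdist_le /(_ _ e20) := evc r r01.
  rewrite near_withinE => /nbhs_ballP[d /= d0 dP].
  have d20 : 0 < d / 2 by rewrite divr_gt0.
  exists (ball r (d / 2), [set n : nat | n.+1%:R^-1 < d / 2]) => /=.
    split; first exact: nbhsx_ballx.
    exact: near_infty_natSinv_lt (PosNum d20).
  move=> [r' n] /= [rr' nd] s r'01 s01 r's.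
  have h1 : `|ev f r - ev f r'| <= e / 2.
    by apply: dP => //; apply: le_ball rr'; rewrite ler_pdivrMr// ler_pMr// ler1n.
  have h2 : `|ev f r - ev f s| <= e / 2.
    apply: dP => //; rewrite -ball_normE /=; move: rr'; rewrite -ball_normE /= => rr'.
    rewrite (le_lt_trans (ler_distD r' _ _))// [d]splitr ltrD//.
    exact: le_lt_trans nd.
  by rewrite (le_trans (ler_distD (ev f r) _ _))// [e]splitr lerD// distrC.
exists N.+1%:R^-1; first by rewrite invr_gt0 ltr0n.
by move=> r s r01 s01 rs; apply: (HN N (leqnn N) r).
Qed.

(** On finite sums of tensors this is the uniform continuity of the functions involved; density and
    the common bound on all *-homomorphisms extend it to every [t]. *)
Lemma evaluation_unif_continuous (pt : R -> star_hom T A) :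
  (forall r, r \in `[0, 1] -> forall a f, pt r (tensor a f) = ev f r *: a) ->
  forall t (e : k), 0 < e -> exists2 d : R, 0 < d &
  forall r s, r \in `[0, 1] -> s \in `[0, 1] -> `|r - s| <= d -> `|pt r t - pt s t| <= e.
Proof.
move=> ptE t e e_gt0; have e20 : 0 < e / 2 by rewrite divr_gt0.
(* An eighth of [e], since [star_hom_bound] costs a factor 2 at each of the two points. *)
have e80 : 0 < e / 2 / 2 / 2 by rewrite !divr_gt0.
have [zs /cvg_seqP /(_ _ e80) [K HK]] := tensor_dense mt t.
have [d d0 dP] : exists2 d : R, 0 < d & forall r s, r \in `[0, 1] -> s \in `[0, 1] ->
    `|r - s| <= d -> `|pt r (tensor_sum (iota := tensor) (zs K)) - pt s (tensor_sum (iota := tensor) (zs K))| <= e / 2.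
  elim: {HK}(zs K) (e / 2) e20 => [|[a f] z IH] e' e'0.
    exists 1 => // r s _ _ _; rewrite /tensor_sum big_nil !linear0 ?subrr ?addr0 normr0.
    exact: ltW.
  have e'20 : 0 < e' / 2 by rewrite divr_gt0.
  have [d1 d10 H1] := IH _ e'20.
  have a1 : 0 < `|a| + 1 by rewrite ltr_wpDl.
  have [d2 d20 H2] := eval_unif_continuous f (divr_gt0 e'20 a1).
  exists (Num.min d1 d2); first by rewrite lt_min d10.
  move=> r s r01 s01; rewrite le_min => /andP[rs1 rs2].
  rewrite /tensor_sum big_cons /= !linearD /= !ptE// ?opprD addrACA -scalerBl.
  rewrite (le_trans (ler_normD _ _))// [e']splitr lerD//; last exact: H1.
  rewrite normrZ; apply: (@le_trans _ _ (`|ev f r - ev f s| * (`|a| + 1))).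
    by rewrite ler_wpM2l// lerDl.
  by rewrite -ler_pdivlMr// H2.
exists d => // r s r01 s01 rs; set z := tensor_sum (zs K) in dP HK *.
have b g : `|(g : star_hom T A) t - g (tensor_sum (iota := tensor) (zs K))| <= e / 2 / 2.
  rewrite -linearB (le_trans (star_hom_bound _ _))// mulrC -ler_pdivlMr//.
  exact: HK.
rewrite (le_trans (ler_distD (pt r (tensor_sum (iota := tensor) (zs K))) _ _))//.
have -> : e = e / 2 / 2 + (e / 2 + e / 2 / 2) by rewrite addrCA -!splitr.
rewrite lerD//; rewrite (le_trans (ler_distD (pt s (tensor_sum (iota := tensor) (zs K))) _ _))//.
by rewrite lerD ?dP// distrC.
Qed.

End Evaluations.

(* The dyadic intervals [lo h, hi h], indexed as the nodes [h >= 1] of a binary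
   heap: the halves of the interval [h] are those of [2h] and [2h + 1]. *)
Section DyadicHeap.
Context {R : realType}.
Implicit Types h : nat.

Definition heap_width h : nat := 2 ^ trunc_log 2 h.
(** For [h = 2^n + i] with [i < 2^n] the width is [2^n], so that [h / 2^n - 1 = i / 2^n]. *)
Definition lo h : R := h%:R / (heap_width h)%:R - 1.
Definition mid h : R := h.*2.+1%:R / (heap_width h).*2%:R - 1.
Definition hi h : R := h.+1%:R / (heap_width h)%:R - 1.

Lemma heap_width_gt0 h : (0 < heap_width h)%N.
Proof. by rewrite expn_gt0. Qed.

Let width0 h : 0 < (heap_width h)%:R :> R.
Proof. by rewrite ltr0n heap_width_gt0. Qed.

Lemma heap_width_double h : (0 < h)%N -> heap_width h.*2 = (heap_width h).*2.
Proof. by move=> h0; rewrite /heap_width trunc_log2_double// expnS mul2n. Qed.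

Lemma heap_width_doubleS h : (0 < h)%N -> heap_width h.*2.+1 = (heap_width h).*2.
Proof.
move=> h0; rewrite /heap_width trunc_log2S ?ltnS ?double_gt0//.
by rewrite -[h.*2.+1]/(true + h.*2)%N half_bit_double expnS mul2n.
Qed.

Lemma heap_width_bounds h : (0 < h)%N -> (heap_width h <= h < (heap_width h).*2)%N.
Proof.
by move=> h0; rewrite /heap_width trunc_logP//= -mul2n -expnS trunc_log_ltn.
Qed.

Lemma lo_double h : (0 < h)%N -> lo h.*2 = lo h.
Proof.
move=> h0; rewrite /lo heap_width_double// -!muln2 !natrM.
by rewrite -mulf_div divff ?mulr1// pnatr_eq0.
Qed.

Lemma lo_doubleS h : (0 < h)%N -> lo h.*2.+1 = mid h.
Proof. by move=> h0; rewrite /lo /mid heap_width_doubleS. Qed.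

Lemma hi_double h : (0 < h)%N -> hi h.*2 = mid h.
Proof. by move=> h0; rewrite /hi /mid heap_width_double. Qed.

Lemma hi_doubleS h : (0 < h)%N -> hi h.*2.+1 = hi h.
Proof.
move=> h0; rewrite /hi heap_width_doubleS// -doubleS -!muln2 !natrM.
by rewrite -mulf_div divff ?mulr1// pnatr_eq0.
Qed.

Lemma lo1 : lo 1 = 0.
Proof. by rewrite /lo /heap_width trunc_log1 divr1 subrr. Qed.

Lemma hi1 : hi 1 = 1.
Proof. by rewrite /hi /heap_width trunc_log1 divr1 -[2%:R]/(1 + 1) addrK. Qed.

Lemma lo_ge0 h : (0 < h)%N -> 0 <= lo h.
Proof.
move=> /heap_width_bounds /andP[wh _].
by rewrite /lo subr_ge0 ler_pdivlMr// mul1r ler_nat.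
Qed.

Lemma hi_le1 h : (0 < h)%N -> hi h <= 1.
Proof.
move=> /heap_width_bounds /andP[_ wh].
by rewrite /hi lerBlDr ler_pdivrMr// -[1 + 1]/(2%:R) -natrM ler_nat mul2n.
Qed.

Lemma hi_lo h : hi h = lo h + (heap_width h)%:R^-1.
Proof. by rewrite /hi /lo -natr1 mulrDl mul1r addrAC. Qed.

Lemma mid_lo h : mid h = lo h + (heap_width h)%:R^-1 / 2.
Proof.
rewrite /mid /lo addrAC; congr (_ - 1).
rewrite -natr1 -!muln2 !natrM mulrDl mul1r -mulf_div divff ?mulr1 ?pnatr_eq0//.
by rewrite invfM.
Qed.

Lemma heap_width_tends (d : R) : 0 < d ->
  exists N, forall h, (N <= h)%N -> (heap_width h)%:R^-1 <= d.
Proof.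
move=> d0; exists (Num.truncn (2 / d)).+1 => h Nh.
have h0 : (0 < h)%N by exact: leq_trans Nh.
have /andP[_ hw] := heap_width_bounds h0.
have : 2 / d < (heap_width h).*2%:R.
  apply: lt_trans (truncnS_gt _) _; rewrite ltr_nat; exact: leq_ltn_trans hw.
rewrite -muln2 natrM ltr_pdivrMr// => dw.
rewrite -[_^-1]mul1r ler_pdivrMr//; nra.
Qed.

End DyadicHeap.

(** * Families of evaluations along the heap *)

Section HeapFamilies.
Context {R : realType} {k : ground R} {T A : cstar k} {pt : R -> star_hom T A}.
Hypothesis pt_cont : forall t (e : k), 0 < e -> exists2 d : R, 0 < d &
  forall r s, r \in `[0, 1] -> s \in `[0, 1] -> `|r - s| <= d -> `|pt r t - pt s t| <= e.
Implicit Types (F G : nat -> R) (n h : nat).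

(* Node [h] of the heap sits at position [2h]; the other positions are left
   free, as room for the reindexings. *)
Definition heap_family F n : star_hom T A :=
  if odd n || (n == 0)%N then zero_hom else pt (F n./2).

Lemma heap_family_double F h : (0 < h)%N -> heap_family F h.*2 = pt (F h).
Proof. by move=> h0; rewrite /heap_family odd_double double_eq0 gtn_eqF// doubleK. Qed.

Lemma heap_family_odd F n : odd n -> heap_family F n = zero_hom.
Proof. by rewrite /heap_family => ->. Qed.

Lemma heap_family0 F : heap_family F 0 = zero_hom.
Proof. by []. Qed.

Variant position_spec n : Prop :=
| PositionOdd of odd n
| PositionZero of n = 0%N
| PositionNode h of (0 < h)%N & n = h.*2.

Lemma positionP n : position_spec n.
Proof.
have [on|en] := boolP (odd n); first exact: PositionOdd.
have nE : n = n./2.*2 by rewrite -[LHS]odd_double_half (negbTE en).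
have [n0|n0] := posnP n; first exact: PositionZero.
by apply: (PositionNode _ nE); rewrite -double_gt0 -nE.
Qed.

Definition heap_values F := forall h, (0 < h)%N -> F h \in `[0, 1] /\
  ((1 < h)%N -> lo h <= F h <= hi h).

Lemma heap_family_close F G : heap_values F -> heap_values G ->
  close (heap_family F) (heap_family G).
Proof.
move=> HF HG t e e0; have [d d0 dP] := pt_cont t e0.
have [N HN] := heap_width_tends d0; exists (maxn 4 N.*2) => n.
rewrite geq_max => /andP[n4 Nn]; case: (positionP n) => [on|n0|h h0 nE].
- by rewrite !heap_family_odd// subrr normr0 ltW.
- by rewrite n0 !heap_family0 subrr normr0 ltW.
have h1 : (1 < h)%N by move: n4; rewrite nE -[4%N]/(2.*2) leq_double.
have [F01 /(_ h1)/andP[F1 F2]] := HF h h0; have [G01 /(_ h1)/andP[G1 G2]] := HG h h0.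
rewrite nE !heap_family_double//; apply: dP => //.
have := HN h; rewrite -leq_double -nE => /(_ Nn).
move: F2 G2; rewrite hi_lo ler_norml; lra.
Qed.

Lemma interval_values F h : (0 < h)%N -> lo h <= F h <= hi h -> F h \in `[0, 1].
Proof.
move=> h0 /andP[F1 F2]; rewrite in_itv /=.
by rewrite (le_trans (lo_ge0 h0))//= (le_trans F2)// hi_le1.
Qed.

Lemma lo_le_hi h : (lo h : R) <= hi h.
Proof. by rewrite hi_lo lerDl invr_ge0. Qed.

Lemma mid_between h : (lo h : R) <= (mid h : R) <= hi h.
Proof.
have : 0 <= (heap_width h)%:R^-1 :> R by rewrite invr_ge0.
rewrite mid_lo hi_lo; lra.
Qed.

Lemma heap_values_between F : (forall h, (0 < h)%N -> lo h <= F h <= hi h) -> heap_values F.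
Proof. by move=> H h h0; split=> [|_]; [apply: interval_values|]; rewrite ?H. Qed.

Lemma heap_values_lo : heap_values lo.
Proof. by apply: heap_values_between => h _; rewrite lexx lo_le_hi. Qed.

Lemma heap_values_hi : heap_values hi.
Proof. by apply: heap_values_between => h _; rewrite lexx lo_le_hi. Qed.

Lemma heap_values_mid : heap_values mid.
Proof. by apply: heap_values_between => h _; rewrite mid_between. Qed.

(* The family [lo] with the root moved to 1, and then with all left children
   moved to their right end points. *)
Definition lo_root h : R := if h == 1%N then 1 else lo h.
Definition lo_left h : R := if h == 1%N then 1 else if odd h then lo h else hi h.

Let one01 : (1 : R) \in `[0, 1].
Proof. by rewrite in_itv /= ler01 lexx. Qed.

Lemma heap_values_lo_root : heap_values lo_root.
Proof.
move=> h h0; rewrite /lo_root; case: eqP => [->|_]; first by rewrite ltnn.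
exact: heap_values_lo.
Qed.

Lemma heap_values_lo_left : heap_values lo_left.
Proof.
move=> h h0; rewrite /lo_left; case: eqP => [->|_]; first by rewrite ltnn.
by case: ifP => _; [exact: heap_values_lo|exact: heap_values_hi].
Qed.

(** These maps act on positions, not on nodes: node [h] has position [2h], its children have
    positions [4h] and [4h + 2], and the root has position 2. Empty positions must go injectively to
    empty ones, and 0 to 0; [root_position] sends all but the root to odd positions, where every
    family vanishes. *)
Definition left_child n := if odd n then n else n.*2.
Definition right_child n := if odd n || (n == 0)%N then n else n.*2.+2.
Definition root_position n := if (n <= 2)%N then n else n.*2.+1.

Lemma left_child_inj : injective left_child.
Proof. by move=> a b; rewrite /left_child; do 2![case: ifP]; lia. Qed.

Lemma right_child_inj : injective right_child.
Proof. by move=> a b; rewrite /right_child; do 2![case: ifP]; lia. Qed.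

Lemma root_position_inj : injective root_position.
Proof. by move=> a b; rewrite /root_position; do 2![case: ifP]; lia. Qed.

Lemma left_child_family F G n : (forall h, (0 < h)%N -> F h.*2 = G h) ->
  heap_family F (left_child n) = heap_family G n.
Proof.
move=> FG; rewrite /left_child; case: (positionP n) => [on|->|h h0 ->] //.
  by rewrite on !heap_family_odd.
by rewrite odd_double !heap_family_double ?double_gt0// FG.
Qed.

Lemma left_child_off F G m : (forall h, (0 < h)%N -> odd h -> F h = G h) ->
  (forall n, left_child n <> m) -> heap_family F m = heap_family G m.
Proof.
move=> FG mn; case: (positionP m) => [om|->|h h0 mE] //.
  by rewrite !heap_family_odd.
rewrite mE !heap_family_double// FG//; apply/negPn/negP => eh.
(* For even [h], the position of the parent [h / 2] is [h] itself. *)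
apply: (mn h); rewrite /left_child (negbTE eh) mE//.
Qed.

Lemma right_child_family F G n : (forall h, (0 < h)%N -> F h.*2.+1 = G h) ->
  heap_family F (right_child n) = heap_family G n.
Proof.
move=> FG; rewrite /right_child; case: (positionP n) => [on|->|h h0 ->] //.
  by rewrite on !heap_family_odd.
rewrite odd_double double_eq0 gtn_eqF//= -doubleS heap_family_double//.
by rewrite heap_family_double// FG.
Qed.

Lemma right_child_off F G m : (forall h, (0 < h)%N -> ~~ odd h -> F h = G h) ->
  F 1%N = G 1%N ->
  (forall n, right_child n <> m) -> heap_family F m = heap_family G m.
Proof.
move=> FG FG1 mn; case: (positionP m) => [om|->|h h0 mE] //.
  by rewrite !heap_family_odd.
rewrite mE !heap_family_double//; have [oh|eh] := boolP (odd h); last by rewrite FG.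
have [->|h1] := eqVneq h 1%N; first by rewrite FG1.
(* For odd [h > 1], the parent [(h - 1) / 2] has position [h - 1]. *)
exfalso; apply: (mn h.-1); rewrite /right_child mE; case: ifP; lia.
Qed.

Definition root_family (r : R) n : star_hom T A := if n == 2%N then pt r else zero_hom.

Lemma root_family_off r n : n != 2%N -> root_family r n = zero_hom.
Proof. by rewrite /root_family => /negbTE ->. Qed.

Lemma root_family_close r s : close (root_family r) (root_family s).
Proof.
move=> t e e0; exists 3%N => n n3; rewrite !root_family_off ?gtn_eqF//.
by rewrite subrr normr0 ltW.
Qed.

Lemma root_position_family F n : heap_family F (root_position n) = root_family (F 1%N) n.
Proof.
case: n => [|[|[|n]]] //.
by rewrite heap_family_odd// /root_position /= odd_double.
Qed.

Lemma root_position_off F G m : (forall h, (1 < h)%N -> F h = G h) ->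
  (forall n, root_position n <> m) -> heap_family F m = heap_family G m.
Proof.
move=> FG mn; case: (positionP m) => [om|->|h h0 mE] //.
  by rewrite !heap_family_odd.
rewrite mE !heap_family_double// FG// ltn_neqAle h0 andbT; apply/eqP => h1.
by apply: (mn 2%N); rewrite mE -h1.
Qed.

End HeapFamilies.

(* [lo] and [hi] differ, up to splitting each interval into its halves, by the
   root interval alone; hence the root contributes nothing. *)
Section Swindle.
Local Notation fmap := Defs.fmap.
Context {R : realType} {k : ground R} {KK CI : cstar k} {p : KK} {u : nat -> KK}
  {S : cstar k -> Prop} {E : ab_functor S}.
Hypotheses (HS : admissible KK CI S) (Estable : stable p E) (Esplit : split_additive E)
  (du : diagonal_units p u).
Context {T A : sobj S} {pt : R -> star_hom T A}.
Hypothesis pt_cont : forall t (e : k), 0 < e -> exists2 d : R, 0 < d &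
  forall r s, r \in `[0, 1] -> s \in `[0, 1] -> `|r - s| <= d -> `|pt r t - pt s t| <= e.

Lemma fmap_endpoints v : fmap E (pt 0) v = fmap E (pt 1) v.
Proof.
have [J [tensor mt]] := adm_compact HS A.
have [LT [tau tau_iso]] := cs_concrete T.
have [L [Pi Pi_iso]] := cs_concrete J.
have cl := heap_family_close pt_cont.
pose fam (F : nat -> R) := heap_family (pt := pt) F.
(* The extension of [lo] hosts all comparisons; those of [mid] and of the root alone supply values
   of [Q] to be transferred into it. *)
have [B [mk [i [q mod]]]] := model_ex HS du mt tau_iso Pi_iso (fam lo).
have [B1 [mk1 [i1 [q1 mod1]]]] := model_ex HS du mt tau_iso Pi_iso (fam mid).
have [B2 [mk2 [i2 [q2 mod2]]]] := model_ex HS du mt tau_iso Pi_iso (root_family (pt := pt) 0).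
have lift F : heap_values F -> exists s,
    lifts (tensor := tensor) (u := u) (Pi := Pi) mk (fam lo) (fam F) s.
  by move=> HF; apply: (model_lift du mt Pi_iso mod); apply: cl => //; exact: heap_values_lo.
have [s_lo l_lo] := lift _ heap_values_lo.
have [s_root l_root] := lift _ heap_values_lo_root.
have [s_left l_left] := lift _ heap_values_lo_left.
have [s_mid l_mid] := lift _ heap_values_mid.
have [s_hi l_hi] := lift _ heap_values_hi.
have [s1_mid l1_mid] := model_lift du mt Pi_iso mod1 (close_refl (fam mid)).
have [s1_hi l1_hi] := model_lift du mt Pi_iso mod1 (cl _ _ heap_values_mid heap_values_hi).
have [s2_0 l2_0] := model_lift du mt Pi_iso mod2 (close_refl (root_family (pt := pt) 0)).
have [s2_1 l2_1] := model_lift du mt Pi_iso mod2 (root_family_close 0 1).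
(* From [lo_root] to [lo_left] only the left children move, each from [lo] to [mid] of its parent:
   this is the pair [(lo, mid)] reindexed. *)
have left_step : fmap E s_root v - fmap E s_left v = fmap E s_lo v - fmap E s_mid v.
  have [w wE] := lift_difference Esplit mod v l_lo l_mid; rewrite wE.
  apply: (transfer Estable du mt Pi_iso left_child_inj _ mod mod _ _ _ _ _ l_lo l_mid l_root l_left wE) => //.
  - exact: cl heap_values_lo heap_values_lo_root.
  - move=> n; apply: left_child_family => h h0.
    by rewrite /lo_root ifN ?lo_double//; case: h h0.
  - exact: cl heap_values_lo heap_values_mid.
  - move=> n; apply: left_child_family => h h0.
    by rewrite /lo_left ifN ?odd_double ?hi_double//; case: h h0.
  - by move=> m; apply: left_child_off => h h0 oh; rewrite /lo_left /lo_root oh.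
have [w wE] := lift_difference Esplit mod1 v l1_mid l1_hi.
(* Between [lo_left] and [hi] only the right children move, each from [mid] to [hi] of its
   parent. *)
have right_step : fmap E s_left v - fmap E s_hi v = fmap E i w.
  apply: (transfer Estable du mt Pi_iso right_child_inj _ mod1 mod _ _ _ _ _ l1_mid l1_hi l_left l_hi wE) => //.
  - exact: cl heap_values_lo heap_values_lo_left.
  - move=> n; apply: right_child_family => h h0.
    by rewrite /lo_left ifN /= ?odd_double ?lo_doubleS//; case: h h0.
  - exact: cl heap_values_mid heap_values_hi.
  - by move=> n; apply: right_child_family => h h0; rewrite hi_doubleS.
  (* The root must already be at [hi 1 = 1], which is why it was moved there before the children. *)
  - move=> m; apply: right_child_off => [h h0 eh|]; last by rewrite hi1.
    by rewrite /lo_left (negbTE eh); case: eqP eh => // ->.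
have right_step' : fmap E s_mid v - fmap E s_hi v = fmap E i w.
  apply: (transfer Estable du mt Pi_iso (@inj_id nat) _ mod1 mod _ _ _ _ _ l1_mid l1_hi l_mid l_hi wE) => //.
  - exact: cl heap_values_lo heap_values_mid.
  - exact: cl heap_values_mid heap_values_hi.
  - by move=> m /(_ m).
(* Adding the two halves, root minus hi equals lo minus hi, both being (lo minus mid) plus (mid
   minus hi). *)
have root_step : fmap E s_lo v = fmap E s_root v.
  apply: (addIr (- fmap E s_mid v)); rewrite -left_step; congr (_ - _).
  by apply/oppr_inj/(addIr (fmap E s_hi v)); rewrite ![- _ + _]addrC -[LHS]opprB -[RHS]opprB right_step right_step'.
have [w2 w2E] := lift_difference Esplit mod2 v l2_0 l2_1.
(* [w2] is the contribution of the root interval; in the extension of [lo] it becomes the difference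
   of [s_lo] and [s_root], which vanishes. *)
have w20 : w2 = 0.
  apply: (fmap_model_inj Esplit mod); rewrite raddf0.
  have /esym -> : fmap E s_lo v - fmap E s_root v = fmap E i w2.
    apply: (transfer Estable du mt Pi_iso root_position_inj _ mod2 mod _ _ _ _ _ l2_0 l2_1 l_lo l_root w2E) => //.
    - exact: close_refl.
    - by move=> n; rewrite /fam root_position_family lo1.
    - exact: root_family_close.
    - by move=> n; rewrite /fam root_position_family /lo_root eqxx.
    - move=> m; apply: root_position_off => h h1.
      by rewrite /lo_root gtn_eqF.
  by rewrite root_step subrr.
have s2E : fmap E s2_0 v = fmap E s2_1 v.
  by apply/eqP; rewrite -subr_eq0 w2E w20 raddf0.
(* [pr] turns the two lifts into [pt 0] and [pt 1] followed by the corner at index 2, which is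
   injective on [E]. *)
have [pr prE] := singleton_extension mt du Pi_iso (mod_ext mod2) (root_family_off 0).
have [ps pp] := du_proj du.
have [|j jE] := tensor_corner mt _ (ps 2%N); first by rewrite pp eqxx.
apply: (fmap_corner_inj Estable du mt jE).
rewrite (fmapE (h := sh_comp pr s2_0)); last first.
  by move=> t /=; rewrite jE (prE _ _ (root_family_off 0) l2_0) /root_family eqxx.
rewrite (fmapE (h := sh_comp pr s2_1)); last first.
  by move=> t /=; rewrite jE (prE _ _ (root_family_off 1) l2_1) /root_family eqxx.
by rewrite !Defs.fmap_comp s2E.
Qed.

End Swindle.

Theorem corollary3p4 (R : realType) (k : ground R)
    (H : hilbert k) (Hinf : infinite_dimensional H) (Hsep : separable H)
    (KK : cstar k) (rho : representation KK H) (HKK : is_compact_algebra rho)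
    (p : KK) (Hp : rank_one_projection rho p)
    (CI : cstar k) (ev : CI -> R -> k) (HCI : is_interval_algebra ev)
    (S : cstar k -> Prop) (HS : admissible KK CI S)
    (E : ab_functor S) (Estable : stable p E) (Esplit : split_additive E) :
  homotopy_invariant ev E.
Proof.
move=> A T tensor mt g0 g1 g0E g1E v.
have [u du] := diagonal_units_ex Hinf HKK Hp.
have [e0 e01 _] := rank_one_vector Hp.
(* A total family indexed by [R], with the zero homomorphism as default outside of [[0, 1]]. *)
have /choice [pt ptE] : forall r : R, exists g : star_hom T A,
    r \in `[0, 1] -> forall a f, g (tensor a f) = ev f r *: a.
  move=> r; have [r01|_] := boolP (r \in `[0, 1]); last by exists zero_hom.
  by have [g gE] := evaluation_hom mt HCI e01 r01; exists g.
have -> : g0 = pt 0.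
  apply/star_hom_ext/(star_hom_tensor_ext mt) => a f.
  by rewrite g0E ptE// in_itv /= lexx ler01.
have -> : g1 = pt 1.
  apply/star_hom_ext/(star_hom_tensor_ext mt) => a f.
  by rewrite g1E ptE// in_itv /= lexx ler01.
apply: (fmap_endpoints HS Estable Esplit du).
exact: (evaluation_unif_continuous mt HCI ptE).
Qed.
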